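(* Let $p$ be a prime number. There exists a complete discretely valued field $(E,v)$ with $\operatorname{char} E = 0$ and residue characteristic $\operatorname{char} Ev = p$ such that the existential $\mathcal{L}_{\mathrm{ring}}$-theory of the residue field $Ev$ is decidable, but the existential $\mathcal{L}_{\mathrm{ring}}$-theory of $E$ is undecidable. Furthermore, $E$ can be chosen such that, in addition, the set of one-variable polynomials in $\mathbb{Q}[X]$ having a zero in $E$ is decidable.
   Context: $\mathcal{L}_{\mathrm{ring}} = \{+,-,\cdot,0,1\}$; sentences and polynomials are identified with natural numbers via standard codings. A discretely valued field is a field with a valuation whose value group is isomorphic to $\mathbb{Z}$; complete means complete with respect to this valuation. *)

(* Defs.v *)
From HB Require Import structures.
From mathcomp Require Import all_boot all_order all_algebra.
From mathcomp Require Import generic_quotient ring_quotient.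

Set Implicit Arguments.
Unset Strict Implicit.
Unset Printing Implicit Defensive.

Import Order.TTheory GRing.Theory Num.Theory.

(* Kleene's partial recursive functions.  [recfun n] is the type of programs
   for n-ary functions and [computes f v y] says that f halts on the argument
   tuple v with output y. *)
Inductive recfun : nat -> Type :=
| RZero n : recfun n
| RSucc : recfun 1
| RProj n (i : 'I_n) : recfun n
| RComp m n (f : recfun m) (g : 'I_m -> recfun n) : recfun n
| RPrim n (f : recfun n) (g : recfun n.+2) : recfun n.+1
| RMin n (f : recfun n.+1) : recfun n.

Fixpoint computes n (f : recfun n) : n.-tuple nat -> nat -> Prop :=
  match f in recfun n return n.-tuple nat -> nat -> Prop with
  | RZero n => fun v y => y = 0
  | RSucc => fun v y => y = (thead v).+1
  | RProj n i => fun v y => y = tnth v i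
  | RComp m n f g => fun v y =>
      exists w : m.-tuple nat,
        (forall i, computes (g i) v (tnth w i)) /\ computes f w y
  | RPrim n f g => fun v y =>
      (* h k is the value at (k, v'), where v = (x, v') *)
      exists h : nat -> nat,
        [/\ computes f [tuple of behead v] (h 0),
            forall k, k < thead v ->
              computes g [tuple of k :: h k :: behead v] (h k.+1)
          & y = h (thead v)]
  | RMin n f => fun v y =>
      computes f [tuple of y :: v] 0 /\
      (forall k, k < y -> exists z, computes f [tuple of k :: v] z.+1)
  end.

Definition decidable_set (A : nat -> Prop) : Prop :=
  exists f : recfun 1, forall n,
    (A n -> computes f [tuple n] 1) /\ (~ A n -> computes f [tuple n] 0).

Definition codes (T : Type) (code : T -> nat) (A : T -> Prop) : nat -> Prop :=
  fun n => exists2 a, A a & code a = n.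

(* Cantor's bijection between pairs of naturals and naturals. *)
Definition cpair (x y : nat) : nat := 'C((x + y).+1, 2) + y.

Fixpoint seq_code (s : seq nat) : nat :=
  if s is x :: s' then (cpair x (seq_code s')).+1 else 0.

Definition int_code (z : int) : nat :=
  match z with Posz n => n.*2 | Negz n => n.*2.+1 end.

Definition rat_code (q : rat) : nat := cpair (int_code (numq q)) `|denq q|.

Definition poly_code (P : {poly rat}) : nat := seq_code (map rat_code P).

(* First-order syntax of rings, with variables named by natural numbers. *)
Inductive term : Type :=
| TVar of nat
| TZero
| TOne
| TAdd of term & term
| TOpp of term
| TMul of term & term.

Inductive formula : Type :=
| FEq of term & term
| FNot of formula
| FAnd of formula & formula
| FOr of formula & formula
| FEx of nat & formula
| FAll of nat & formula.

Fixpoint term_code (t : term) : nat :=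
  match t with
  | TVar i => cpair 0 i
  | TZero => cpair 1 0
  | TOne => cpair 2 0
  | TAdd t u => cpair 3 (cpair (term_code t) (term_code u))
  | TOpp t => cpair 4 (term_code t)
  | TMul t u => cpair 5 (cpair (term_code t) (term_code u))
  end.

Fixpoint formula_code (f : formula) : nat :=
  match f with
  | FEq t u => cpair 0 (cpair (term_code t) (term_code u))
  | FNot f => cpair 1 (formula_code f)
  | FAnd f g => cpair 2 (cpair (formula_code f) (formula_code g))
  | FOr f g => cpair 3 (cpair (formula_code f) (formula_code g))
  | FEx i f => cpair 4 (cpair i (formula_code f))
  | FAll i f => cpair 5 (cpair i (formula_code f))
  end.

Fixpoint term_vars (t : term) : seq nat :=
  match t with
  | TVar i => [:: i]
  | TZero | TOne => [::]
  | TAdd t u | TMul t u => term_vars t ++ term_vars u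
  | TOpp t => term_vars t
  end.

Fixpoint free_vars (f : formula) : seq nat :=
  match f with
  | FEq t u => term_vars t ++ term_vars u
  | FNot f => free_vars f
  | FAnd f g | FOr f g => free_vars f ++ free_vars g
  | FEx i f | FAll i f => [seq j <- free_vars f | j != i]
  end.

Definition sentence (f : formula) : bool := nilp (free_vars f).

Fixpoint quantifier_free (f : formula) : bool :=
  match f with
  | FEq _ _ => true
  | FNot f => quantifier_free f
  | FAnd f g | FOr f g => quantifier_free f && quantifier_free g
  | FEx _ _ | FAll _ _ => false
  end.

Fixpoint existential (f : formula) : bool :=
  if f is FEx _ g then existential g else quantifier_free f.

Local Open Scope ring_scope.
Local Open Scope quotient_scope.

Fixpoint teval (R : nzRingType) (e : nat -> R) (t : term) : R :=
  match t with
  | TVar i => e i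
  | TZero => 0
  | TOne => 1
  | TAdd t u => teval e t + teval e u
  | TOpp t => - teval e t
  | TMul t u => teval e t * teval e u
  end.

Fixpoint holds (R : nzRingType) (e : nat -> R) (f : formula) : Prop :=
  match f with
  | FEq t u => teval e t = teval e u
  | FNot f => ~ holds e f
  | FAnd f g => holds e f /\ holds e g
  | FOr f g => holds e f \/ holds e g
  | FEx i f => exists x : R, holds [eta e with i |-> x] f
  | FAll i f => forall x : R, holds [eta e with i |-> x] f
  end.

(* The assignment used to evaluate a sentence is irrelevant. *)
Definition existential_theory (R : nzRingType) (f : formula) : Prop :=
  [/\ sentence f, existential f & holds (fun _ : nat => 0 : R) f].

Definition has_zero (E : fieldType) (P : {poly rat}) : Prop :=
  exists x : E, root (map_poly ratr P) x.

(* Valuations with value group identified with the integers.  The value at 0,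
   which should be +oo, is unconstrained and never used. *)
Record discrete_valuation (E : fieldType) := DiscreteValuation {
  dval :> E -> int;
  dvalM : forall x y, x != 0 -> y != 0 -> dval (x * y) = dval x + dval y;
  dvalD : forall x y, x != 0 -> y != 0 -> x + y != 0 ->
    Num.min (dval x) (dval y) <= dval (x + y);
  dval_surj : forall n : int, exists2 x, x != 0 & dval x = n
}.

Section Valuation.

Variables (E : fieldType) (v : discrete_valuation E).

(* n <= v x, with v 0 = +oo. *)
Definition dval_ge (n : int) (x : E) : bool := (x == 0) || (n <= v x).

Definition dval_cauchy (u : nat -> E) : Prop :=
  forall n : int, exists N : nat, forall i j : nat,
    (N <= i)%N -> (N <= j)%N -> dval_ge n (u i - u j).

Definition dval_cvg (u : nat -> E) (l : E) : Prop :=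
  forall n : int, exists N : nat, forall i : nat,
    (N <= i)%N -> dval_ge n (u i - l).

Definition dval_complete : Prop :=
  forall u, dval_cauchy u -> exists l, dval_cvg u l.

Lemma dval1 : v 1 = 0.
Proof.
have /eqP := dvalM v (oner_neq0 E) (oner_neq0 E).
by rewrite mulr1 -subr_eq subrr eq_sym => /eqP.
Qed.

Lemma dvalN1 : v (-1) = 0.
Proof.
have n1 : (-1 : E) != 0 by rewrite oppr_eq0 oner_neq0.
have := dvalM v n1 n1; rewrite mulrNN mulr1 dval1 -mulr2n => /esym/eqP.
by rewrite mulrn_eq0 => /eqP.
Qed.

Lemma dvalV x : x != 0 -> v x^-1 = - v x.
Proof.
move=> x0; have xV0 : x^-1 != 0 by rewrite invr_eq0.
have := dvalM v x0 xV0; rewrite divff // dval1 => /esym/eqP.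
by rewrite addrC addr_eq0 => /eqP.
Qed.

Lemma dval_ge0 n : dval_ge n 0. Proof. by rewrite /dval_ge eqxx. Qed.

Lemma dval_ge_le m n x : n <= m -> dval_ge m x -> dval_ge n x.
Proof.
move=> nm /orP[x0|mx]; first by rewrite /dval_ge x0.
by rewrite /dval_ge (le_trans nm mx) orbT.
Qed.

Lemma dval_geM m n x y : dval_ge m x -> dval_ge n y -> dval_ge (m + n) (x * y).
Proof.
rewrite /dval_ge mulf_eq0.
case: (eqVneq x 0) => //= x0; case: (eqVneq y 0) => //= y0 mx ny.
by rewrite dvalM // lerD.
Qed.

Lemma dval_geD n x y : dval_ge n x -> dval_ge n y -> dval_ge n (x + y).
Proof.
rewrite /dval_ge.
case: (eqVneq x 0) => [->|x0]; first by rewrite add0r.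
case: (eqVneq y 0) => [->|y0]; first by rewrite addr0 (negPf x0).
case: (eqVneq (x + y) 0) => //= xy0 nx ny.
by apply: le_trans (dvalD v x0 y0 xy0); rewrite le_min nx ny.
Qed.

Lemma dval_geN n x : dval_ge n x -> dval_ge n (- x).
Proof.
move=> nx; rewrite -mulN1r -[n]add0r dval_geM //.
by rewrite /dval_ge dvalN1 lexx orbT.
Qed.

(* The valuation ring and its maximal ideal. *)
Definition vring_pred : {pred E} := fun x => dval_ge 0 x.

Lemma vring_subring : subring_closed vring_pred.
Proof.
split=> [|x y|x y].
- by rewrite unfold_in /dval_ge dval1 lexx orbT.
- by move=> vx vy; apply: dval_geD => //; apply: dval_geN.
- by move=> vx vy; apply: (dval_geM vx vy).
Qed.

HB.instance Definition _ :=
  GRing.isSubringClosed.Build E vring_pred vring_subring.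

Record vring := VRing { vring_val :> E; _ : vring_val \in vring_pred }.

HB.instance Definition _ := [isSub for vring_val].
HB.instance Definition _ := [Choice of vring by <:].
HB.instance Definition _ := [SubChoice_isSubComNzRing of vring by <:].

Definition vmax : {pred vring} := fun x => dval_ge 1 (val x).

Lemma vmax_idealr : idealr_closed vmax.
Proof.
split=> [||a x y].
- by rewrite unfold_in /= dval_ge0.
- by rewrite unfold_in /= /dval_ge dval1 oner_eq0.
- move=> vx vy; rewrite unfold_in /=; apply: dval_geD => //.
  exact: (dval_geM (valP a) vx).
Qed.

HB.instance Definition _ := isIdealr.Build vring vmax vmax_idealr.

Definition residue_field : Type := {ideal_quot vmax}.

HB.instance Definition _ := GRing.ComNzRing.on residue_field.

Lemma vring_inv_subproof (x : vring) :
  x \notin vmax -> (val x)^-1 \in vring_pred.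
Proof.
have := valP x; rewrite !unfold_in /dval_ge /= => /orP[->//|x0].
rewrite negb_or -ltNge => /andP[xn0 x1].
have vx0 : v (val x) = 0 by apply/le_anti; rewrite x0 -ltzD1 x1.
by rewrite dvalV // vx0 oppr0 lexx orbT.
Qed.

Definition vring_inv (x : vring) : vring :=
  insubd 0 (val x)^-1.

Definition residue_inv (x : residue_field) : residue_field :=
  if x == 0 then 0 else \pi_residue_field (vring_inv (repr x)).

Lemma residue_mulVf x : x != 0 -> residue_inv x * x = 1.
Proof.
move=> x0; rewrite /residue_inv (negPf x0).
have yNm : repr x \notin vmax.
  apply: contra x0 => ym; rewrite -[x]reprK.
  by rewrite -[repr x]subr0 Quotient.idealrBE in ym; rewrite (eqP ym) rmorph0.
rewrite -[X in _ * X]reprK -rmorphM -[RHS](rmorph1 \pi_{ideal_quot vmax}).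
congr (\pi _); apply: val_inj.
rewrite rmorphM /= insubdK ?vring_inv_subproof // mulVf //.
by apply: contraNneq yNm => y0; rewrite unfold_in /= y0 dval_ge0.
Qed.

Lemma residue_inv0 : residue_inv 0 = 0.
Proof. by rewrite /residue_inv eqxx. Qed.

HB.instance Definition _ :=
  GRing.ComNzRing_isField.Build residue_field residue_mulVf residue_inv0.

End Valuation.

(* Main.v *)
(* For a set A of primes l <> p, let E_A be the fraction field of an ultraproduct of
   truncated local rings Z[X, Y] / (m_i, Y^p + p c_i Y - p), where m_i lifts the
   minimal polynomial of a root of unity in an algebraic closure of F_p.  It is
   complete and discretely valued, with a uniformizer pi such that
   pi^p = p (1 - c pi), where the residue of c is not algebraic over F_p and c
   is an l-th power if and only if l is in A.  The residue of c is determined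
   by this equation, so A can be read off the existential theory of E_A; as
   there are only countably many programs, this theory is undecidable for
   some A.

   The residue field contains zeros of all monic integer polynomials, so its
   existential sentences are those that hold in some field of characteristic p,
   since solutions specialize to an algebraic closure of F_p.  A rational
   polynomial has a zero in E_A if and only if it has one in a field with a
   valuation for which p is a uniformizer: the elements of a number field
   contained in E_A have no valuation strictly between 0 and v(p), for
   otherwise the residue of c would be algebraic.

   Both criteria are made effective by pairs of finite coherent theories over
   the natural numbers, whose inconsistency is semidecidable.  The models of the
   first one are solutions in some field; such a solution yields a finite
   certificate (a generator of a finite residue field and, for polynomials, an
   approximate zero to which Hensel's lemma applies), and the second theory is
   inconsistent as soon as a certificate exists. *)

From HB Require Import structures.
From mathcomp Require Import all_boot all_order all_algebra all_field cyclic.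
From mathcomp Require Import generic_quotient ring_quotient fraction.
From mathcomp Require Import boolp.
From mathcomp Require classical_sets functions filter.
From mathcomp Require Import zify ring lra.
Require Import Defs.

Set Implicit Arguments.
Unset Strict Implicit.
Unset Printing Implicit Defensive.

(** * Recursive functions *)

(** Ramification of degree [p] is what makes the twist rigid: a uniformizer with [pi ^+ p = p * u]
    and [u] congruent to 1 can be rescaled only by elements congruent to 1, as the residue field has
    no nontrivial p-th roots of unity, and such a rescaling does not move the first-order
    coefficient of [u]. So the field remembers one residue [c], although its residue field carries
    no constant. The ultraproduct meets two opposite demands. Each factor has a finite residue
    field, where l-th powers and Frobenius are controlled by the order of a root of unity; in the
    limit [c] leaves every finite field. An ultraproduct would have a nonstandard value group, so
    sequences of infinite valuation are divided out, and completeness follows by a diagonal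
    argument. Decidability must be witnessed by Kleene programs. To avoid programming algebra in
    that language, the only program whose correctness is proved checks refutation traces. Everything
    else is an argument about models, supplied by a completeness theorem. *)

Definition push (k : nat) (e : nat -> nat) (i : nat) : nat :=
  if i is j.+1 then e j else k.

Notation "k .: e" := (push k e) (at level 60, right associativity).

Lemma nth_push k (s : seq nat) : nth 0 (k :: s) = k .: nth 0 s.
Proof. by apply/funext; case. Qed.

(* The arguments of an n-ary function are presented as an environment, its
   value outside [0, n) being 0. *)
Definition rc n (F : (nat -> nat) -> nat) : Prop :=
  exists f : recfun n, forall v : n.-tuple nat, computes f v (F (nth 0 v)).

Lemma rc_ext n F G :
  (forall v : n.-tuple nat, F (nth 0 v) = G (nth 0 v)) -> rc n F -> rc n G.
Proof. by move=> FG [f Hf]; exists f => v; rewrite -FG. Qed.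

Lemma rc_var n i : i < n -> rc n (fun e => e i).
Proof.
by move=> i_n; exists (RProj (Ordinal i_n)) => v /=; rewrite (tnth_nth 0).
Qed.

Lemma rc_comp m n G (Fs : nat -> (nat -> nat) -> nat) :
  rc m G -> (forall i, i < m -> rc n (Fs i)) ->
  rc n (fun e => G (nth 0 (mkseq (fun i => Fs i e) m))).
Proof.
move=> [g Hg] HF.
have /choice[fs Hfs] : forall i : 'I_m, exists f : recfun n,
    forall v : n.-tuple nat, computes f v (Fs i (nth 0 v)).
  by move=> i; apply: HF.
exists (RComp g fs) => v /=.
exists (mktuple (fun i : 'I_m => Fs i (nth 0 v))); split.
  by move=> i; rewrite tnth_mktuple.
set t := mktuple _; suff <- : nth 0 t = nth 0 (mkseq (Fs^~ (nth 0 v)) m) by [].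
congr nth; apply: (@eq_from_nth _ 0); rewrite size_tuple ?size_mkseq //.
move=> i im; rewrite nth_mkseq // -(tnth_nth 0 t (Ordinal im)).
by rewrite tnth_mktuple.
Qed.

Lemma rc_sub n P K :
  rc n.+1 P -> rc n K -> rc n (fun e => P (K e .: e)).
Proof.
move=> HP HK.
apply: (@rc_ext _ (fun e => P (nth 0 (mkseq
  (fun i => (if i is j.+1 then fun e => e j else K) e) n.+1)))).
  move=> v; congr P; apply/funext => i.
  case: (ltnP i n.+1) => hi; first by rewrite nth_mkseq //; case: i hi.
  rewrite nth_default ?size_mkseq //; case: i hi => //= i hi.
  by rewrite nth_default // size_tuple.
by apply: rc_comp => // -[|i] // hi; apply: rc_var.
Qed.

Lemma rc_op1 (g : nat -> nat) n F :
  rc 1 (fun e => g (e 0)) -> rc n F -> rc n (fun e => g (F e)).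
Proof.
move=> Hg HF.
by have := @rc_comp 1 n (fun e => g (e 0)) (fun=> F) Hg (fun _ _ => HF).
Qed.

Lemma rc_op2 (g : nat -> nat -> nat) n F F' :
  rc 2 (fun e => g (e 0) (e 1)) -> rc n F -> rc n F' ->
  rc n (fun e => g (F e) (F' e)).
Proof.
move=> Hg HF HF'.
have := @rc_comp 2 n _ (fun i => if i is 0 then F else F') Hg.
by apply; case.
Qed.

Lemma rc_succ n F : rc n F -> rc n (fun e => (F e).+1).
Proof.
apply: (rc_op1 (g := S)); exists RSucc => v /=.
by rewrite /thead (tnth_nth 0).
Qed.

Lemma rc_const n k : rc n (fun=> k).
Proof.
by elim: k => [|k IH]; [exists (RZero n) => v | apply: rc_succ].
Qed.

Lemma rc_rec n K B S :
  rc n K -> rc n B -> rc n.+2 S ->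
  rc n (fun e => nat_rect (fun=> nat) (B e) (fun k h => S (k .: h .: e)) (K e)).
Proof.
move=> HK [b Hb] [s Hs].
pose P e := nat_rect (fun=> nat) (B (fun i => e i.+1))
  (fun k h => S (k .: h .: (fun i => e i.+1))) (e 0).
apply: (rc_sub (P := P)) HK; exists (RPrim b s) => v /=.
have Ev : (fun i => nth 0 v i.+1) = nth 0 (behead v).
  by apply/funext => i; rewrite nth_behead.
exists (nat_rect (fun=> nat) (B (fun i => nth 0 v i.+1))
  (fun k h => S (k .: h .: (fun i => nth 0 v i.+1)))).
split; last by rewrite /P /thead (tnth_nth 0).
- by rewrite /= Ev; apply: Hb.
- by move=> k _ /=; rewrite Ev -!nth_push; apply: Hs.
Qed.

Lemma rc_min n F G : rc n.+1 F ->
  (forall e, F (G e .: e) = 0) -> (forall e k, k < G e -> F (k .: e) != 0) ->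
  rc n G.
Proof.
move=> [f Hf] F0 Fn0; exists (RMin f) => v /=; split.
  by have := Hf [tuple of G (nth 0 v) :: v]; rewrite nth_push F0.
move=> k kG; exists (F (k .: nth 0 v)).-1.
rewrite prednK ?lt0n ?Fn0 //.
by have := Hf [tuple of k :: v]; rewrite nth_push.
Qed.

Ltac rc_base := first
  [ exact: rc_const | exact: rc_var | assumption | apply: rc_succ ].
Ltac rc_step := rc_base.
Ltac rcs := repeat rc_step.

Lemma rc_add n F F' : rc n F -> rc n F' -> rc n (fun e => F e + F' e).
Proof.
apply: (rc_op2 (g := addn)).
refine (rc_ext _ (@rc_rec 2 (fun e => e 1) (fun e => e 0) (fun e => (e 1).+1) _ _ _)) => [v /=|||].
- by elim: (nth 0 v 1) => [|k /= ->]; rewrite ?addn0 ?addnS.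
- by rcs.
- by rcs.
- by rcs.
Qed.

Ltac rc_step ::= first [ rc_base | apply: rc_add ].

Lemma rc_mul n F F' : rc n F -> rc n F' -> rc n (fun e => F e * F' e).
Proof.
apply: (rc_op2 (g := muln)).
refine (rc_ext _ (@rc_rec 2 (fun e => e 1) (fun=> 0) (fun e => e 1 + e 2) _ _ _)) => [v /=|||].
- by elim: (nth 0 v 1) => [|k /= ->]; rewrite ?muln0 ?mulnSr.
- by rcs.
- by rcs.
- by rcs.
Qed.

Lemma rc_pred n F : rc n F -> rc n (fun e => (F e).-1).
Proof.
apply: (rc_op1 (g := predn)).
refine (rc_ext _ (@rc_rec 1 (fun e => e 0) (fun=> 0) (fun e => e 0) _ _ _)) => [v /=|||].
- by case: (nth 0 v 0).
- by rcs.
- by rcs.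
- by rcs.
Qed.

Ltac rc_step ::= first [ rc_base | apply: rc_pred ].

Lemma rc_subn n F F' : rc n F -> rc n F' -> rc n (fun e => F e - F' e).
Proof.
apply: (rc_op2 (g := subn)).
refine (rc_ext _ (@rc_rec 2 (fun e => e 1) (fun e => e 0) (fun e => (e 1).-1) _ _ _)) => [v /=|||].
- by elim: (nth 0 v 1) => [|k /= ->]; rewrite ?subn0 ?subnS.
- by rcs.
- by rcs.
- by rcs.
Qed.

Ltac rc_step ::= first
  [ rc_base
  | apply: rc_pred | apply: rc_add | apply: rc_mul | apply: rc_subn ].

(* Recursive predicates are represented by 0/1-valued functions. *)
Notation rp n P := (rc n (fun e => nat_of_bool (P e))).

Lemma rp_not n P : rp n P -> rp n (fun e => ~~ P e).
Proof.
move=> HP; apply: (@rc_ext _ (fun e => 1 - P e)); first by move=> v; case: (P _).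
by apply: rc_subn => //; exact: rc_const.
Qed.

Lemma rp_and n P Q : rp n P -> rp n Q -> rp n (fun e => P e && Q e).
Proof.
move=> HP HQ; apply: (@rc_ext _ (fun e => P e * Q e)).
  by move=> v; rewrite mulnb.
exact: rc_mul.
Qed.

Lemma rp_or n P Q : rp n P -> rp n Q -> rp n (fun e => P e || Q e).
Proof.
move=> HP HQ; apply: (@rc_ext _ (fun e => ~~ (~~ P e && ~~ Q e))).
  by move=> v; rewrite negb_and !negbK.
by apply/rp_not/rp_and; apply: rp_not.
Qed.

Lemma rp_leq n F F' : rc n F -> rc n F' -> rp n (fun e => F e <= F' e).
Proof.
move=> HF HF'; apply: (@rc_ext _ (fun e => 1 - (F e - F' e))).
  by move=> v; rewrite /leq; case: (F _ - _).
by apply: rc_subn; [exact: rc_const | exact: rc_subn].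
Qed.

Lemma rp_eq n F F' : rc n F -> rc n F' -> rp n (fun e => F e == F' e).
Proof.
move=> HF HF'; apply: (@rc_ext _ (fun e => (F e <= F' e) && (F' e <= F e))).
  by move=> v; rewrite eqn_leq.
by apply: rp_and; apply: rp_leq.
Qed.

Lemma rp_bex n P K : rp n.+1 P -> rc n K ->
  rp n (fun e => has (fun k => P (k .: e)) (iota 0 (K e))).
Proof.
move=> HP HK.
(* Slot 0 holds the counter and slot 1 the truth value found so far; [P] must not see the latter,
   hence the shift by two. *)
pose S e := (P (e 0 .: fun i => e i.+2) || (e 1 != 0)) : nat.
suff HS : rc n.+2 S.
  apply: rc_ext _ (rc_rec HK (rc_const n 0) HS) => v.
  elim: (K _) => // k; cbn [nat_rect] => ->.
  by rewrite -[k.+1]addn1 iotaD has_cat /S /= orbF orbC eqb0 negbK.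
apply: rp_or; last by apply/rp_not/rp_eq; [exact: rc_var | exact: rc_const].
apply: (@rc_ext _ (fun e => P (nth 0 (mkseq (fun i =>
    e (if i is j.+1 then j.+2 else 0)) n.+1)))).
  move=> v; congr (nat_of_bool (P _)); apply/funext => i.
  case: (ltnP i n.+1) => hi; first by rewrite nth_mkseq //; case: i hi.
  rewrite [LHS]nth_default ?size_mkseq //; case: i hi => //= i hi.
  by rewrite nth_default // size_tuple.
by apply: (rc_comp (G := fun e => nat_of_bool (P e))) => // -[|i] hi;
  apply: rc_var.
Qed.

Lemma rp_ball n P K : rp n.+1 P -> rc n K ->
  rp n (fun e => all (fun k => P (k .: e)) (iota 0 (K e))).
Proof.
move=> HP HK.
apply: (@rc_ext _ (fun e => ~~ has (fun k => ~~ P (k .: e)) (iota 0 (K e)))).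
  by move=> v; rewrite has_predC negbK.
apply/rp_not/(rp_bex (P := fun e => ~~ P e)) => //; exact: rp_not.
Qed.

(** * Cantor's pairing *)

(** Walks along the antidiagonals, so that the n-th iterate from [(0, 0)] inverts Cantor's bijection
    at [n]. *)
Definition unpair_step (xy : nat * nat) : nat * nat :=
  if xy.1 is x.+1 then (x, xy.2.+1) else (xy.2.+1, 0).

Definition unpair n := iter n unpair_step (0, 0).
Definition c1 n := (unpair n).1.
Definition c2 n := (unpair n).2.

Lemma cpair_unpair n : cpair (c1 n) (c2 n) = n.
Proof.
rewrite /c1 /c2; elim: n => //= n IH.
rewrite /unpair_step; case: (unpair n) IH => -[|x] y /= <-; rewrite /cpair.
- by rewrite !addn0 add0n; have := binS y.+1 1; rewrite bin1; lia.
- by rewrite addSn addnS addnS.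
Qed.

Lemma cpair_inj x y x' y' : cpair x y = cpair x' y' -> x = x' /\ y = y'.
Proof.
have mono s s' y1 y2 : y1 <= s -> s < s' -> 'C(s.+1, 2) + y1 < 'C(s'.+1, 2) + y2.
  move=> y1s ss'; apply: leq_trans (leq_addr _ _).
  apply: (@leq_trans 'C(s.+2, 2)); last by rewrite leq_bin2l.
  by rewrite [X in _ < X]binS bin1; lia.
rewrite /cpair => E; case: (ltngtP (x + y) (x' + y')) => h.
- by have := mono _ _ y y' (leq_addl _ _) h; rewrite E ltnn.
- by have := mono _ _ y' y (leq_addl _ _) h; rewrite E ltnn.
- by move: E; rewrite h; lia.
Qed.

Lemma c1K x y : c1 (cpair x y) = x.
Proof. by have [] := cpair_inj (cpair_unpair (cpair x y)). Qed.

Lemma c2K x y : c2 (cpair x y) = y.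
Proof. by have [] := cpair_inj (cpair_unpair (cpair x y)). Qed.

Lemma cpair_ge2 x y : y <= cpair x y.
Proof. exact: leq_addl. Qed.

Lemma cpair_ge1 x y : x <= cpair x y.
Proof. by rewrite /cpair binS bin1; lia. Qed.

Lemma cpair_gt2 x y : 0 < x -> y < cpair x y.
Proof. by move=> x0; rewrite /cpair binS bin1; lia. Qed.

Lemma c2_lt x : 0 < x -> c2 x < x.
Proof.
rewrite -{1 3}(cpair_unpair x); case: (c1 x) => [|a] x0; last exact: cpair_gt2.
by move: x0; rewrite /cpair add0n binS bin1; lia.
Qed.

Lemma c1_le x : c1 x <= x.
Proof. by rewrite -{2}(cpair_unpair x) cpair_ge1. Qed.

Lemma c2_le x : c2 x <= x.
Proof. by rewrite -{2}(cpair_unpair x) cpair_ge2. Qed.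

Lemma rc_cpair n F F' : rc n F -> rc n F' -> rc n (fun e => cpair (F e) (F' e)).
Proof.
apply: (rc_op2 (g := cpair)).
pose T s := nat_rect (fun=> nat) 0 (fun k h => h + k.+1) s.
apply: (@rc_ext _ (fun e => T (e 0 + e 1) + e 1)).
  move=> v; rewrite [RHS]/(cpair _ _); congr (_ + _).
  by elim: (_ + _) => // s IH; rewrite [RHS]binS bin1 -IH.
apply: rc_add; last exact: rc_var.
apply: (rc_op1 (g := T)); last by apply: rc_add; apply: rc_var.
by apply: (@rc_rec 1 (fun e => e 0) (fun=> 0) (fun e => e 1 + (e 0).+1)); rcs.
Qed.

#[global] Opaque cpair.

(** A projection is found by searching for it, the other component being bounded by the code; this
    avoids computing with the pairs of [unpair_step]. *)
Lemma rc_c1 n F : rc n F -> rc n (fun e => c1 (F e)).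
Proof.
apply: (rc_op1 (g := c1)).
pose P e := ~~ has (fun y => cpair ((y .: e) 1) ((y .: e) 0) == (y .: e) 2)
  (iota 0 (e 1).+1).
apply: (@rc_min 1 (fun e => P e)).
- apply/rp_not/(rp_bex (P := fun e => cpair (e 1) (e 0) == e 2)).
    by apply: rp_eq; [apply: rc_cpair; exact: rc_var | exact: rc_var].
  exact/rc_succ/rc_var.
- move=> e; apply/eqP; rewrite eqb0 negbK; apply/hasP; exists (c2 (e 0)).
    by rewrite mem_iota /= ltnS c2_le.
  by rewrite cpair_unpair.
- move=> e k kc; rewrite eqb0 negbK; apply/hasPn => y _ /=.
  by apply/eqP => E; move: kc; rewrite -E c1K ltnn.
Qed.

Lemma rc_c2 n F : rc n F -> rc n (fun e => c2 (F e)).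
Proof.
apply: (rc_op1 (g := c2)).
pose P e := ~~ has (fun y => cpair ((y .: e) 0) ((y .: e) 1) == (y .: e) 2)
  (iota 0 (e 1).+1).
apply: (@rc_min 1 (fun e => P e)).
- apply/rp_not/(rp_bex (P := fun e => cpair (e 0) (e 1) == e 2)).
    by apply: rp_eq; [apply: rc_cpair; exact: rc_var | exact: rc_var].
  exact/rc_succ/rc_var.
- move=> e; apply/eqP; rewrite eqb0 negbK; apply/hasP; exists (c1 (e 0)).
    by rewrite mem_iota /= ltnS c1_le.
  by rewrite cpair_unpair.
- move=> e k kc; rewrite eqb0 negbK; apply/hasPn => y _ /=.
  by apply/eqP => E; move: kc; rewrite -E c2K ltnn.
Qed.

Ltac rc_step ::= first
  [ rc_base
  | apply: rc_pred | apply: rc_add | apply: rc_mul | apply: rc_subn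
  | apply: rc_c1 | apply: rc_c2 | apply: rc_cpair ].

(* A number codes an eventually vanishing sequence. *)
Definition cn l i := c1 (iter i c2 l).

Lemma cn0 x l : cn (cpair x l) 0 = x. Proof. exact: c1K. Qed.

Lemma cnS x l i : cn (cpair x l) i.+1 = cn l i.
Proof. by rewrite /cn iterSr c2K. Qed.

Definition cseq (s : seq nat) : nat := foldr cpair 0 s.

Lemma cn_cseq s : cn (cseq s) = nth 0 s.
Proof.
apply/funext; elim: s => [|x s IH] i /=.
  rewrite nth_nil /cn; suff -> : iter i c2 0 = 0 by [].
  by elim: i => //= i ->.
by case: i => [|i]; rewrite ?cn0 ?cnS ?IH.
Qed.

Ltac rc_step ::= first [ rc_base | apply: rc_c2 ].

Lemma rc_cn n F F' : rc n F -> rc n F' -> rc n (fun e => cn (F e) (F' e)).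
Proof.
apply: (rc_op2 (g := cn)); apply: rc_c1.
refine (rc_ext _ (@rc_rec 2 (fun e => e 1) (fun e => e 0) (fun e => c2 (e 1)) _ _ _)) => [v /=|||].
- by elim: (nth 0 v 1) => //= k ->.
- by rcs.
- by rcs.
- by rcs.
Qed.

Ltac rc_step ::= first
  [ exact: rc_const | exact: rc_var | assumption
  | apply: rc_cpair | apply: rc_cn | apply: rc_c1 | apply: rc_c2
  | apply: rc_succ | apply: rc_pred | apply: rc_add | apply: rc_mul
  | apply: rc_subn ].

(** * Semidecidable sets *)

Definition semi (A : nat -> Prop) : Prop :=
  exists2 F : nat -> nat -> bool, rp 2 (fun e => F (e 0) (e 1)) &
    forall n, A n <-> exists k, F k n.

Lemma semi_ext A B : (forall n, A n <-> B n) -> semi A -> semi B.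
Proof. by move=> AB [F HF AF]; exists F => // n; rewrite -AB. Qed.

(** Post's theorem: both searches run in parallel, and excluded middle shows that one of them
    stops. *)
Lemma semi_decidable A : semi A -> semi (fun n => ~ A n) -> decidable_set A.
Proof.
move=> [F HF AF] [G HG BG].
have ex n : exists k, F k n || G k n.
  case: (pselect (A n)) => [/AF[k h]|/BG[k h]]; exists k; rewrite h ?orbT //.
have [f Hf] : rp 1 (fun e => F (ex_minn (ex (e 0))) (e 0)).
  apply: (rc_op2 (g := fun x y => nat_of_bool (F x y))) => //; last by rcs.
  apply: (rc_min (F := fun e => ~~ (F (e 0) (e 1) || G (e 0) (e 1)))).
  - by apply/rp_not/rp_or.
  - by move=> e /=; case: ex_minnP => k ->.
  - move=> e k /=; case: ex_minnP => m _ h km; rewrite eqb0 negbK.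
    by apply/negP => /h; rewrite leqNgt km.
exists f => n; have := Hf [tuple n]; rewrite /=.
case: ex_minnP => k h _; case E: (F k n) h => /= h Hn; split=> // An.
- by case: An; apply/AF; exists k.
- by have /BG : exists k, G k n by [exists k].
Qed.

(** * Coherent theories over the natural numbers *)

(** Codes are built and matched by pairing and successor alone, so a rule is finite data and its
    instantiation is recursive. *)
Inductive pat : Type :=
| PV of nat
| PN of nat
| PS of pat
| PP of pat & pat.

Fixpoint inst (e : nat -> nat) (q : pat) : nat :=
  match q with
  | PV i => e i
  | PN k => k
  | PS q => (inst e q).+1
  | PP q r => cpair (inst e q) (inst e r)
  end.

Fixpoint Pall (T : Type) (P : T -> Prop) (s : seq T) : Prop :=
  if s is x :: s' then P x /\ Pall P s' else True.

Fixpoint Pex (T : Type) (P : T -> Prop) (s : seq T) : Prop :=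
  if s is x :: s' then P x \/ Pex P s' else False.

Lemma PallP T (P : T -> Prop) s : Pall P s <-> forall x, List.In x s -> P x.
Proof.
elim: s => [|x s IH] /=; first by split.
by rewrite IH; split=> [[Px H] y [<-|/H]|H] //; split=> *; apply: H; auto.
Qed.

Lemma PexP T (P : T -> Prop) s : Pex P s <-> exists2 x, List.In x s & P x.
Proof.
elim: s => [|x s IH] /=; first by split=> // -[].
rewrite IH; split=> [[Px|[y ys Py]]|[y [<-|ys] Py]]; first by exists x; auto.
- by exists y; auto.
- by left.
- by right; exists y.
Qed.

Lemma Pall_cat T (P : T -> Prop) s t :
  Pall P (s ++ t) <-> Pall P s /\ Pall P t.
Proof.
by elim: s => [|x s IH] /=; [split=> // -[] | rewrite IH and_assoc].
Qed.

(* A rule asserts that the conjunction of its premises entails the disjunction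
   of its conclusions. *)
Definition rule := (seq pat * seq pat)%type.

Definition rule_ok (M : nat -> Prop) (r : rule) : Prop :=
  forall e, Pall (fun q => M (inst e q)) r.1 -> Pex (fun q => M (inst e q)) r.2.

(* The number 0 stands for a trivially true fact, since every coded list of
   facts is padded with zeros. *)
Definition model (T : seq rule) (M : nat -> Prop) : Prop :=
  M 0 /\ Pall (rule_ok M) T.

Definition listed (G f : nat) : Prop := exists i, cn G i = f.

(** A closed tableau for the finite context [G]: applying a rule branches over its conclusions, and
    a rule without conclusions closes the branch. *)
Inductive refuted (T : seq rule) : nat -> Prop :=
| Refuted G r e :
    List.In r T ->
    (forall q, List.In q r.1 -> listed G (inst e q)) ->
    (forall c, List.In c r.2 -> refuted T (cpair (inst e c) G)) ->
    refuted T G.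

(** Iterating [c2] strictly decreases positive numbers, so [G] steps reach 0 and every list ends in
    zeros. *)
Lemma listed0 G : listed G 0.
Proof.
exists G; rewrite /cn; suff -> : iter G c2 G = 0 by [].
have H k : forall m, m <= k -> iter k c2 m = 0.
  elim: k => [|k IH] [|m] // mk; rewrite iterSr IH //.
  by rewrite -ltnS; apply: leq_trans mk; apply: c2_lt.
exact: H.
Qed.

Lemma listed_cons f G h : listed (cpair f G) h <-> h = f \/ listed G h.
Proof.
split=> [[[|i]]|[->|[i hi]]]; rewrite ?cn0 ?cnS.
- by left.
- by right; exists i.
- by exists 0; rewrite cn0.
- by exists i.+1; rewrite cnS.
Qed.

Lemma refuted_mono T G G' :
  (forall f, listed G f -> listed G' f) -> refuted T G -> refuted T G'.
Proof.
move=> GG' H; elim: H G' GG' => {}G r e rT Hq Hc IH G' GG'.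
apply: (Refuted (r := r) (e := e)) => // [q qr|c cr]; first exact/GG'/Hq.
by apply: (IH c cr) => f; rewrite !listed_cons => -[->|/GG']; auto.
Qed.

(** A model of the context contains some conclusion of each applied rule, so it can be followed
    through the tree until a rule without conclusions is contradicted. *)
Lemma model_not_refuted T M G :
  model T M -> (forall f, listed G f -> M f) -> ~ refuted T G.
Proof.
move=> [_ /PallP TM] GM H; elim: H GM => {}G r e rT Hq Hc IH GM.
have /PexP[c cr Mc] : Pex (fun q => M (inst e q)) r.2.
  by apply: TM => //; apply/PallP => q qr; apply/GM/Hq.
by apply: (IH c cr) => f; rewrite listed_cons => -[->|/GM].
Qed.

(* Lindenbaum's construction: facts are added one by one as long as the result
   is not refuted. *)
Lemma not_refuted_model T G :
  ~ refuted T G -> exists2 M, model T M & forall f, listed G f -> M f.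
Proof.
move=> nG.
pose Gs := nat_rect (fun=> nat) G
  (fun n H => if pselect (refuted T (cpair n H)) then H else cpair n H).
have nGs n : ~ refuted T (Gs n).
  by elim: n => //= n IH; case: pselect.
have mono n m f : n <= m -> listed (Gs n) f -> listed (Gs m) f.
  elim: m => [|m IH]; first by rewrite leqn0 => /eqP->.
  rewrite leq_eqVlt => /orP[/eqP->//|nm] /(IH nm) h /=.
  by case: pselect => // ?; apply/listed_cons; right.
exists (fun f => exists n, listed (Gs n) f); last by move=> f; exists 0.
split; first by exists 0; apply: listed0.
apply/PallP => r rT e /PallP Hq; apply: contrapT => /PexP Hc.
have [N HN] : exists N, forall q, List.In q r.1 -> listed (Gs N) (inst e q).
  elim: (r.1) Hq => [|q s IH] Hq; first by exists 0.
  have [|N HN] := IH; first by move=> x xs; apply: Hq; right.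
  have [|n Hn] := Hq q; first by left.
  exists (maxn n N) => x [<-|xs]; first exact: mono (leq_maxl _ _) _.
  by apply: mono (leq_maxr _ _) _; apply: HN.
(* The fact [f] is considered at stage [f], so from stage [K] on every conclusion has been either
   added or found refutable. *)
have [K HK] : exists K, forall c, List.In c r.2 -> inst e c < K.
  elim: (r.2) => [|c s [K HK]]; first by exists 0.
  exists (maxn (inst e c).+1 K) => x [<-|/HK h]; first exact: leq_maxl.
  exact: leq_trans h (leq_maxr _ _).
apply: (nGs (maxn N K)); apply: (Refuted (r := r) (e := e)) => // [q qr|c cr].
  by apply: mono (leq_maxl _ _) _; apply: HN.
set f := inst e c.
have ref : refuted T (cpair f (Gs f)).
  apply: contrapT => nf; apply: Hc; exists c => //; exists f.+1 => /=.
  by case: pselect => // ?; apply/listed_cons; left.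
apply: refuted_mono ref => h; rewrite !listed_cons => -[->|h']; first by left.
right; apply: mono h'; apply: leq_trans (leq_maxr _ _); exact/ltnW/HK.
Qed.

Definition consistent (T : seq rule) (n : nat) : Prop :=
  exists2 M, model T M & M (cpair 1 n).

Lemma consistentP T n : consistent T n <-> ~ refuted T (cpair (cpair 1 n) 0).
Proof.
split=> [[M TM Mn]|/not_refuted_model[M TM HM]].
  apply: (model_not_refuted TM) => f; rewrite listed_cons => -[->//|[i <-]].
  by have := cn_cseq [::] => /= ->; rewrite nth_nil; case: TM.
by exists M => //; apply: HM; apply/listed_cons; left.
Qed.

Definition listedb (G f : nat) : bool := has (fun j => cn G j == f) (iota 0 G.+1).

Lemma cn_ge G i : G <= i -> cn G i = 0.
Proof.
rewrite /cn => Gi; suff -> : iter i c2 G = 0 by [].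
elim: i G Gi => [|i IH] G; first by rewrite leqn0 => /eqP.
case: G => [|G] Gi; rewrite iterSr IH //.
by rewrite -ltnS; apply: leq_trans Gi; apply: c2_lt.
Qed.

Lemma listedP G f : reflect (listed G f) (listedb G f).
Proof.
apply: (iffP hasP) => [[i _ /eqP <-]|[i <-]]; first by exists i.
case: (leqP G i) => Gi.
  by exists G; rewrite ?mem_iota ?add0n ?ltnS //= !cn_ge.
by exists i => //; rewrite mem_iota /= ltnS ltnW.
Qed.

(* Entry i of a trace is a context together with the code of the environment
   of the rule refuting it; the contexts extended by a conclusion of that rule
   occur earlier in the trace. *)
Definition step_ok (r : rule) (d i : nat) : bool :=
  all (fun q => listedb (c1 (cn d i)) (inst (cn (c2 (cn d i))) q)) r.1 &&
  all (fun c => has (fun j => c1 (cn d j) ==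
    cpair (inst (cn (c2 (cn d i))) c) (c1 (cn d i))) (iota 0 i)) r.2.

(** The number [k] codes a trace together with its length; the context to be refuted consists of the
    input fact alone. *)
Definition trace_ok (T : seq rule) (k n : nat) : bool :=
  all (fun i => has (fun r => step_ok r (c1 k) i) T) (iota 0 (c2 k)) &&
  has (fun i => c1 (cn (c1 k) i) == cpair (cpair 1 n) 0) (iota 0 (c2 k)).

Lemma rc_inst n E q : rc n E -> rc n (fun e => inst (cn (E e)) q).
Proof.
move=> HE; elim: q => [i|k|q IH|q IH q' IH'] /=.
- by apply: rc_cn => //; apply: rc_const.
- exact: rc_const.
- exact: rc_succ.
- exact: rc_cpair.
Qed.

Lemma rp_listedb n F F' : rc n F -> rc n F' -> rp n (fun e => listedb (F e) (F' e)).
Proof.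
apply: (rc_op2 (g := fun x y => nat_of_bool (listedb x y))).
apply: (rp_bex (P := fun e => cn (e 1) (e 0) == e 2)); last by rcs.
by apply: rp_eq; [apply: rc_cn |]; rcs.
Qed.

Lemma rp_step_ok r : rp 2 (fun e => step_ok r (e 0) (e 1)).
Proof.
have Hcn : rc 2 (fun e => cn (e 0) (e 1)) by apply: rc_cn; rcs.
have Hcn' : rc 3 (fun e => cn (e 1) (e 2)) by apply: rc_cn; rcs.
apply: rp_and.
- elim: (r.1) => [|q s IH]; first exact: (rc_const 2 1).
  by apply: rp_and => //; apply: rp_listedb; [rcs | apply: rc_inst; rcs].
- elim: (r.2) => [|c s IH]; first exact: (rc_const 2 1).
  apply: rp_and => //; apply: (rp_bex (P := fun e => c1 (cn (e 1) (e 0)) ==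
    cpair (inst (cn (c2 (cn (e 1) (e 2)))) c) (c1 (cn (e 1) (e 2))))); last by rcs.
  apply: rp_eq; first by apply/rc_c1/rc_cn; rcs.
  by apply: rc_cpair; [apply: rc_inst; rcs | rcs].
Qed.

Lemma rp_trace_ok T : rp 2 (fun e => trace_ok T (e 0) (e 1)).
Proof.
apply: rp_and.
- apply: (rp_ball (P := fun e => has (fun r => step_ok r (c1 (e 1)) (e 0)) T)); last by rcs.
  elim: T => [|r T IH]; first exact: (rc_const 3 0).
  apply: rp_or => //.
  by apply: (rc_op2 (g := fun x y => nat_of_bool (step_ok r x y)) (rp_step_ok r)); rcs.
- apply: (rp_bex (P := fun e => c1 (cn (c1 (e 1)) (e 0)) ==
    cpair (cpair 1 (e 2)) 0)); last by rcs.
  by apply: rp_eq; [apply/rc_c1/rc_cn; rcs | rcs].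
Qed.

Fixpoint pbound (q : pat) : nat :=
  match q with
  | PV i => i.+1
  | PN _ => 0
  | PS q => pbound q
  | PP q r => maxn (pbound q) (pbound r)
  end.

Lemma inst_ext e e' q :
  (forall i, i < pbound q -> e i = e' i) -> inst e q = inst e' q.
Proof.
elim: q => [i|k|q IH|q IH q' IH'] //= H; first exact: H.
  by rewrite IH.
by rewrite IH ?IH' // => i h; apply: H; rewrite leq_max h ?orbT.
Qed.

Definition trace (T : seq rule) (s : seq nat) : Prop :=
  forall i, i < size s -> exists2 r, List.In r T &
    (forall q, List.In q r.1 ->
       listed (c1 (nth 0 s i)) (inst (cn (c2 (nth 0 s i))) q)) /\
    (forall c, List.In c r.2 -> exists2 j, j < i &
       c1 (nth 0 s j) = cpair (inst (cn (c2 (nth 0 s i))) c) (c1 (nth 0 s i))).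

Lemma trace_cat T s t : trace T s -> trace T t -> trace T (s ++ t).
Proof.
move=> Hs Ht i; rewrite size_cat => hi; case: (ltnP i (size s)) => his.
  have [r rT [Hq Hc]] := Hs i his; exists r => //; rewrite nth_cat his.
  split=> // c /Hc[j ji hj]; exists j => //.
  by rewrite nth_cat (ltn_trans ji his).
have [|r rT [Hq Hc]] := Ht (i - size s); first by rewrite ltn_subLR.
exists r => //; rewrite nth_cat ltnNge his /=.
split=> // c /Hc[j ji hj]; exists (size s + j); first by lia.
by rewrite nth_cat ltnNge leq_addr /= addKn.
Qed.

(** A tree is flattened by concatenating the traces of its branches and appending the root; the
    coded environment keeps only the finitely many variables that occur in the rule. *)
Lemma refuted_trace T G : refuted T G ->
  exists2 s, trace T s & exists2 i, i < size s & c1 (nth 0 s i) = G.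
Proof.
elim=> {}G r e rT Hq Hc IH.
pose N := \max_(q <- r.1 ++ r.2) pbound q.
pose E := cseq (mkseq e N).
have HE q : List.In q (r.1 ++ r.2) -> inst (cn E) q = inst e q.
  move=> qr; apply: inst_ext => i hi; rewrite cn_cseq nth_mkseq //.
  apply: leq_trans hi _; rewrite /N; elim: (r.1 ++ r.2) qr => //= x s IHs.
  by rewrite big_cons leq_max => -[->|/IHs->]; rewrite ?leqnn ?orbT.
have [s Hs Hsc] : exists2 s, trace T s & forall c, List.In c r.2 ->
    exists2 i, i < size s & c1 (nth 0 s i) = cpair (inst e c) G.
  elim: (r.2) IH => [|c l IHl] IH; first by exists [::].
  have [|s Hs Hsl] := IHl; first by move=> x xl; apply: IH; right.
  have [|t Ht [i it hi]] := IH c; first by left.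
  exists (s ++ t); first exact: trace_cat.
  move=> x [<-|/Hsl[j js hj]].
    exists (size s + i); first by rewrite size_cat ltn_add2l.
    by rewrite nth_cat ltnNge leq_addr /= addKn.
  by exists j; rewrite ?size_cat ?ltn_addr // nth_cat js.
exists (rcons s (cpair G E)); last first.
  by exists (size s); rewrite ?size_rcons // nth_rcons ltnn eqxx c1K.
move=> i; rewrite size_rcons ltnS leq_eqVlt => /orP[/eqP->|his].
  exists r => //; rewrite nth_rcons ltnn eqxx c1K c2K; split=> [q qr|c cr].
    by rewrite HE; [apply: Hq | apply: List.in_or_app; left].
  have [j js hj] := Hsc c cr; exists j => //.
  by rewrite nth_rcons js hj HE //; apply: List.in_or_app; right.
have [r' rT' [Hq' Hc']] := Hs i his; exists r' => //; rewrite nth_rcons his.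
split=> // c /Hc'[j ji hj]; exists j => //.
by rewrite nth_rcons (ltn_trans ji his).
Qed.

Lemma hasInP (T : Type) (P : T -> bool) s : reflect (exists2 x, List.In x s & P x) (has P s).
Proof.
elim: s => [|x s IH] /=; first by apply: ReflectF => -[].
apply: (iffP orP) => [[Px|/IH[y ys Py]]|[y [<-|ys] Py]].
- by exists x; auto.
- by exists y; auto.
- by left.
- by right; apply/IH; exists y.
Qed.

Lemma allInP (T : Type) (P : T -> bool) s : reflect (forall x, List.In x s -> P x) (all P s).
Proof.
elim: s => [|x s IH] /=; first exact: ReflectT.
apply: (iffP andP) => [[Px /IH H] y [<-|/H]|H] //.
by split; [apply: H; left | apply/IH => y ys; apply: H; right].
Qed.

Lemma trace_okP T n :
  refuted T (cpair (cpair 1 n) 0) <-> exists k, trace_ok T k n.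
Proof.
split=> [/refuted_trace[s Hs [i his hi]]|[k /andP[/allP Hk /hasP[i]]]].
  exists (cpair (cseq s) (size s)); rewrite /trace_ok c1K c2K; apply/andP; split.
    apply/allP => j; rewrite mem_iota /= add0n => /Hs[r rT [Hq Hc]].
    apply/hasInP; exists r => //; rewrite /step_ok cn_cseq.
    apply/andP; split; first by apply/allInP => q /Hq/listedP.
    apply/allInP => c /Hc[m mj hm]; apply/hasP; exists m; first by rewrite mem_iota.
    by rewrite hm.
  by apply/hasP; exists i; rewrite ?mem_iota // cn_cseq hi.
have H j : j < c2 k -> refuted T (c1 (cn (c1 k) j)).
  elim/ltn_ind: j => j IH jk.
  have /hasInP[r rT /andP[/allInP Hq /allInP Hc]] : has (fun r => step_ok r (c1 k) j) T.
    by apply: Hk; rewrite mem_iota.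
  apply: (Refuted (r := r) (e := cn (c2 (cn (c1 k) j)))) => // [q /Hq/listedP//|c /Hc].
  move=> /hasP[m]; rewrite mem_iota /= add0n => mj /eqP <-.
  by apply: IH => //; apply: ltn_trans jk.
by rewrite mem_iota /= add0n => /H + /eqP <-.
Qed.

Lemma semi_inconsistent T : semi (fun n => ~ consistent T n).
Proof.
exists (trace_ok T); first exact: rp_trace_ok.
move=> n; rewrite consistentP -trace_okP; split=> [/contrapT //|h nh]; exact: nh.
Qed.

(** Inconsistency is always semidecidable, so one theory consistent exactly on a set and another
    consistent exactly on its complement decide it. *)
Lemma decidable_of_theories T T' (A : nat -> Prop) :
  (forall n, A n <-> consistent T n) -> (forall n, A n <-> ~ consistent T' n) ->
  decidable_set A.
Proof.
move=> AT AT'; apply: semi_decidable.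
  by apply: semi_ext (semi_inconsistent T') => n; rewrite AT'.
by apply: semi_ext (semi_inconsistent T) => n; rewrite AT.
Qed.

(** * Countability of programs *)

Lemma computes_inj n (f : recfun n) v y y' :
  computes f v y -> computes f v y' -> y = y'.
Proof.
elim: f v y y' => {n} [n|||m n f IHf g IHg|n f IHf g IHg|n f IHf] v y y' /=.
- by move=> -> ->.
- by move=> -> ->.
- by move=> n i -> ->.
- move=> [w [Hw Hy]] [w' [Hw' Hy']]; apply: IHf Hy _.
  suff -> : w = w' by [].
  by apply: eq_from_tnth => i; apply: IHg (Hw i) (Hw' i).
- move=> [h [h0 hS ->]] [h' [h0' hS' ->]].
  suff H k : k <= thead v -> h k = h' k by apply: H.
  elim: k => [_|k IH kv]; first exact: IHf h0 h0'.
  by apply: IHg (hS _ kv) _; rewrite IH ?(ltnW kv) //; apply: hS'.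
- move=> [Hy My] [Hy' My']; case: (ltngtP y y') => // h.
  + by have [z Hz] := My' _ h; have := IHf _ _ _ Hz Hy.
  + by have [z Hz] := My _ h; have := IHf _ _ _ Hz Hy'.
Qed.

(** A decoder of numbers into programs with fuel [k]. Codes that do not fit the arity yield [RZero],
    which makes it total at every arity. *)
Fixpoint prog (k c n : nat) : recfun n :=
  if k is k'.+1 then
    let d := c2 c in
    match c1 c with
    | 0 => RZero n
    | 1 => match n return recfun n with 1 => RSucc | n => RZero n end
    | 2 => if insub d is Some i then RProj i else RZero n
    | 3 => RComp (prog k' (c1 (c2 d)) (c1 d)) (fun i => prog k' (cn (c2 (c2 d)) i) n)
    | 4 => match n return recfun n with
           | n'.+1 => RPrim (prog k' (c1 d) n') (prog k' (c2 d) n'.+2)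
           | 0 => RZero 0
           end
    | _ => RMin (prog k' d n.+1)
    end
  else RZero n.

(** Stated for all sufficiently large fuel, so that finitely many subprograms can share one
    bound. *)
Lemma prog_surj n (f : recfun n) :
  exists c K, forall k, K <= k -> prog k c n = f.
Proof.
elim: f => {n} [n||n i|m n f [c [K IHf]] g IHg|n f [c [K Hf]] g [c' [K' Hg]]
  |n f [c [K Hf]]].
- by exists (cpair 0 0), 1 => -[|k] //= _; rewrite c1K.
- by exists (cpair 1 0), 1 => -[|k] //= _; rewrite c1K.
- by exists (cpair 2 i), 1 => -[|k] //= _; rewrite c1K c2K valK.
- have /choice[cK HcK] : forall i, exists cK : nat * nat,
      forall k, cK.2 <= k -> prog k cK.1 n = g i.
    by move=> i; have [c' [K' H]] := IHg i; exists (c', K').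
  pose L := \max_i (cK i).2.
  exists (cpair 3 (cpair m (cpair c (cseq (codom (fun i => (cK i).1)))))).
  exists (maxn K L).+1 => -[|k] //; rewrite ltnS geq_max => /andP[Kk Lk] /=.
  rewrite !(c1K, c2K) IHf //; congr RComp; apply/funext => i.
  rewrite cn_cseq codomE (nth_map i) ?size_enum_ord // nth_ord_enum HcK //.
  exact: leq_trans (leq_bigmax i) Lk.
- exists (cpair 4 (cpair c c')), (maxn K K').+1 => -[|k] //.
  rewrite ltnS geq_max => /andP[Kk Kk'] /=.
  by rewrite !(c1K, c2K) Hf // Hg.
- exists (cpair 5 c), K.+1 => -[|k] // Kk /=.
  by rewrite !(c1K, c2K) Hf.
Qed.

(** Cantor's diagonal argument: a program decides at most one set, hence is attached to at most one
    [A] up to equivalence; the set of all [i] that do not belong to the set attached to program [i]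
    is attached to no program. *)
Lemma undecidable_member (Th : (nat -> Prop) -> nat -> Prop) :
  (forall A B, (forall n, Th A n <-> Th B n) -> forall n, A n <-> B n) ->
  exists A, ~ decidable_set (Th A).
Proof.
move=> Th_inj; apply: contrapT => /forallNP H.
pose decides (f : recfun 1) (A : nat -> Prop) := forall n,
  (A n -> computes f [tuple n] 1) /\ (~ A n -> computes f [tuple n] 0).
have decides_inj f A B : decides f A -> decides f B -> forall n, A n -> B n.
  move=> fA fB n An; apply: contrapT => nBn.
  by have := computes_inj ((fA n).1 An) ((fB n).2 nBn).
pose D i := prog (c1 i) (c2 i) 1.
pose A i := ~ exists2 B, decides (D i) (Th B) & B i.
have [f fA] := contrapT (H A).
have [c [K /(_ K (leqnn K)) Hf]] := prog_surj f.
pose i := cpair K c; have DA : decides (D i) (Th A) by rewrite /D c1K c2K Hf.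
have nAi : ~ A i by move=> Ai; apply: (Ai); exists A.
case: (contrapT nAi) => B DB Bi; apply: nAi.
apply/(Th_inj B A) => // n.
by split; [exact: (decides_inj _ _ _ DB DA) | exact: (decides_inj _ _ _ DA DB)].
Qed.

Import Order.TTheory GRing.Theory Num.Theory.

Local Open Scope ring_scope.

(** * Integer polynomials in positive characteristic *)

Definition evi (R : comNzRingType) (x : R) : {poly int} -> R :=
  horner_eval x \o map_poly intr.

HB.instance Definition _ (R : comNzRingType) (x : R) :=
  GRing.RMorphism.on (evi x).

Lemma eviE (R : comNzRingType) (x : R) f : evi x f = (map_poly intr f).[x].
Proof. by []. Qed.

Lemma eviC (R : comNzRingType) (x : R) c : evi x c%:P = c%:~R.
Proof. by rewrite eviE map_polyC hornerC. Qed.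

Lemma eviX (R : comNzRingType) (x : R) : evi x 'X = x.
Proof. by rewrite eviE map_polyX hornerX. Qed.

Lemma evi_morph (R S : comNzRingType) (phi : {rmorphism R -> S}) x f :
  phi (evi x f) = evi (phi x) f.
Proof.
rewrite !eviE -horner_map -map_poly_comp; congr (_.[_]).
by apply: eq_map_poly => c /=; rewrite rmorph_int.
Qed.

Lemma evi_sum (R : comNzRingType) (x : R) (f : {poly int}) n : (size f <= n)%N ->
  evi x f = \sum_(i < n) (f`_i)%:~R * x ^+ i.
Proof.
move=> sf; rewrite eviE -[f in LHS]coefK poly_def rmorph_sum horner_sum.
rewrite (big_ord_widen n (fun i => (map_poly intr (f`_i *: 'X^i)).[x]) sf).
rewrite [RHS](bigID (fun i : 'I_n => (i < size f)%N)) /= [X in _ + X]big1 ?addr0.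
  by apply: eq_bigr => i _; rewrite map_polyZ map_polyXn hornerZ hornerXn.
by move=> i; rewrite -leqNgt => fi; rewrite nth_default // mul0r.
Qed.

Lemma size_drop_lead (R : nzRingType) (f : {poly R}) : f != 0 ->
  (size (f - lead_coef f *: 'X^((size f).-1))%R < size f)%N.
Proof.
rewrite -size_poly_gt0 => sf0; rewrite -[X in (_ < X)%N](prednK sf0) ltnS.
apply/leq_sizeP => j hj; rewrite coefB coefZ coefXn.
case: (eqVneq j _) => [->|jn]; first by rewrite mulr1 subrr.
by rewrite mulr0 subr0 nth_default // -(prednK sf0) ltn_neqAle eq_sym jn.
Qed.

Lemma dvd_int_polyP (p : nat) (f : {poly int}) :
  (exists r, f = p%:R * r) <-> forall i, (p %| f`_i)%Z.
Proof.
split=> [[r ->] i|H].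
  by rewrite -polyC_natr coefCM natz dvdz_mulr.
exists (\poly_(i < size f) (f`_i %/ p)%Z); apply/polyP => i.
rewrite -polyC_natr coefCM coef_poly; case: ltnP => hi.
  by rewrite natz mulrC divzK.
by rewrite mulr0 nth_default.
Qed.

(** Modulo [p] the product vanishes in a polynomial ring over a field, where the monic factor stays
    nonzero. *)
Lemma dvd_int_poly_mul (p : nat) (m a b : {poly int}) :
  prime p -> m \is monic -> m * a = p%:R * b -> exists r, a = p%:R * r.
Proof.
move=> p_pr mm E; apply/dvd_int_polyP => i.
have pF : p \in [pchar 'F_p] by rewrite pchar_Fp.
have : map_poly intr (m * a) = 0 :> {poly 'F_p}.
  by rewrite E rmorphM rmorph_nat -polyC_natr (pcharf0 pF) mul0r.
rewrite rmorphM => /eqP; rewrite mulf_eq0 (negPf (monic_neq0 (monic_map _ mm))).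
move=> /eqP a0.
by rewrite (dvdz_pcharf pF) -coef_map a0 coef0.
Qed.

Section PositiveCharacteristic.

Variables (k : fieldType) (p : nat).
Hypothesis pk : p \in [pchar k].

Let p_pr : prime p. Proof. exact: pcharf_prime pk. Qed.

Lemma exp_p_inj (x y : k) i : x ^+ (p ^ i) = y ^+ (p ^ i) -> x = y.
Proof.
elim: i x y => [|i IH] x y; first by rewrite !expr1.
rewrite expnSr !exprM => /(fmorph_inj (pFrobenius_aut pk)); exact: IH.
Qed.

Lemma evi_exp_p (x : k) f i : evi (x ^+ (p ^ i)) f = evi x f ^+ (p ^ i).
Proof.
elim: i => [|i IH]; first by rewrite !expr1.
rewrite expnSr !exprM -IH; set y := x ^+ _.
by rewrite -[y ^+ p](pFrobenius_autE pk) -[RHS](pFrobenius_autE pk) evi_morph.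
Qed.

Lemma root_exp_p (b : k) (g : {poly int}) n :
  map_poly intr g != 0 :> {poly k} -> (size g <= n.+1)%N -> evi b g = 0 ->
  exists N, [/\ (0 < N)%N, (N <= n)%N & b ^+ (p ^ N) = b].
Proof.
move=> g0 sg gb; pose s := mkseq (fun i => b ^+ (p ^ i)) n.+1.
have : ~~ uniq s.
  apply/negP => us; have := max_poly_roots g0 (rs := s).
  rewrite us size_mkseq => /(_ _ isT) h.
  suff /h : all (root (map_poly intr g)) s.
    by rewrite ltnNge (leq_trans _ sg) ?size_poly.
  apply/allP => x /mapP[i _ ->]; rewrite /root -eviE evi_exp_p gb.
  by rewrite expf_eq0 eqxx andbT expn_gt0 prime_gt0.
move=> /(uniqPn 0)[i [j [ij]]]; rewrite size_mkseq => jn.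
rewrite !nth_mkseq ?(ltn_trans ij) // => E.
exists (j - i)%N; split; [by rewrite subn_gt0 | by lia |].
by apply: (@exp_p_inj _ _ i); rewrite E -exprM -expnD subnK // ltnW.
Qed.

Lemma exp_p_iter (b : k) N i : b ^+ (p ^ N) = b -> b ^+ (p ^ (N * i)) = b.
Proof.
move=> bN; elim: i => [|i IH]; first by rewrite muln0 expr1.
by rewrite mulnSr expnD exprM IH.
Qed.

(** [k] need not contain all roots of unity of order [q - 1], so a longest list of them is taken; it
    is closed under products, and its length is the order of a generator. *)
Lemma exists_generator q : (1 < q)%N -> exists n (th : k),
  [/\ (0 < n)%N, n.-primitive_root th &
      forall y, y ^+ q = y -> y = 0 \/ exists i, y = th ^+ i].
Proof.
move=> q1; have q'0 : (0 < q.-1)%N by rewrite -ltnS prednK // ltnW.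
pose P s := `[< exists rs : seq k,
  [/\ uniq rs, all (q.-1).-unity_root rs & size rs = s] >].
have exP : exists s, P s by exists 0%N; apply/asboolP; exists [::].
have boundP s : P s -> (s <= q.-1)%N.
  by move=> /asboolP[rs [urs ars <-]]; apply: max_unity_roots.
case: (ex_maxnP exP boundP) => n /asboolP[rs [urs ars srs]] max_n.
have rsP y : (y \in rs) = (y ^+ q.-1 == 1).
  apply/idP/idP => [/(allP ars)|yq]; first by rewrite unity_rootE.
  apply/negPn/negP => yrs; suff /max_n : P n.+1 by rewrite ltnn.
  apply/asboolP; exists (y :: rs); split; rewrite /= ?srs //.
    by rewrite yrs.
  by rewrite ars unity_rootE yq.
have n0 : (0 < n)%N.
  by rewrite -srs; case: (rs) (rsP 1) => //; rewrite expr1n eqxx.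
have rs_n y : y \in rs -> y ^+ n = 1.
  move=> yrs; have y0 : y != 0.
    apply: contraTneq yrs => ->; rewrite rsP expr0n (gtn_eqF q'0).
    by rewrite eq_sym oner_eq0.
  (* Multiplication by [y] permutes the list, so comparing the products of all entries gives
     [y ^+ n = 1], as in Lagrange's theorem for abelian groups. *)
  have pe : perm_eq rs (map ( *%R y) rs).
    have um : uniq (map ( *%R y) rs) by rewrite map_inj_uniq //; apply: mulfI.
    apply: uniq_perm => // z.
    have sub : {subset map ( *%R y) rs <= rs}.
      move=> _ /mapP[x xrs ->]; move: xrs yrs; rewrite !rsP exprMn.
      by move=> /eqP-> /eqP->; rewrite mulr1.
    have [_ E] := uniq_min_size um sub (eq_leq (esym (size_map _ _))).
    by rewrite E.
  have : \prod_(x <- rs) x = \prod_(x <- map ( *%R y) rs) x by apply: perm_big.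
  rewrite big_map big_split /= big_const_seq count_predT srs iter_mulr_1.
  set z := \prod_(i <- rs) i => E; apply/(@mulIf _ z).
    rewrite prodf_seq_neq0; apply/allP => x xrs /=.
    apply: contraTneq xrs => ->; rewrite rsP expr0n (gtn_eqF q'0).
    by rewrite eq_sym oner_eq0.
  by rewrite mul1r -E.
have /(has_prim_root n0) : all n.-unity_root rs.
  by apply/allP => y /rs_n /eqP; rewrite unity_rootE.
move=> /(_ urs); rewrite srs leqnn => /(_ isT)/hasP[th _ thP].
exists n, th; split=> // y yq; case: (eqVneq y 0) => [->|y0]; [by left | right].
have /rs_n yn : y \in rs.
  by rewrite rsP -(inj_eq (mulfI y0)) -exprS prednK ?(ltnW q1) // yq mulr1.
by have [i ->] := prim_rootP thP yn; exists i.
Qed.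

Section MinimalPolynomial.

Variables (n : nat) (th : k).
Hypotheses (n_gt0 : (0 < n)%N) (th_prim : n.-primitive_root th).

Let evip r : evi th (p%:R * r) = 0.
Proof. by rewrite rmorphM rmorph_nat (pcharf0 pk) mul0r. Qed.

(** The polynomial has least size among those vanishing at [th] and not divisible by [p]. It is
    normalized to natural coefficients so that a list of numbers can describe it inside facts. *)
Lemma exists_min_poly : exists l : seq nat, let m := Poly (map Posz l) in
  [/\ (1 < size l)%N, last 0%N l = 1%N, m \is monic, evi th m = 0 &
      forall r : {poly int}, (size r < size m)%N -> evi th r = 0 ->
        exists r', r = p%:R * r'].
Proof.
pose P s := `[< exists f : {poly int}, [/\ size f = s, evi th f = 0 & ~ (exists r : {poly int}, f = p%:R * r)] >].
have exP : exists s, P s.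
  exists (size ('X^n - 1 : {poly int})); apply/asboolP; exists ('X^n - 1).
  split=> //; first by rewrite rmorphB rmorphXn rmorph1 /= eviX prim_expr_order // subrr.
  move=> /dvd_int_polyP/(_ n); rewrite coefB coefXn eqxx coef1 -[n == 0%N]negbK -lt0n n_gt0.
  by rewrite subr0 dvdzE /= dvdn1 => /eqP p1; have := prime_gt1 p_pr; rewrite p1.
case: (ex_minnP exP) => s /asboolP[f [sf f0 npf]] min_s.
have minP (r : {poly int}) : (size r < s)%N -> evi th r = 0 -> exists r', r = p%:R * r'.
  move=> rs r0; apply: contrapT => npr; suff /min_s : P (size r) by rewrite leqNgt rs.
  by apply/asboolP; exists r.
have sf0 : (0 < size f)%N.
  rewrite size_poly_gt0; apply: contra_notN npf => /eqP->.
  by exists 0; rewrite mulr0.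
have npl : ~~ (p %| lead_coef f)%Z.
  apply/negP => pl; apply: npf.
  pose g := f - lead_coef f *: 'X^((size f).-1).
  have gE : f = g + lead_coef f *: 'X^((size f).-1) by rewrite subrK.
  have pl' : exists r, lead_coef f *: 'X^((size f).-1) = p%:R * r.
    apply/dvd_int_polyP => i; rewrite coefZ coefXn; case: eqP => _; rewrite ?mulr1 ?mulr0 //.
  have [||r hr] := minP g.
  - by rewrite -sf size_drop_lead // -size_poly_gt0.
  - by rewrite rmorphB /= f0 sub0r; case: pl' => r ->; rewrite evip oppr0.
  - by case: pl' => r' hr'; exists (r + r'); rewrite {1}gE hr hr' mulrDr.
(* The leading coefficient is invertible modulo [p]; a correction by a multiple of [p] makes it
   exactly 1. *)
have [u [w uw]] := Bezoutz (lead_coef f) p.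
have {uw} uw : u * lead_coef f + w * p = 1.
  rewrite uw /gcdz; congr Posz; apply/eqP; rewrite -/(coprime _ _).
  by rewrite coprime_sym prime_coprime //.
pose m1 := u *: f + (w * p) *: 'X^((size f).-1).
have sm1 : (size m1 <= size f)%N.
  apply: leq_trans (size_polyD _ _) _; rewrite geq_max size_scale_leq /=.
  by apply: leq_trans (size_scale_leq _ _) _; rewrite size_polyXn prednK.
have m1l : m1`_(size f).-1 = 1.
  by rewrite coefD !coefZ coefXn eqxx mulr1 -lead_coefE.
have m10 : evi th m1 = 0.
  rewrite rmorphD -!mul_polyC !rmorphM /= f0 mulr0 add0r !eviC.
  by rewrite -pmulrn (pcharf0 pk) mulr0 mul0r.
(* Coefficients are reduced to the range from 0 to [p - 1]; the leading 1 survives because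
   [p > 1]. *)
pose a i := `|(m1`_i %% p)%Z|%N.
have p0 : (p : int) != 0 by rewrite eqz_nat -lt0n prime_gt0.
have aE i : (a i : int) = (m1`_i %% p)%Z by rewrite /a gez0_abs ?modz_ge0.
pose l := mkseq a s.
have ss : size l = s by rewrite size_mkseq.
have s0 : (0 < s)%N by rewrite -sf.
have ll : last 0%N l = 1%N.
  rewrite -nth_last ss nth_mkseq ?prednK //; apply/eqP; rewrite -eqz_nat aE.
  by rewrite -sf m1l modz_small // ler01 /= ltz_nat prime_gt1.
have lm : Poly (map Posz l) = map Posz l :> seq int.
  by apply: (@PolyK _ 0); rewrite (last_map Posz l 0%N) ll.
have ml i : (Poly (map Posz l))`_i = (m1`_i %% p)%Z.
  rewrite lm; case: (ltnP i s) => hi.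
    by rewrite (nth_map 0%N) ?ss // nth_mkseq // aE.
  have -> : m1`_i = 0 by rewrite nth_default // (leq_trans sm1) ?sf.
  by rewrite mod0z nth_default // size_map ss.
have m0 : evi th (Poly (map Posz l)) = 0.
  suff [r hr] : exists r, m1 - Poly (map Posz l) = p%:R * r.
    have -> : Poly (map Posz l) = m1 - p%:R * r by rewrite -hr subKr.
    by rewrite rmorphB /= m10 evip subr0.
  by apply/dvd_int_polyP => i; rewrite coefB ml -eqz_mod_dvd modz_mod.
have mm : Poly (map Posz l) \is monic.
  by rewrite monicE /lead_coef lm nth_last (last_map Posz l 0%N) ll.
exists l => m; split=> //; last by move=> r; rewrite /m lm size_map ss => /minP.
rewrite ltnNge; apply/negP => l1.
have E : m = 1.
  have : size m = 1%N.
    by apply/eqP; rewrite eqn_leq /m lm size_map l1 /= ss.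
  move=> /eqP/size_poly1P[c _ mE]; move: mm; rewrite -/m mE monicE lead_coefC.
  by move=> /eqP->.
by move: m0; rewrite -/m E rmorph1 => /eqP; rewrite oner_eq0.
Qed.

Variable m : {poly int}.
Hypotheses (m_monic : m \is monic) (m_root : evi th m = 0)
  (m_min : forall r : {poly int}, (size r < size m)%N -> evi th r = 0 ->
     exists r', r = p%:R * r').

Lemma min_polyP f : evi th f = 0 -> exists h r, f = m * h + p%:R * r.
Proof.
move=> f0; have E := Pdiv.RingMonic.rdivp_eq m_monic f.
have [||r hr] := m_min (r := Pdiv.Ring.rmodp f m).
- by rewrite Pdiv.Ring.ltn_rmodpN0 // monic_neq0.
- move: f0; rewrite {1}E rmorphD rmorphM /= m_root mulr0 add0r //.
- by exists (Pdiv.Ring.rdivp f m), r; rewrite {1}E hr mulrC.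
Qed.

(** Modulo [p], [m] divides ['X^n - 1]. Differentiating and evaluating at [th] shows that the value
    of the derivative of [m] divides [n * th ^+ n.-1], a unit since the order [n] is prime to
    [p]. *)
Lemma min_poly_separable :
  exists U G H, U * m^`() = 1 + p%:R * G + m * H.
Proof.
have [|h [r E]] := @min_polyP ('X^n - 1).
  by rewrite rmorphB rmorphXn rmorph1 /= eviX prim_expr_order // subrr.
have n0 : (n%:R : k) != 0.
  apply/negP => n0; have pn : (p %| n)%N by rewrite (dvdn_pcharf pk).
  by have := pk; rewrite (prim_root_pcharF th_prim pn).
have [u [w uw]] := Bezoutz n p.
have {uw} uw : u * n + w * p = 1.
  rewrite uw /gcdz; congr Posz; apply/eqP; rewrite -/(coprime _ _).
  by rewrite coprime_sym prime_coprime // (dvdn_pcharf pk).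
have mh : evi th m^`() * evi th h = n%:R * th ^+ n.-1.
  have := congr1 (fun f => evi th f^`()) E.
  rewrite /= derivB derivXn derivC subr0 derivD derivM [p%:R * r]mulr_natl.
  rewrite derivMn !(rmorphD, rmorphM, rmorphMn) /= m_root mul0r addr0 rmorphXn /=.
  rewrite eviX -[_ *+ p]mulr_natl (pcharf0 pk) mul0r addr0 mulr_natl => <-.
  by [].
have [|H [G HG]] := @min_polyP ((u *: ('X * h)) * m^`() - 1).
  rewrite rmorphB rmorph1 rmorphM /= -mul_polyC !rmorphM /= eviC eviX.
  rewrite -!mulrA [evi th h * _]mulrC mh [th * _]mulrCA -exprS prednK //.
  rewrite prim_expr_order // mulr1; apply/eqP; rewrite subr_eq0; apply/eqP.
  have := congr1 (fun c : int => c%:~R : k) uw.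
  by rewrite /= rmorphD !rmorphM /= -!pmulrn (pcharf0 pk) mulr0 addr0.
exists (u *: ('X * h)), G, H.
by rewrite -addrA [_ + m * _]addrC -HG addrC subrK.
Qed.

End MinimalPolynomial.
End PositiveCharacteristic.

(** * Specialization of solutions to an algebraically closed field *)

Section ExtensionStep.

Variables (A : idomainType) (K : fieldType) (L : closedFieldType).
Variables (eps : {rmorphism A -> K}) (x : K).

Let evx (f : {poly A}) := (map_poly eps f).[x].

Let evxD f g : evx (f + g) = evx f + evx g.
Proof. by rewrite /evx rmorphD hornerD. Qed.

Let evxM f g : evx (f * g) = evx f * evx g.
Proof. by rewrite /evx rmorphM hornerM. Qed.

Let evxZ a f : evx (a *: f) = eps a * evx f.
Proof. by rewrite /evx map_polyZ hornerZ. Qed.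

(* Dropping a leading term killed by [eps] does not change the value. *)
Let exists_small (f : {poly A}) : exists2 g : {poly A}, (size g <= size f)%N &
  map_poly eps g = map_poly eps f /\ (g != 0 -> eps (lead_coef g) != 0).
Proof.
elim: {f}(size f) {-2}f (leqnn (size f)) => [|n IH] f sf.
  by exists f => //; split=> // f0; move: sf f0; rewrite leqn0 size_poly_eq0 => ->.
case: (eqVneq (eps (lead_coef f)) 0) => [l0|l0]; last by exists f.
case: (eqVneq f 0) => [f0|f0]; first by exists f; rewrite // f0 eqxx.
pose g := f - lead_coef f *: 'X^((size f).-1).
have sg : (size g < size f)%N by apply: size_drop_lead.
have [|h sh [hE hl]] := IH g; first by rewrite -ltnS (leq_trans sg).
exists h; first exact: leq_trans sh (ltnW sg).
by split=> //; rewrite hE rmorphB /= map_polyZ l0 scale0r subr0.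
Qed.

(** The condition on [s] is pushed down to one condition [a] on the base. If [x] is transcendental
    over the image, [a] is a coefficient of [s]; otherwise it is the leading coefficient of a
    minimal relation [f] times a constant that is a multiple of [s] modulo relations of [x]. *)
Lemma extension_step (s : {poly A}) : (map_poly eps s).[x] != 0 ->
  exists2 a : A, eps a != 0 &
    forall phi : {rmorphism A -> L}, (forall b, eps b = 0 -> phi b = 0) ->
      phi a != 0 -> exists2 y : L, (map_poly phi s).[y] != 0 &
        forall f, (map_poly eps f).[x] = 0 -> (map_poly phi f).[y] = 0.
Proof.
rewrite -/(evx s) => s0.
pose P n := `[< exists f : {poly A},
  [/\ size f = n, evx f = 0 & map_poly eps f != 0] >].
have phi0 (phi : {rmorphism A -> L}) (f : {poly A}) : (forall b, eps b = 0 -> phi b = 0) ->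
    map_poly eps f = 0 -> map_poly phi f = 0.
  move=> Hphi f0; apply/polyP => i; rewrite coef0.
  transitivity (phi f`_i); first by rewrite coef_map.
  by apply: Hphi; rewrite -coef_map f0 coef0.
case: (pselect (exists n, P n)) => [exP|nP]; last first.
  have [i si] : exists i, eps s`_i != 0.
    apply: contrapT => /forallNP H; move: s0; rewrite /evx.
    suff -> : map_poly eps s = 0 by rewrite horner0 eqxx.
    by apply/polyP => i; rewrite coef_map coef0; apply/eqP/negPn/negP/H.
  exists s`_i => // phi Hphi phii.
  have /closed_nonrootP[y sy] : map_poly phi s != 0.
    by apply: contraNneq phii => E; rewrite -coef_map E coef0.
  exists y => // f fx; rewrite phi0 ?horner0 //.
  apply: contrapT => /eqP fn; apply: nP; exists (size f).
  by apply/asboolP; exists f.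
case: (ex_minnP exP) => n /asboolP[f0 [sf0 f0x f0n]] min_n.
have [f sf [fE fl]] := exists_small f0.
have fn : map_poly eps f != 0 by rewrite fE.
have f_neq0 : f != 0 by apply: contraNneq fn => ->; rewrite rmorph0.
move/(_ f_neq0): fl => fl.
have fx : evx f = 0 by rewrite /evx fE.
have minf (g : {poly A}) : (size g < size f)%N -> evx g = 0 -> map_poly eps g = 0.
  move=> gf gx; apply/eqP/negPn/negP => gn.
  suff /min_n : P (size g) by rewrite leqNgt (leq_trans gf) // -sf0.
  by apply/asboolP; exists g.
(* Bezout's identity by minimality: a multiple of [s], up to relations of [x], with nonzero value
   and least size is compared with [f] by pseudo-division in both directions and turns out
   constant. *)
pose Q n := `[< exists h V : {poly A},
  [/\ size h = n, evx h != 0 & evx (h - V * s) = 0] >].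
have exQ : exists n, Q n.
  by exists (size s); apply/asboolP; exists s, 1; rewrite mul1r subrr /evx rmorph0 horner0.
case: (ex_minnP exQ) => d /asboolP[h0 [V [sh0 h0x h0V]]] min_d.
have [h sh [hE hl]] := exists_small h0.
have hx : evx h != 0 by rewrite /evx hE.
have hV : evx h = evx V * evx s.
  move/eqP: h0V; rewrite /evx rmorphB hornerD hornerN subr_eq0 => /eqP.
  by rewrite hE rmorphM hornerM.
have h_neq0 : h != 0 by apply: contraNneq hx => ->; rewrite /evx rmorph0 horner0.
move/(_ h_neq0): hl => hl.
have minh (g W : {poly A}) : (size g < size h)%N -> evx g = evx W * evx s -> evx g = 0.
  move=> gh gW; apply/eqP/negPn/negP => gx.
  suff /min_d : Q (size g) by rewrite leqNgt (leq_trans gh) // -sh0.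
  apply/asboolP; exists g, W; split=> //.
  by rewrite /evx rmorphB hornerD hornerN -/(evx g) gW rmorphM hornerM subrr.
have powl (a : A) i : eps a != 0 -> eps (a ^+ i) != 0.
  by move=> a0; rewrite rmorphXn expf_neq0.
have h_f : (size h < size f)%N.
  rewrite ltnNge; apply/negP => fh.
  have E := Pdiv.Idomain.divp_eq h f.
  have := congr1 evx E; rewrite evxZ evxD evxM fx mulr0 add0r => E'.
  have := @minh (h %% f) (lead_coef f ^+ scalp h f *: V).
  rewrite evxZ -mulrA -hV -E' => /(_ _ erefl) => H.
  have := H (leq_trans (ltn_modpN0 _ f_neq0) fh).
  by move=> /eqP; rewrite mulf_eq0 (negPf hx) orbF (negPf (powl _ _ fl)).
have sh1 : size h = 1%N.
  apply/eqP; rewrite eqn_leq size_poly_gt0 h_neq0 andbT leqNgt; apply/negP => h1.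
  have E := Pdiv.Idomain.divp_eq f h.
  have rx : evx (f %% h) = 0.
    apply: (@minh _ (- (f %/ h) * V)); first by rewrite ltn_modp.
    have := congr1 evx E; rewrite evxZ evxD evxM fx mulr0 => /esym/eqP.
    rewrite addrC addr_eq0 => /eqP ->.
    by rewrite evxM -mulrA -hV -scaleN1r evxZ rmorphN1 mulN1r mulNr.
  have r0 : map_poly eps (f %% h) = 0.
    by apply: minf => //; apply: ltn_trans h_f; rewrite ltn_modp.
  have qx : evx (f %/ h) = 0.
    have := congr1 evx E; rewrite evxZ evxD evxM fx mulr0 rx addr0 => /esym/eqP.
    by rewrite mulf_eq0 (negPf hx) orbF => /eqP.
  have q0 : map_poly eps (f %/ h) = 0.
    apply: minf => //; rewrite size_divp //; move: h1 f_neq0.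
    by rewrite -size_poly_gt0; case: (size h) => [|[|m]] //=; lia.
  have := congr1 (map_poly eps) E.
  rewrite rmorphD rmorphM /= q0 mul0r r0 addr0 map_polyZ => /eqP.
  by rewrite scaler_eq0 (negPf fn) orbF (negPf (powl _ _ hl)).
have [a a0 hA] : exists2 a, a != 0 & h = a%:P by apply/size_poly1P/eqP.
have la : lead_coef h = a by rewrite hA lead_coefC.
exists (lead_coef f * a); first by rewrite rmorphM mulf_neq0 // -la.
move=> phi Hphi; rewrite rmorphM mulf_eq0 negb_or => /andP[phil phia].
have sfphi : size (map_poly phi f) = size f by rewrite size_map_poly_id0.
have [y fy] : exists y, root (map_poly phi f) y.
  apply/closed_rootP; rewrite sfphi; apply: contraTneq h_f => ->.
  by rewrite sh1.
have Hg g : evx g = 0 -> (map_poly phi g).[y] = 0.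
  move=> gx; have E := Pdiv.Idomain.divp_eq g f.
  have r0 : map_poly eps (g %% f) = 0.
    apply: minf; first by rewrite ltn_modp.
    have := congr1 evx E.
    by rewrite evxZ evxD evxM fx gx !mulr0 add0r => <-.
  have := congr1 (fun f => (map_poly phi f).[y]) E.
  rewrite /= rmorphD rmorphM /= (phi0 phi _ Hphi r0) addr0 hornerM (rootP fy) mulr0.
  rewrite map_polyZ hornerZ => /eqP; rewrite mulf_eq0 rmorphXn expf_eq0.
  by rewrite (negPf phil) andbF => /eqP.
exists y => //.
have := Hg (h - V * s); rewrite {1}/evx rmorphB hornerD hornerN -/(evx h).
rewrite hV rmorphM hornerM subrr => /(_ erefl).
rewrite rmorphB rmorphM hornerD hornerN hornerM hA /= map_polyC hornerC.
move=> /eqP; rewrite subr_eq0 => /eqP E.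
by apply: contraNneq phia => sy; rewrite E sy mulr0.
Qed.

End ExtensionStep.

Fixpoint tower (N : nat) : idomainType :=
  if N is N'.+1 then {poly tower N'} else int.

Fixpoint tower_eval (K : fieldType) (x : nat -> K) N : {rmorphism tower N -> K} :=
  match N return {rmorphism tower N -> K} with
  | 0%N => intr
  | N'.+1 => horner_eval (x N') \o map_poly (tower_eval x N')
  end.

(** A form of the Nullstellensatz, removing one variable at a time; at the bottom an integer
    vanishes in [K] exactly when it vanishes in [L], the characteristics being equal. *)
Lemma specialization (K : fieldType) (L : closedFieldType) p (x : nat -> K) N
    (s : tower N) :
  p \in [pchar K] -> p \in [pchar L] -> tower_eval x N s != 0 ->
  exists2 y : nat -> L, tower_eval y N s != 0 &
    forall t, tower_eval x N t = 0 -> tower_eval y N t = 0.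
Proof.
move=> pK pL; elim: N s => [|N IH] s.
  move=> s0; exists (fun=> 0) => [|t] /=.
    by apply: contraNneq s0 => /eqP; rewrite -(dvdz_pcharf pL) (dvdz_pcharf pK).
  by move=> /eqP; rewrite -(dvdz_pcharf pK) (dvdz_pcharf pL) => /eqP.
move=> /(@extension_step _ _ L (tower_eval x N) (x N))[a /IH[y ya Hy] Ha].
have [z sz Hz] := Ha _ Hy ya.
pose y' i := if i == N then z else y i.
have yy' M : (M <= N)%N -> tower_eval y' M =1 tower_eval y M.
  elim: M => [|M IHM] MN t //=.
  rewrite /horner_eval /y' ltn_eqF //; congr (_.[_]).
  by apply: eq_map_poly => u; rewrite IHM // ltnW.
have E t : tower_eval y' N.+1 t = (map_poly (tower_eval y N) t).[z].
  rewrite /= /horner_eval {2}/y' eqxx; congr (_.[_]).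
  by apply: eq_map_poly => u; rewrite yy'.
by exists y' => [|t tx]; rewrite E // Hz.
Qed.

(** * Degrees of elements of a simple extension *)

(** The bound is uniform over the extension generated by [al]: remainders modulo [Q] live in a
    rational vector space of dimension [n], so [n + 1] of them are linearly dependent. *)
Lemma degree_bound (K : fieldType) (al : K) (Q f g : {poly int}) n :
  [pchar K] =i pred0 -> Q != 0 -> evi al Q = 0 -> (size Q <= n.+1)%N ->
  evi al g != 0 ->
  exists h : {poly int},
    [/\ h != 0, (size h <= n.+1)%N & evi (evi al f / evi al g) h = 0].
Proof.
move=> cK Q0 Qa sQ ga.
have intK0 (c : int) : c%:~R = 0 :> K -> c = 0.
  have nK m : m.+1%:R = 0 :> K -> False.
    by move=> /eqP /natf0_pchar[] // q; rewrite cK.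
  case: c => [[|m]|m] //; first by rewrite -pmulrn => /nK.
  by rewrite NegzE rmorphN /= -pmulrn => /eqP; rewrite oppr_eq0 => /eqP/nK.
pose toQ : {poly int} -> {poly rat} := map_poly intr.
have toQ_inj : injective toQ by apply: map_inj_poly => //; apply: intr_inj.
(* Homogenized powers: a relation among them, divided by the n-th power of [g], is a relation for
   [f / g], and no inverse of [g] modulo [Q] is needed. *)
pose F i := f ^+ i * g ^+ (n - i).
pose M := \matrix_(i < n.+1) (poly_rV (toQ (F i) %% toQ Q) : 'rV[rat]_n).
have [c cn0 cM] : exists2 c : 'rV_n.+1, c != 0 & c *m M = 0.
  have /rowV0Pn[c /sub_kermxP cM cn0] : kermx M != 0.
    by rewrite kermx_eq0 /row_free ltn_eqF // ltnS rank_leq_col.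
  by exists c.
have [h [a a0 hE]] := rat_poly_scale (rVpoly c).
have a0' : (a%:~R : rat) != 0 by rewrite intr_eq0.
have hc (i : 'I_n.+1) : (h`_i)%:~R = a%:~R * c 0 i :> rat.
  have := congr1 (fun f : {poly rat} => f`_i) hE.
  rewrite coef_rVpoly_ord coefZ coef_map /= => ->.
  by rewrite mulrA divff // mul1r.
have sh : (size h <= n.+1)%N.
  have -> : size h = size (rVpoly c).
    rewrite hE size_scale ?invr_eq0 // size_map_poly_id0 //.
    by rewrite intr_eq0 lead_coef_eq0; apply: contra_neq cn0 => h0;
       apply/rowP => i; apply: (mulfI a0'); rewrite -hc h0 coef0 mxE mulr0.
  exact: size_poly.
have h0 : h != 0.
  apply: contra_neq cn0 => h0; apply/rowP => i; apply: (mulfI a0').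
  by rewrite -hc h0 coef0 mxE mulr0.
have tQ0 : toQ Q != 0 by rewrite map_poly_eq0_id0 ?intr_eq0 ?lead_coef_eq0.
pose S := \sum_(i < n.+1) c 0 i *: (toQ (F i) %/ toQ Q).
have RS : \sum_(i < n.+1) c 0 i *: toQ (F i) = S * toQ Q.
  have -> : \sum_(i < n.+1) c 0 i *: toQ (F i) = S * toQ Q +
      \sum_(i < n.+1) c 0 i *: (toQ (F i) %% toQ Q).
    rewrite mulr_suml -big_split; apply: eq_bigr => i _ /=.
    by rewrite {1}[toQ (F i)](divp_eq _ (toQ Q)) scalerDr scalerAl.
  rewrite [X in _ + X](_ : _ = 0) ?addr0 //.
  transitivity (rVpoly (c *m M)); last by rewrite cM linear0.
  rewrite mulmx_sum_row linear_sum /=; apply: eq_bigr => i _.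
  rewrite linearZ /= rowK poly_rV_K // -ltnS (leq_trans _ sQ) //.
  apply: leq_trans (ltn_modpN0 _ tQ0) _; exact: size_poly.
(* Evaluation in [K] is set up for integer polynomials, so the denominators of the quotients are
   cleared as well. *)
have [S' [b b0 SE]] := rat_poly_scale S.
have intE : b *: (\sum_(i < n.+1) h`_i *: F i) = a *: (S' * Q).
  apply: toQ_inj; rewrite /toQ !map_polyZ /= rmorph_sum rmorphM /= -/toQ.
  have -> : \sum_(i < n.+1) toQ (h`_i *: F i) = a%:~R *: (S * toQ Q).
    rewrite -RS scaler_sumr; apply: eq_bigr => i _.
    by rewrite /toQ map_polyZ /= hc scalerA.
  rewrite SE -scalerAl !scalerA [b%:~R * _]mulrC mulfK ?intr_eq0 //.
exists h; split=> //.
have := congr1 (evi al) intE.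
rewrite -!mul_polyC !rmorphM /= Qa !mulr0 eviC => /eqP.
rewrite mulf_eq0 => /orP[/eqP/intK0 b0'|]; first by rewrite b0' eqxx in b0.
rewrite rmorph_sum /= => /eqP E.
apply: (mulfI (expf_neq0 n ga)); rewrite mulr0 -E eviE.
rewrite -eviE (evi_sum _ sh) mulr_sumr; apply: eq_bigr => i _.
rewrite -mul_polyC rmorphM rmorphM /= !rmorphXn /= eviC mulrCA; congr (_ * _).
rewrite exprMn exprVn mulrCA; congr (_ * _).
have -> : evi al g ^+ n = evi al g ^+ (n - i) * evi al g ^+ i.
  by rewrite -exprD subnK // -ltnS.
by rewrite mulfK // expf_neq0.
Qed.

Local Open Scope quotient_scope.

(** * Discrete valuations from uniformizers *)

(** Since the inverse of [pi] is not in [O], the exponent of [pi] in the decomposition of [x] is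
    unique, and [O] consists of 0 and the elements of nonnegative exponent. *)
Lemma exists_valuation (K : fieldType) (O : K -> Prop) (pi : K) :
  O 1 -> (forall x y, O x -> O y -> O (x - y)) ->
  (forall x y, O x -> O y -> O (x * y)) -> O pi -> ~ O pi^-1 ->
  (forall x, x != 0 -> exists (z : int) u, [/\ x = pi ^ z * u, O u & O u^-1]) ->
  exists2 v : discrete_valuation K, v pi = 1 & forall x, dval_ge v 0 x <-> O x.
Proof.
move=> O1 OB OM Opi nOpi dec.
have O0 : O 0 by rewrite -(subrr 1); apply: (OB).
have pi0 : pi != 0 by apply: contra_notN nOpi => /eqP->; rewrite invr0.
have OD x y : O x -> O y -> O (x + y).
  move=> Ox Oy; rewrite -[y]opprK; apply: (OB) => //.
  by rewrite -[- y]sub0r; apply: (OB).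
have OX x n : O x -> O (x ^+ n).
  by move=> Ox; elim: n => [|n IH]; rewrite ?expr0 // exprS; apply: (OM).
have /choice[v Hv] : forall x, exists z : int, x != 0 ->
    exists u, [/\ x = pi ^ z * u, O u & O u^-1].
  move=> x; case: (eqVneq x 0) => [->|/dec[z [u Hu]]]; first by exists 0.
  by exists z => _; exists u.
have ge0 z u : u != 0 -> O u^-1 -> O (pi ^ z * u) -> 0 <= z.
  move=> u0 Ou Oz; case: z Oz => // n Oz; case: nOpi.
  have -> : pi^-1 = (pi ^ Negz n * u) * u^-1 * pi ^+ n.
    rewrite mulfK // NegzE -exprnN exprS invfM -mulrA mulVf ?mulr1 //.
    by rewrite expf_neq0.
  by apply: (OM); [apply: (OM) | apply: (OX)].
have uniq z w u t : u != 0 -> t != 0 -> O u -> O u^-1 -> O t -> O t^-1 ->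
    pi ^ z * u = pi ^ w * t -> z <= w.
  move=> u0 t0 Ou Ou' Ot Ot' E; rewrite -subr_ge0.
  apply: (@ge0 _ (t / u)); [by rewrite mulf_neq0 ?invr_eq0| |].
    by rewrite invf_div; apply: (OM).
  have -> : pi ^ (w - z) * (t / u) = 1; last by [].
  apply: (mulfI (mulf_neq0 (expfz_neq0 z pi0) u0)); rewrite mulr1 mulrACA.
  by rewrite -expfzDr // addrC subrK [u * _]mulrC mulfVK // -E.
have vE x z u : x != 0 -> x = pi ^ z * u -> O u -> O u^-1 -> v x = z.
  move=> x0 xE Ou Ou'; have [t [xE' Ot Ot']] := Hv x x0.
  have nz w s : x = pi ^ w * s -> s != 0.
    by move=> E; apply: contraNneq x0 => s0; rewrite E s0 mulr0.
  apply/le_anti/andP; split.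
  - by apply: (uniq (v x) z t u) => //; rewrite -?xE -?xE' //; apply: nz; eassumption.
  - by apply: (uniq z (v x) u t) => //; rewrite -?xE' -?xE //; apply: nz; eassumption.
have unz x z u : x != 0 -> x = pi ^ z * u -> u != 0.
  by move=> x0 E; apply: contraNneq x0 => s0; rewrite E s0 mulr0.
have vge x z s : x != 0 -> x = pi ^ z * s -> O s -> z <= v x.
  move=> x0 xE Os; have [t [xE' Ot Ot']] := Hv x x0.
  rewrite -subr_ge0; apply: (ge0 _ t) => //; first exact: unz xE'.
  have -> : pi ^ (v x - z) * t = s; last by [].
  apply: (mulfI (expfz_neq0 z pi0)); rewrite -xE mulrA -expfzDr // addrC subrK.
  by rewrite -xE'.
have vM x y : x != 0 -> y != 0 -> v (x * y) = v x + v y.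
  move=> x0 y0; have [u [xE Ou Ou']] := Hv x x0; have [t [yE Ot Ot']] := Hv y y0.
  apply: (@vE _ _ (u * t)); rewrite ?mulf_neq0 ?invfM //; try exact: OM.
  by rewrite {1}xE {1}yE mulrACA expfzDr.
have vD x y : x != 0 -> y != 0 -> x + y != 0 -> Num.min (v x) (v y) <= v (x + y).
  have gen x' y' : x' != 0 -> y' != 0 -> x' + y' != 0 -> v x' <= v y' ->
      v x' <= v (x' + y').
    move=> x0 y0 xy0 xy.
    have [u [xE Ou _]] := Hv x' x0; have [t [yE Ot _]] := Hv y' y0.
    apply: (@vge _ _ (u + pi ^ (v y' - v x') * t)) => //.
      by rewrite mulrDr mulrA -expfzDr // [v x' + _]addrC subrK -xE -yE.
    apply: (OD) => //; apply: (OM) => //; have [n ->] : exists n : nat, v y' - v x' = n.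
      by exists `|v y' - v x'|%N; rewrite gez0_abs // subr_ge0.
    exact: OX.
  move=> x0 y0 xy0; case: (leP (v x) (v y)) => h; first exact: gen.
  by rewrite addrC; apply: gen; rewrite // 1?addrC // ltW.
have vS n : exists2 x, x != 0 & v x = n.
  exists (pi ^ n); first exact: expfz_neq0.
  by apply: (@vE _ _ 1); rewrite ?expfz_neq0 ?mulr1 ?invr1.
exists (DiscreteValuation vM vD vS) => /=.
  by apply: (@vE _ _ 1); rewrite ?expr1z ?mulr1 ?invr1.
move=> x; rewrite /dval_ge; case: (eqVneq x 0) => [->|x0] //=.
split=> [vx|Ox]; last by apply: (@vge _ _ x); rewrite ?expr0z ?mul1r.
have [u [xE Ou _]] := Hv x x0; rewrite xE; apply: (OM) => //.
have [n ->] : exists n : nat, v x = n by exists `|v x|%N; rewrite gez0_abs.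
exact: OX.
Qed.

Section ValuationTheory.

Variables (E : fieldType) (v : discrete_valuation E).

Lemma dval_geB n x y : dval_ge v n x -> dval_ge v n y -> dval_ge v n (x - y).
Proof. by move=> hx hy; apply: dval_geD => //; apply: dval_geN. Qed.

Lemma dval_ge01 : dval_ge v 0 1.
Proof. by rewrite /dval_ge dval1 lexx orbT. Qed.

Lemma dval_ge_sum n (I : Type) (r : seq I) (P : pred I) (F : I -> E) :
  (forall i, P i -> dval_ge v n (F i)) -> dval_ge v n (\sum_(i <- r | P i) F i).
Proof.
move=> H; elim/big_rec: _ => [|i x Pi]; first exact: dval_ge0.
by apply: dval_geD; apply: H.
Qed.

Lemma dval_ge0M x y : dval_ge v 0 x -> dval_ge v 0 y -> dval_ge v 0 (x * y).
Proof. by move=> hx hy; have := dval_geM hx hy; rewrite addr0. Qed.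

Lemma dval_geMl n x y : dval_ge v n x -> dval_ge v 0 y -> dval_ge v n (x * y).
Proof. by move=> hx hy; have := dval_geM hx hy; rewrite addr0. Qed.

Lemma dval_geMr n x y : dval_ge v 0 x -> dval_ge v n y -> dval_ge v n (x * y).
Proof. by move=> hx hy; have := dval_geM hx hy; rewrite add0r. Qed.

Lemma dval_ge0X x n : dval_ge v 0 x -> dval_ge v 0 (x ^+ n).
Proof.
move=> hx; elim: n => [|n IH]; first by rewrite expr0 dval_ge01.
by rewrite exprS dval_ge0M.
Qed.

Lemma dval_ge_eq0 x : (forall n : nat, dval_ge v n%:Z x) -> x = 0.
Proof.
move=> H; apply/eqP/negPn/negP => x0.
have := H `|v x|.+1%N; rewrite /dval_ge (negPf x0) /= => h.
by have := ler_norm (v x); lia.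
Qed.

Lemma dval_gt0N1 : ~~ dval_ge v 1 1.
Proof. by rewrite /dval_ge oner_eq0 dval1. Qed.

Lemma dvalX x n : x != 0 -> v (x ^+ n) = (v x) *+ n.
Proof.
move=> x0; elim: n => [|n IH]; first by rewrite expr0 dval1.
by rewrite exprS dvalM ?expf_neq0 // IH mulrS.
Qed.

Lemma dval_unit x : dval_ge v 0 x -> ~~ dval_ge v 1 x -> x != 0 /\ v x = 0.
Proof.
rewrite /dval_ge negb_or => /orP[/eqP->|x0]; first by rewrite eqxx.
by rewrite -ltNge => /andP[xn0 x1]; split=> //; apply/le_anti; rewrite x0 -ltzD1 x1.
Qed.

Lemma dval_ge_prime x y : dval_ge v 0 x -> dval_ge v 0 y -> dval_ge v 1 (x * y) ->
  dval_ge v 1 x \/ dval_ge v 1 y.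
Proof.
move=> hx hy; case: (boolP (dval_ge v 1 x)) => [|nx]; first by left.
case: (boolP (dval_ge v 1 y)) => [|ny]; first by right.
have [x0 vx] := dval_unit hx nx; have [y0 vy] := dval_unit hy ny.
by rewrite /dval_ge mulf_eq0 (negPf x0) (negPf y0) dvalM // vx vy.
Qed.

Lemma dval_ge1X x n : (0 < n)%N -> dval_ge v 0 x -> dval_ge v 1 (x ^+ n) -> dval_ge v 1 x.
Proof.
move=> n0 hx; elim: n n0 => // n IH _; rewrite exprS.
case: n IH => [|n] IH; first by rewrite expr0 mulr1.
by move=> /dval_ge_prime[] //; [exact: dval_ge0X | exact: IH].
Qed.

Lemma dval_ge_shift n x y : y != 0 -> dval_ge v (n + v y) (y * x) = dval_ge v n x.
Proof.
move=> y0; rewrite /dval_ge mulf_eq0 (negPf y0) /=.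
by case: (eqVneq x 0) => //= x0; rewrite dvalM // addrC lerD2l.
Qed.

End ValuationTheory.

(** * Ultraproducts of truncated local rings *)

Record ultra (U : (nat -> Prop) -> Prop) : Prop := Ultra {
  ultra_sub : forall A B, U A -> (forall i, A i -> B i) -> U B;
  ultra_and : forall A B, U A -> U B -> U (fun i => A i /\ B i);
  ultra_ge : forall N, U (fun i => N <= i)%N;
  ultra_not0 : ~ U (fun=> False);
  ultra_or : forall A, U A \/ U (fun i => ~ A i)
}.

Section Ultrafilter.

Import classical_sets filter.

Lemma exists_ultra : exists U, ultra U.
Proof.
have [G [GU FG]] := ultraFilterLemma eventually_filter.
exists G; split.
- by move=> A B GA AB; apply: filterS GA.
- by move=> A B GA GB; apply: filterI.
- by move=> N; apply: FG; exists N.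
- exact: filter_not_empty.
- by move=> A; apply: in_ultra_setVsetC.
Qed.

End Ultrafilter.

Section UltraLocal.

Import functions.

Variables (R : comNzRingType) (U : (nat -> Prop) -> Prop).
(** [J i N f] is to be read as: [f] has valuation at least [N] in the i-th local ring, with
    uniformizer [Y i]. The intersection of all [J i N] may be nonzero, so [Jlift] divides by
    [Y i ^+ N] only up to this intersection. *)
Variables (Y : nat -> R) (J : nat -> nat -> R -> Prop).
Hypotheses (HU : ultra U)
  (J0 : forall i f, J i 0 f) (JB : forall i N f g, J i N f -> J i N g -> J i N (f - g))
  (JM : forall i N f g, J i N g -> J i N (f * g))
  (J1 : forall i, ~ J i 1%N 1) (JS : forall i N f, J i N.+1 f -> J i N f)
  (JY : forall i N f, J i N f -> J i N.+1 (Y i * f))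
  (JYK : forall i N f, J i N.+1 (Y i * f) -> J i N f)
  (Jlift : forall i N f, J i N f -> exists h, forall M, J i M (f - Y i ^+ N * h))
  (Jinv : forall i f, ~ J i 1%N f -> exists g, J i 1%N (f * g - 1)).

Definition seqs := nat -> R.
HB.instance Definition _ := GRing.ComPzRing.on seqs.

Lemma seqs1_neq0 : (1 : seqs) != 0.
Proof. by apply/eqP => /(congr1 (@^~ 0%N)) /eqP; rewrite oner_eq0. Qed.

HB.instance Definition _ := GRing.PzSemiRing_isNonZero.Build seqs seqs1_neq0.

Definition uJ (N : nat) (x : seqs) : Prop := U (fun i => J i N (x i)).

(** These sequences have a valuation beyond every standard number along the ultrafilter; dividing
    them out collapses the nonstandard value group to the integers. *)
Definition null_seq : {pred seqs} := fun x => `[< forall N, uJ N x >].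

Lemma JD i N f g : J i N f -> J i N g -> J i N (f + g).
Proof.
move=> hf hg; rewrite -[g]opprK; apply: (JB hf); rewrite -sub0r.
by apply: (JB _ hg); rewrite -(subrr g); apply: (JB).
Qed.

Lemma uJB N x y : uJ N x -> uJ N y -> uJ N (x - y).
Proof.
move=> hx hy; apply: (ultra_sub HU (ultra_and HU hx hy)) => i [].
exact: JB.
Qed.

Lemma uJM N x y : uJ N y -> uJ N (x * y).
Proof. by move=> hy; apply: (ultra_sub HU hy) => i; apply: (JM). Qed.

Lemma uJ_all N x : (forall i, J i N (x i)) -> uJ N x.
Proof. by move=> H; apply: (ultra_sub HU (ultra_ge HU 0)) => i _. Qed.

Lemma Jz i N : J i N 0.
Proof. by rewrite -(mulr0 0); apply: (JM); elim: N => // N IH; rewrite -(mulr0 (Y i)); apply: (JY). Qed.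

Lemma uJD N x y : uJ N x -> uJ N y -> uJ N (x + y).
Proof.
by move=> hx hy; apply: (ultra_sub HU (ultra_and HU hx hy)) => i []; apply: (JD).
Qed.

Lemma null_seq_idealr : idealr_closed null_seq.
Proof.
split=> [||a x y].
- by apply/asboolP => N; apply: uJ_all => i; apply: Jz.
- apply/asboolP => /(_ 1%N) h; apply: (ultra_not0 HU).
  by apply: (ultra_sub HU h) => i /J1.
- move=> /asboolP hx /asboolP hy; apply/asboolP => N.
  by apply: (uJD) => //; apply: (uJM).
Qed.

HB.instance Definition _ := isIdealr.Build seqs null_seq null_seq_idealr.

Definition ulocal : Type := {ideal_quot null_seq}.

HB.instance Definition _ := GRing.ComNzRing.on ulocal.

Definition cls (x : seqs) : ulocal := \pi_ulocal x.

HB.instance Definition _ := GRing.RMorphism.copy cls (\pi_{ideal_quot null_seq} : seqs -> _).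

Lemma cls_eq0 x : cls x = 0 <-> forall N, uJ N x.
Proof.
have -> : (0 : ulocal) = cls 0 by rewrite rmorph0.
split=> [/eqP|H].
  by rewrite /cls -Quotient.idealrBE subr0 => /asboolP.
by apply/eqP; rewrite /cls -Quotient.idealrBE subr0; apply/asboolP.
Qed.

Lemma cls_surj y : exists x, cls x = y.
Proof. by exists (repr y); rewrite /cls reprK. Qed.


Lemma uJ_cls N x y : cls x = cls y -> uJ N x -> uJ N y.
Proof.
move=> E hx; rewrite -[y](subKr x); apply: uJB => //.
by move: N {hx}; apply/cls_eq0; rewrite rmorphB /= E subrr.
Qed.

Definition Yc : ulocal := cls (Y : seqs).

Lemma JYn i n h : J i n (Y i ^+ n * h).
Proof.
elim: n => [|n IH]; first exact: J0.
by rewrite exprS -mulrA; apply: JY.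
Qed.

Lemma seqsXE (x : seqs) n i : (x ^+ n) i = x i ^+ n.
Proof. by elim: n => [|n IH]; rewrite ?expr0 // !exprS -IH. Qed.

Lemma uJP N x : uJ N x <-> exists h, cls x = Yc ^+ N * cls h.
Proof.
split=> [hx|[h E]]; last first.
  apply: (uJ_cls (x := (Y : seqs) ^+ N * h)); first by rewrite rmorphM rmorphXn.
  by apply: uJ_all => i; rewrite -[X in J _ _ X]/(_ * _) seqsXE; apply: JYn.
have /choice[h Hh] : forall i, exists h, J i N (x i) ->
    forall M, J i M (x i - Y i ^+ N * h).
  move=> i; case: (pselect (J i N (x i))) => [/Jlift[h Hh]|nx]; first by exists h.
  by exists 0.
exists (h : seqs); apply/eqP; rewrite -subr_eq0 -rmorphXn -rmorphM -rmorphB.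
apply/eqP/cls_eq0 => M; apply: (ultra_sub HU hx) => i /Hh/(_ M).
by rewrite -seqsXE.
Qed.

Lemma Jmono i M N f : (M <= N)%N -> J i N f -> J i M f.
Proof.
elim: N => [|N IH]; first by rewrite leqn0 => /eqP->.
by rewrite leq_eqVlt => /orP[/eqP->//|MN] /JS; apply: IH.
Qed.

Lemma Jexp i k z : J i 1%N z -> J i k (z ^+ k).
Proof.
move=> z1; have [h Hh] := Jlift z1.
elim: k => [|k IH]; first exact: J0.
rewrite exprS -[X in X * _](subrK (Y i ^+ 1 * h)) mulrDl; apply: JD.
  by rewrite mulrC; apply: (JM).
by rewrite expr1 -mulrA; apply: JY; apply: (JM).
Qed.

Lemma uunit x : ~ uJ 1 x -> exists g, cls g * cls x = 1.
Proof.
move=> nx; have Ux : U (fun i => ~ J i 1%N (x i)).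
  by case: (ultra_or HU (fun i => J i 1%N (x i))).
have /choice[g Hg] : forall i, exists g, ~ J i 1%N (x i) -> J i 1%N (x i * g - 1).
  move=> i; case: (pselect (J i 1%N (x i))) => [xi|/Jinv[g Hg]]; last by exists g.
  by exists 0.
pose z i := 1 - x i * g i.
(* An inverse modulo [J i 1] is improved by a geometric series, cut in component [i] after [i]
   terms; the error lies in [J i i] and is null because the index eventually exceeds every [N]. *)
exists (fun i => g i * \sum_(k < i) z i ^+ k).
apply/eqP; rewrite -subr_eq0 -rmorphM -(rmorph1 cls) -rmorphB; apply/eqP/cls_eq0 => N.
apply: (ultra_sub HU (ultra_and HU Ux (ultra_ge HU N))) => i [/Hg xi Ni].
rewrite -[X in J _ _ X]/(g i * _ * x i - 1).
have -> : g i * (\sum_(k < i) z i ^+ k) * x i - 1 = - z i ^+ i.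
  rewrite mulrAC [g i * _]mulrC -[x i * g i](subKr 1) -/(z i).
  by rewrite -[1 - z i]opprB mulNr -subrX1 opprB addrAC subrr sub0r.
apply: (Jmono Ni); rewrite -sub0r; apply: (JB); first exact: Jz.
by apply: Jexp; rewrite /z -opprB -sub0r; apply: (JB) => //; apply: Jz.
Qed.

Lemma ulocal_dec (a : ulocal) : a != 0 -> exists n u g, a = Yc ^+ n * u /\ g * u = 1.
Proof.
have [x <-] := cls_surj a => x0.
have exn : exists n, `[< ~ uJ n x >].
  apply: contrapT => /forallNP H; move/eqP: x0; apply; apply/cls_eq0 => N.
  by have := H N; rewrite asboolE => /contrapT.
case: (ex_minnP exn) => -[|n] /asboolP nx min_n.
  by case: nx; apply: uJ_all => i; apply: J0.
have /uJP[h xE] : uJ n x.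
  apply: contrapT => /asboolP/min_n; by rewrite ltnn.
have [|g gh] := @uunit h; last by exists n, (cls h), (cls g).
move=> /uJP[h' hE]; apply: nx; apply/uJP; exists h'.
by rewrite xE hE expr1 mulrA -exprSr.
Qed.

Lemma Yc_cancel n (b : ulocal) : Yc ^+ n * b = 0 -> b = 0.
Proof.
elim: n b => [|n IH] b; first by rewrite mul1r.
rewrite exprSr -mulrA => /IH; have [x <-] := cls_surj b.
rewrite -rmorphM => /cls_eq0 H; apply/cls_eq0 => N.
by apply: (ultra_sub HU (H N.+1)) => i; apply: JYK.
Qed.

Definition ulocal_unit : {pred ulocal} := fun a => `[< exists b, b * a = 1 >].

Definition ulocal_inv (a : ulocal) : ulocal :=
  if pselect (exists b, b * a = 1) is left h then projT1 (cid h) else a.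

Lemma ulocal_mulVx : {in ulocal_unit, left_inverse 1 ulocal_inv *%R}.
Proof.
move=> a /asboolP h; rewrite /ulocal_inv; case: pselect => // h'.
by case: (cid h').
Qed.

Lemma ulocal_unitP (a b : ulocal) : b * a = 1 -> ulocal_unit a.
Proof. by move=> h; apply/asboolP; exists b. Qed.

Lemma ulocal_inv_out : {in [predC ulocal_unit], ulocal_inv =1 id}.
Proof.
move=> a; rewrite inE => /negP h; rewrite /ulocal_inv; case: pselect => // h'.
by case: h; apply/asboolP.
Qed.

HB.instance Definition _ := GRing.ComNzRing_hasMulInverse.Build ulocal
  ulocal_mulVx ulocal_unitP ulocal_inv_out.

Lemma ulocal_integral (a b : ulocal) : a * b = 0 -> (a == 0) || (b == 0).
Proof.
move=> ab; case: (eqVneq a 0) => //= a0.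
have [n [u [g [aE gu]]]] := ulocal_dec a0.
move: ab; rewrite aE -mulrA => /Yc_cancel ub.
by rewrite -[b]mul1r -gu -mulrA ub mulr0.
Qed.

HB.instance Definition _ := GRing.ComUnitRing_isIntegral.Build ulocal ulocal_integral.

Lemma fraction_dec (D : idomainType) (x : {fraction D}) :
  exists n d : D, d != 0 /\ x = FracField.tofrac n / FracField.tofrac d.
Proof.
elim/quotW: x => r; exists r.1, r.2; split; first exact: denom_ratioP.
have d0 : FracField.tofrac r.2 != 0 by rewrite tofrac_eq0 denom_ratioP.
apply: (mulIf d0); rewrite mulfVK //.
rewrite -[LHS]/(FracField.mul _ _) !piE; apply/eqmodP.
rewrite /= FracField.equivfE /FracField.mulf !numden_Ratio ?oner_neq0 ?mulr1 ?denom_ratioP //.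
by rewrite mulrC.
Qed.

Theorem ultraproduct_field :
  exists (E : fieldType) (v : discrete_valuation E) (st : {rmorphism seqs -> E}),
    [/\ dval_complete v, v (st (Y : seqs)) = 1,
       forall x N, dval_ge v N%:Z (st x) <-> U (fun i => J i N (x i)) &
       forall y, dval_ge v 0 y -> exists x, st x = y].
Proof.
pose E := {fraction ulocal} : fieldType.
pose st : {rmorphism seqs -> E} := (@FracField.tofrac ulocal) \o cls.
have st_surj a : exists x, st x = FracField.tofrac a.
  by have [x <-] := cls_surj a; exists x.
have Yc0 : Yc != 0.
  apply/eqP => Y0; have := @Yc_cancel 1 1; rewrite expr1 Y0 mul0r => /(_ erefl)/eqP.
  by rewrite oner_eq0.
pose O (y : E) := exists a, y = FracField.tofrac a.
have [|||||| v vY vO] := @exists_valuation E O (st (Y : seqs)).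
- by exists 1; rewrite tofrac1.
- by move=> _ _ [a ->] [b ->]; exists (a - b); rewrite tofracB.
- by move=> _ _ [a ->] [b ->]; exists (a * b); rewrite tofracM.
- by exists Yc.
- move=> [a E1]; have : Yc * a = 1.
    apply/eqP; rewrite -tofrac_eq tofracM tofrac1 -E1 divff //.
    by rewrite tofrac_eq0.
  have [x <-] := cls_surj a; rewrite -(rmorph1 cls) => Y1.
  have /(uJ_cls (N := 1)) : cls ((Y : seqs) * x) = cls 1 by rewrite rmorphM.
  move=> /(_ (uJ_all (fun i => JY (J0 i (x i))))) H.
  by apply: (ultra_not0 HU); apply: (ultra_sub HU H) => i /J1.
- move=> x x0; have [a [b [b0 xE]]] := fraction_dec x.
  have a0 : a != 0 by apply: contraNneq x0 => a0; rewrite xE a0 tofrac0 mul0r.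
  have [n [u [g [aE gu]]]] := ulocal_dec a0.
  have [m [w [h [bE hw]]]] := ulocal_dec b0.
  have tinv c d : d * c = 1 -> (FracField.tofrac c)^-1 = FracField.tofrac d :> E.
    move=> dc; have c0 : FracField.tofrac c != 0 :> E.
      rewrite tofrac_eq0; apply: contra_eq_neq dc => ->.
      by rewrite mulr0 eq_sym oner_neq0.
    by apply: (mulIf c0); rewrite mulVf // -tofracM dc tofrac1.
  have Y0 : FracField.tofrac Yc != 0 :> E by rewrite tofrac_eq0.
  exists (n%:Z - m%:Z), (FracField.tofrac (u * h)); split.
  + rewrite xE aE bE !tofracM !tofracXn invfM (tinv _ _ hw) expfzDr //.
    by rewrite -exprnP -exprnN mulrACA.
  + by exists (u * h).
  + exists (g * w); apply: tinv.
    by rewrite mulrACA gu mul1r mulrC hw.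
have stY : st (Y : seqs) = FracField.tofrac Yc by [].
have stE x N : dval_ge v N%:Z (st x) <-> U (fun i => J i N (x i)).
  have Y0 : st (Y : seqs) != 0 by rewrite tofrac_eq0.
  have vYN : v (st (Y : seqs) ^+ N) = N%:Z by rewrite dvalX // vY -mulr_natl mulr1 natz.
  rewrite -/(uJ N x); split=> [H|/uJP[h xE]].
    apply/uJP; have /vO[a aE] : dval_ge v 0 ((st (Y : seqs) ^+ N)^-1 * st x).
      by rewrite -(dval_ge_shift v _ _ (expf_neq0 N Y0)) vYN add0r mulVKf ?expf_neq0.
    have [h hE] := cls_surj a; exists h; apply/eqP; rewrite hE -tofrac_eq.
    rewrite tofracM tofracXn -stY -aE mulVKf; last exact: expf_neq0.
    exact: eqxx.
  have -> : st x = st (Y : seqs) ^+ N * st h.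
    by rewrite stY -tofracXn -tofracM -xE.
  rewrite -[N%:Z]add0r -{1}vYN dval_ge_shift ?expf_neq0 //.
  by apply/vO; exists (cls h).
exists E, v, st; split=> //; last first.
  by move=> y /vO[a ->]; apply: st_surj.
move=> u Cu.
have /choice[Nf HNf] : forall k : nat, exists N, forall i j,
    (N <= i)%N -> (N <= j)%N -> dval_ge v k%:Z (u i - u j).
  by move=> k; apply: Cu.
pose m k := (\sum_(j < k.+1) Nf j)%N.
have mN k i : (m k <= i)%N -> (Nf k <= i)%N.
  by apply: leq_trans; rewrite /m big_ord_recr leq_addl.
have m_mono k l : (k <= l)%N -> (m k <= m l)%N.
  elim: l => [|l IH]; first by rewrite leqn0 => /eqP->.
  rewrite leq_eqVlt => /orP[/eqP->//|kl]; apply: leq_trans (IH kl) _.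
  by rewrite {2}/m big_ord_recr leq_addr.
(* Subtracting the first term makes all terms integral, hence classes of sequences. *)
have /choice[a Ha] : forall k, exists x : seqs, st x = u (m k) - u (m 0%N).
  move=> k; have /vO[b ->] : dval_ge v 0 (u (m k) - u (m 0%N)); last exact: st_surj.
  by apply: HNf; apply: mN => //; apply: m_mono.
have aU k : U (fun i => J i k (a k.+1 i - a k i)).
  rewrite -/(uJ k (a k.+1 - a k)); apply/stE; rewrite rmorphB !Ha opprB addrA subrK.
  by apply: HNf; apply: mN => //; apply: m_mono.
pose S k i := forall j, (j < k)%N -> J i j (a j.+1 i - a j i).
have SU k : U (S k).
  elim: k => [|k IH]; first by apply: (ultra_sub HU (ultra_ge HU 0)).
  apply: (ultra_sub HU (ultra_and HU IH (aU k))) => i [Si Ji] j.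
  by rewrite ltnS leq_eqVlt => /orP[/eqP->|/Si].
have tel i n k : (k <= n)%N -> S n i -> J i k (a n i - a k i).
  elim: n => [|n IH]; first by rewrite leqn0 => /eqP-> _; rewrite subrr; apply: Jz.
  rewrite leq_eqVlt => /orP[/eqP->|kn] Sn; first by rewrite subrr; apply: Jz.
  rewrite -[a n.+1 i](subrK (a n i)) -addrA; apply: JD.
    by apply: (Jmono (N := n)) => //; apply: Sn.
  by apply: IH => // j jn; apply: Sn; apply: ltnW.
(* Diagonal choice: component [i] of the limit copies [a k] for the largest [k <= i] up to which the
   Cauchy conditions hold at [i]; for each fixed [k] they hold on a set of the ultrafilter. *)
have /choice[b Hb] : forall i, exists b, forall k, (k <= i)%N -> S k i ->
    J i k (b - a k i).
  move=> i; suff H n : exists b, forall k, (k <= n)%N -> S k i ->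
      J i k (b - a k i) by apply: H.
  elim: n => [|n [b IH]].
    by exists (a 0%N i) => k; rewrite leqn0 => /eqP-> _; rewrite subrr; apply: Jz.
  case: (pselect (S n.+1 i)) => Sn; first by exists (a n.+1 i) => k kn _; apply: tel.
  by exists b => k; rewrite leq_eqVlt => /orP[/eqP->|] //; apply: IH.
exists (st (b : seqs) + u (m 0%N)) => n; exists (m `|n|%N) => i hi.
apply: (@dval_ge_le _ _ `|n|%N%:Z); first exact: (le_trans (ler_norm n)).
rewrite -[u i](subrK (u (m `|n|%N))) -addrA; apply: dval_geD.
  by apply: HNf; apply: mN.
have -> : u (m `|n|%N) - (st (b : seqs) + u (m 0%N)) = - st ((b : seqs) - a `|n|%N).
  by rewrite rmorphB Ha opprB opprD addrA addrAC.
apply: dval_geN; apply/stE.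
apply: (ultra_sub HU (ultra_and HU (SU `|n|%N) (ultra_ge HU `|n|%N))) => j [Sj nj].
exact: Hb.
Qed.

End UltraLocal.

Local Close Scope quotient_scope.

(** * The complete field attached to a set of primes *)

Lemma exists_closure p : prime p -> exists L : closedFieldType,
  p \in [pchar L] /\ forall b : L, exists2 N, (0 < N)%N & b ^+ (p ^ N) = b.
Proof.
move=> p_pr; have [L [phi phi_int]] := countable_algebraic_closure 'F_p.
have pL : p \in [pchar L] by rewrite (fmorph_pchar phi) pchar_Fp.
exists L; split=> // b; have [f f_monic fb] := phi_int b.
pose g : {poly int} := map_poly (fun x : 'F_p => Posz (x : nat)) f.
have gE : map_poly intr g = map_poly phi f.
  apply/polyP => i; rewrite !coef_map /= coef_map_id0 //.
  by rewrite -pmulrn -[in RHS](natr_Zp f`_i) rmorph_nat.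
have [|||N [N0 _ bN]] := @root_exp_p _ _ pL b g (size g).
- by rewrite gE map_poly_eq0 monic_neq0.
- exact: leqnSn.
- by rewrite eviE gE; apply/rootP.
- by exists N.
Qed.

Lemma closed_prim_root (L : closedFieldType) n :
  n%:R != 0 :> L -> exists z : L, n.-primitive_root z.
Proof.
move=> n0; have n_gt0 : (0 < n)%N by case: n n0 => //; rewrite eqxx.
have [rs E] := closed_field_poly_normal ('X^n - 1 : {poly L}).
have mon : 'X^n - 1 \is @monic L by rewrite monicXnsubC.
move: E; rewrite (eqP mon) scale1r => E.
have szrs : size rs = n.
  have := congr1 (fun f : {poly L} => size f) E.
  by rewrite size_XnsubC // size_prod_XsubC => -[].
have urs : uniq rs by rewrite -separable_prod_XsubC -E separable_Xn_sub_1.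
have ars : all n.-unity_root rs.
  by apply/allP => z zrs; rewrite /root_of_unity E root_prod_XsubC.
have := has_prim_root n_gt0 ars urs; rewrite szrs leqnn => /(_ isT)/hasP[z _ zP].
by exists z.
Qed.

Definition seq_proj (R : comNzRingType) (i : nat) (x : seqs R) : R := x i.

HB.instance Definition _ (R : comNzRingType) i :=
  GRing.isZmodMorphism.Build (seqs R) R (@seq_proj R i) (fun x y => erefl).
HB.instance Definition _ (R : comNzRingType) i :=
  GRing.isMonoidMorphism.Build (seqs R) R (@seq_proj R i)
    (pair (erefl) (fun x y => erefl)).

Section Construction.

Variables (p : nat) (L : closedFieldType) (A : nat -> Prop).
Hypotheses (p_pr : prime p) (pL : p \in [pchar L]).

Let R := {poly {poly int}}.

(** [M i] makes [th ^+ M i] an l-th power for every prime [l] dividing it. The factorial [t i] is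
    divisible by all small exponents: this puts each finite field into almost all residue fields,
    and it makes [l] divide [n i], so that no further prime gives l-th roots. It is also at least
    [i + M i], which keeps [c] from being fixed by small Frobenius powers. *)
Let M i := (\prod_(l < i | [&& prime l, l != p :> nat & `[< A l >]]) l)%N.
Let t i := (i + M i)`!%N.
Let n i := (p ^ t i).-1.

Let p1 : (1 < p)%N. Proof. exact: prime_gt1. Qed.

Let M_gt0 i : (0 < M i)%N.
Proof. by apply: prodn_cond_gt0 => l /andP[/prime_gt0]. Qed.

Let t_ge i : (i + M i <= t i)%N.
Proof. by rewrite /t; elim: (i + M i)%N => // m IH; rewrite factS; have := fact_gt0 m; nia. Qed.

Let qn i : (p ^ t i = (n i).+1)%N.
Proof. by rewrite prednK // expn_gt0 prime_gt0. Qed.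

Let n_gt0 i : (0 < n i)%N.
Proof.
rewrite -ltnS -qn; apply: leq_ltn_trans (ltn_expl _ p1).
exact: fact_gt0.
Qed.

Let exists_data i : exists tm : L * {poly int},
  [/\ (n i).-primitive_root tm.1, tm.2 \is monic, evi tm.1 tm.2 = 0 &
     forall r : {poly int}, (size r < size tm.2)%N -> evi tm.1 r = 0 ->
        exists r', r = p%:R * r'].
Proof.
have [|z zP] := @closed_prim_root L (n i).
  have : (p ^ t i)%:R = 0 :> L.
    by rewrite natrX (pcharf0 pL) expr0n gtn_eqF // (leq_trans _ (t_ge i)) // ltn_addl.
  rewrite qn -natr1 => /eqP; rewrite addr_eq0 => /eqP ->.
  by rewrite oppr_eq0 oner_eq0.
have [l [_ _ lm l0 lmin]] := exists_min_poly pL (n_gt0 i) zP.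
by exists (z, Poly (map Posz l)).
Qed.

Let data : {tm : nat -> L * {poly int} | forall i,
  [/\ (n i).-primitive_root (tm i).1, (tm i).2 \is monic, evi (tm i).1 (tm i).2 = 0 &
     forall r : {poly int}, (size r < size (tm i).2)%N -> evi (tm i).1 r = 0 ->
        exists r', r = p%:R * r']}.
Proof. by have [tm H] := choice exists_data; exists tm. Qed.

Let th i := (sval data i).1.
Let m i := (sval data i).2.

Let th_prim i : (n i).-primitive_root (th i). Proof. by case: (svalP data i). Qed.
Let m_monic i : m i \is monic. Proof. by case: (svalP data i). Qed.
Let m_th i : evi (th i) (m i) = 0. Proof. by case: (svalP data i). Qed.
Let m_min i : forall r : {poly int}, (size r < size (m i))%N -> evi (th i) r = 0 ->
  exists r', r = p%:R * r'.
Proof. by case: (svalP data i). Qed.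

Let th_q i : th i ^+ (p ^ t i) = th i.
Proof. by rewrite qn exprS prim_expr_order // mulr1. Qed.

(** The inner variable of [R] stands for a lift of [th i]. The outer one is the future uniformizer,
    a root of the Eisenstein polynomial [eis i]. *)
Let c i : R := ('X^(M i))%:P.
Let eis i : R := 'X^p + p%:R * c i * 'X - p%:R.

Let J i N (f : R) := exists a b h : R, f = (m i)%:P * a + eis i * b + 'X^N * h.

Let res i (f : R) : L := evi (th i) f.[0].

Let resE i f : res i f = (evi (th i) \o horner_eval 0) f. Proof. by []. Qed.

Let resB i f g : res i (f - g) = res i f - res i g.
Proof. by rewrite /res hornerD hornerN rmorphB. Qed.

Let resM i f g : res i (f * g) = res i f * res i g.
Proof. by rewrite /res hornerM rmorphM. Qed.

Let res1 i : res i 1 = 1. Proof. by rewrite /res hornerC rmorph1. Qed.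

Let resX i f k : res i (f ^+ k) = res i f ^+ k.
Proof. by rewrite /res horner_exp rmorphXn. Qed.

Let J0 i f : J i 0 f.
Proof. by exists 0, 0, f; rewrite !mulr0 !add0r expr0 mul1r. Qed.

Let JB i N f g : J i N f -> J i N g -> J i N (f - g).
Proof.
move=> [a [b [h ->]]] [a' [b' [h' ->]]]; exists (a - a'), (b - b'), (h - h').
by ring.
Qed.

Let JM i N f g : J i N g -> J i N (f * g).
Proof.
by move=> [a [b [h ->]]]; exists (f * a), (f * b), (f * h); ring.
Qed.

Let JS i N f : J i N.+1 f -> J i N f.
Proof. by move=> [a [b [h ->]]]; exists a, b, ('X * h); rewrite exprSr mulrA. Qed.

Let JY i N f : J i N f -> J i N.+1 ('X * f).
Proof.
by move=> [a [b [h ->]]]; exists ('X * a), ('X * b), h; rewrite exprS; ring.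
Qed.

Let eis_dec i : eis i = 'X * ('X^(p.-1) + p%:R * c i) - p%:R.
Proof. by rewrite mulrDr -exprS prednK ?prime_gt0 // /eis; ring. Qed.

Let eis0 i : (eis i).[0] = - p%:R.
Proof. by rewrite eis_dec !hornerE /= -polyC_natr hornerC; ring. Qed.

Let res_J i f : J i 1 f <-> res i f = 0.
Proof.
split=> [[a [b [h ->]]]|f0].
  rewrite /res 2!hornerD 3!hornerM hornerC eis0 hornerXn expr0n mul0r addr0.
  rewrite rmorphD !rmorphM /= m_th mul0r add0r.
  by rewrite rmorphN rmorph_nat (pcharf0 pL) oppr0 mul0r.
have [h [r E]] := min_polyP (m_monic i) (m_th i) (@m_min i) f0.
have /factor_theorem[g gE] : root (f - (f.[0])%:P) 0.
  by rewrite /root hornerD hornerN hornerC subrr.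
exists h%:P, (- r%:P), (g + ('X^(p.-1) + p%:R * c i) * r%:P).
rewrite -[f](subrK (f.[0])%:P) gE E eis_dec polyC0 subr0 expr1.
by rewrite rmorphD !rmorphM /= polyC_natr; ring.
Qed.

Let horner0_dec (f : R) : exists g, f = (f.[0])%:P + 'X * g.
Proof.
have /factor_theorem[g gE] : root (f - (f.[0])%:P) 0.
  by rewrite /root hornerD hornerN hornerC subrr.
exists g; rewrite -[LHS](subrK (f.[0])%:P) gE polyC0 subr0; ring.
Qed.

(** At outer variable 0 the relation says that [m] times the value of [a] is [p] times that of [b].
    As [m] is monic, [p] divides the former value, and the latter is the same multiple of [m]. These
    two parts combine to a multiple of [p + eis i], which is divisible by the outer variable. *)
Let JYK i N f : J i N.+1 ('X * f) -> J i N f.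
Proof.
move=> [a [b [h E]]].
have E0 : m i * a.[0] = p%:R * b.[0].
  have := congr1 (fun g : R => g.[0]) E.
  rewrite 2!hornerD 4!hornerM hornerC eis0 hornerX hornerXn expr0n !mul0r addr0.
  by move=> /esym/eqP; rewrite mulNr subr_eq0 => /eqP.
have [a1 a1E] := dvd_int_poly_mul p_pr (m_monic i) E0.
have p0 : p%:R != 0 :> {poly int}.
  by rewrite -polyC_natr polyC_eq0 pnatr_eq0 -lt0n prime_gt0.
have b1E : b.[0] = m i * a1.
  by apply: (mulfI p0); rewrite -E0 a1E; ring.
have [a2 a2E] := horner0_dec a; have [b2 b2E] := horner0_dec b.
exists (a1%:P * ('X^(p.-1) + p%:R * c i) + a2), b2, h.
have X0 : 'X != 0 :> R by rewrite polyX_eq0.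
apply: (mulfI X0); rewrite E a2E b2E a1E b1E eis_dec exprS !rmorphM /= polyC_natr.
by ring.
Qed.

Let Jlift i N f : J i N f -> exists h, forall K, J i K (f - 'X^N * h).
Proof.
move=> [a [b [h ->]]]; exists h => K; exists a, b, 0.
by rewrite mulr0 addr0 addrK.
Qed.

Let res_q i f : res i f ^+ (p ^ t i) = res i f.
Proof. by rewrite /res -evi_exp_p // th_q. Qed.

Let res_unit i (y : L) : y ^+ (p ^ t i) = y -> y != 0 -> y ^+ (n i) = 1.
Proof.
by move=> yq y0; apply: (mulfI y0); rewrite -exprS -qn yq mulr1.
Qed.

Let Jinv i f : ~ J i 1 f -> exists g, J i 1 (f * g - 1).
Proof.
move=> /res_J/eqP f0.
have [k fk] := prim_rootP (th_prim i) (res_unit (res_q i f) f0).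
exists (('X^(n i - k))%:P); apply/res_J.
rewrite resB resM res1 fk /res hornerC rmorphXn /= eviX.
by rewrite -exprD subnKC ?(ltnW (ltn_ord k)) // prim_expr_order // subrr.
Qed.

Let J1 i : ~ J i 1 1.
Proof. by move/res_J/eqP; rewrite res1 oner_eq0. Qed.

Let res_st i (x : seqs R) g : res i (evi (x : seqs R) g i) = evi (res i (x i)) g.
Proof.
rewrite -[evi x g i]/(seq_proj i (evi x g)) evi_morph resE.
by rewrite (evi_morph (evi (th i) \o horner_eval 0)).
Qed.

Lemma exists_field :
  exists (E : fieldType) (v : discrete_valuation E) (pi c : E),
    [/\ dval_complete v,
        forall g : {poly int}, g \is monic -> (1 < size g)%N ->
          exists2 x, dval_ge v 0 x & dval_ge v 1 (evi x g),
        [/\ pi != 0, v pi = 1, pi ^+ p = p%:R * (1 - c * pi), dval_ge v 0 c &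
          forall N, (0 < N)%N -> ~~ dval_ge v 1 (c ^+ (p ^ N) - c)] &
        forall l, prime l -> l != p ->
          (A l -> exists z, z ^+ l = c) /\
          (~ A l -> forall z, dval_ge v 0 z -> ~~ dval_ge v 1 (z ^+ l - c))].
Proof.
have [U HU] := exists_ultra.
have [E [v [st [v_complete v_pi stJ st_surj]]]] :=
  ultraproduct_field HU J0 JB JM J1 JS JY JYK Jlift Jinv.
have U_ge (P : nat -> Prop) N : (forall i, (N <= i)%N -> P i) -> U P.
  by move=> H; apply: (ultra_sub HU (ultra_ge HU N)).
have U_ge_not (P : nat -> Prop) N : (forall i, (N <= i)%N -> ~ P i) -> ~ U P.
  move=> H UP; apply: (ultra_not0 HU).
  by apply: (ultra_sub HU (ultra_and HU UP (ultra_ge HU N))) => i [Pi /H].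
pose sY : seqs R := fun=> 'X.
pose sc : seqs R := c.
have res_c i k : res i (c i ^+ k) = th i ^+ (M i * k).
  by rewrite /res -rmorphXn hornerC -exprM rmorphXn /= eviX.
have seqX (x : seqs R) k i : (x ^+ k) i = x i ^+ k.
  by rewrite -[LHS]/(seq_proj i (x ^+ k)) rmorphXn.
have subE (x : seqs R) k i : (x ^+ k - sc) i = x i ^+ k - c i.
  by rewrite -[LHS]/(seq_proj i (x ^+ k - sc)) rmorphB rmorphXn.
exists E, v, (st sY), (st sc); split=> //.
- move=> g g_monic sg.
  have [b gb] : exists b : L, evi b g = 0.
    have /closed_rootP[b /rootP gb] : size (map_poly intr g : {poly L}) != 1%N.
      by rewrite size_map_poly_id0 ?(eqP g_monic) ?oner_eq0 // gtn_eqF.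
    by exists b.
  have g0 : map_poly intr g != 0 :> {poly L}.
    by rewrite monic_neq0 // monic_map.
  have [N [N0 Ng bN]] := root_exp_p pL g0 (leqnSn _) gb.
  have /choice[f fE] : forall i, exists f : {poly int}, (N <= i)%N -> evi (th i) f = b.
    move=> i; case: (leqP N i) => Ni; last by exists 0.
    case: (eqVneq b 0) => [->|b0]; first by exists 0 => _; rewrite rmorph0.
    have bq : b ^+ (p ^ t i) = b.
      (* Here the factorial matters: it is divisible by [N] once [i] is at least [N], so the root
         [b] lies in the i-th residue field. *)
      have /dvdnP[k ->] : (N %| t i)%N.
        by rewrite dvdn_fact // N0 (leq_trans Ni) ?leq_addr.
      by rewrite mulnC exp_p_iter.
    have [k ->] := prim_rootP (th_prim i) (res_unit bq b0).
    by exists 'X^k => _; rewrite rmorphXn /= eviX.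
  exists (st (fun i => (f i)%:P)).
    by apply/(stJ _ 0%N)/(U_ge _ 0%N) => i _; apply: J0.
  rewrite -evi_morph; apply/(stJ _ 1%N)/(U_ge _ N) => i Ni.
  by apply/res_J; rewrite res_st /res hornerC fE.
- split=> //.
  + apply/eqP => Y0; have /(stJ _ 2%N) : dval_ge v 2 (st sY) by rewrite Y0 dval_ge0.
    apply: (U_ge_not _ 0%N) => i _; rewrite /sY -['X]mulr1 => /JYK.
    exact: J1.
  + apply/eqP; rewrite -subr_eq0; apply/eqP; apply: (@dval_ge_eq0 _ v) => N.
    have -> : st sY ^+ p - p%:R * (1 - st sc * st sY) =
        st (sY ^+ p - p%:R * (1 - sc * sY)).
      by rewrite !(rmorphB, rmorphM, rmorphXn) /= rmorph1 rmorph_nat.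
    apply/stJ/(U_ge _ 0%N) => i _; exists 0, 1, 0.
    rewrite -[LHS]/(seq_proj i _) !(rmorphB, rmorphM, rmorphXn) /= rmorph1 rmorph_nat.
    by rewrite /seq_proj /sY /sc /eis; ring.
  + by apply/(stJ _ 0%N)/(U_ge _ 0%N) => i _; apply: J0.
  + move=> N N0; rewrite -rmorphXn -rmorphB; apply/negP => /(stJ _ 1%N).
    apply: (U_ge_not _ N) => i Ni /res_J.
    rewrite subE resB res_c -[c i]expr1 res_c muln1 => /eqP.
    rewrite subr_eq0 (eq_prim_root_expr (th_prim i)) eqn_mod_dvd; last first.
      by rewrite leq_pmulr // expn_gt0 prime_gt0.
    have pN1 : (1 < p ^ N)%N by rewrite -(exp1n N) ltn_exp2r.
    have -> : (M i * p ^ N - M i = M i * (p ^ N - 1))%N by rewrite mulnBr muln1.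
    (* If the residue were fixed, the order [n i] would divide the positive number
       [M i * (p ^ N - 1)], which is smaller than [n i] because [t i] is at least [i + M i]. *)
    move=> /dvdn_leq; rewrite muln_gt0 M_gt0 subn_gt0 pN1.
    move=> /(_ isT); rewrite leqNgt => /negP; apply.
    rewrite -ltnS -qn; apply: leq_trans (leq_pexp2l (ltnW p1) (t_ge i)).
    rewrite expnD; have := ltn_expl (M i) p1; have := leq_pexp2l (ltnW p1) Ni.
    by move: (M_gt0 i) pN1; nia.
- move=> l l_pr lp; split=> [Al|nAl z].
  + exists (st (fun i => ('X^(M i %/ l))%:P)); rewrite -rmorphXn; apply/eqP.
    rewrite -subr_eq0 -rmorphB; apply/eqP/(@dval_ge_eq0 _ v) => N.
    apply/stJ/(U_ge _ l.+1) => i li.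
    have -> : ((fun i => ('X^(M i %/ l))%:P) : seqs R) ^+ l - sc =
        ((fun i => (('X^(M i %/ l))%:P) ^+ l - c i) : seqs R).
      by apply/funext => j; rewrite -[LHS]/(seq_proj j _) rmorphB rmorphXn.
    have lM : (l %| M i)%N.
      rewrite /M (bigD1 (Ordinal li)) /= ?dvdn_mulr //.
      by rewrite l_pr lp; apply/asboolP.
    rewrite /c -rmorphXn /= -exprM divnK // subrr; exists 0, 0, 0.
    by rewrite !mulr0 !addr0.
  + move=> /st_surj[x <-]; rewrite -rmorphXn -rmorphB; apply/negP => /(stJ _ 1%N).
    apply: (U_ge_not _ l) => i li /res_J.
    rewrite subE resB resX -[c i]expr1 res_c muln1.
    move=> /eqP; rewrite subr_eq0 => /eqP xl.
    have thM0 : th i ^+ M i != 0.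
      rewrite expf_neq0 //; apply: contra_eq_neq (prim_expr_order (th_prim i)) => ->.
      by rewrite expr0n gtn_eqF // eq_sym oner_neq0.
    have x0 : res i (x i) != 0.
      by apply: contraNneq thM0 => x0; rewrite -xl x0 expr0n gtn_eqF // prime_gt0.
    have xn := res_unit (res_q i (x i)) x0.
    (* By Euler's theorem, since [l.-1] divides the factorial exponent [t i] once [i] is at least
       [l]. *)
    have ln : (l %| n i)%N.
      have cop : coprime p l by rewrite prime_coprime // dvdn_prime2 // eq_sym.
      have /dvdnP[k tE] : (totient l %| t i)%N.
        rewrite totient_prime // dvdn_fact //; apply/andP; split.
          by rewrite -ltnS prednK ?prime_gt1 ?prime_gt0.
        exact: leq_trans (leq_pred l) (leq_trans li (leq_addr _ _)).
      have := Euler_exp_totient cop => /eqP.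
      have : (p ^ t i == 1 %[mod l])%N.
        by rewrite tE mulnC expnM -modnXm Euler_exp_totient // modnXm exp1n.
      by rewrite eqn_mod_dvd ?expn_gt0 ?prime_gt0 // subn1.
    (* An l-th root of [th ^+ M] forces the power of [th] with exponent [M * (n / l)] to be 1; as
       [n] is the exact order, [l] divides [M] and is one of its prime factors. *)
    have nMl : (n i %| M i * (n i %/ l))%N.
      rewrite (prim_order_dvd (th_prim i)) exprM -xl -exprM.
      by rewrite mulnC divnK // xn.
    have lM : (l %| M i)%N.
      move: nMl; rewrite -{1}(divnK ln) mulnC dvdn_pmul2r // divn_gt0 ?prime_gt0 //.
      by rewrite dvdn_leq.
    have : exists2 l', (l %| l')%N & [&& prime l', l' != p & `[< A l' >]].
      move: lM; rewrite /M; elim/big_ind: _ => [|a b Ha Hb|l' Pl' ll'].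
      - by rewrite dvdn1 => /eqP l1; move: l_pr; rewrite l1.
      - by rewrite Euclid_dvdM // => /orP[/Ha|/Hb].
      - by exists l'.
    move=> [l' ll' /and3P[l'_pr _ /asboolP Al']]; apply: nAl.
    by move: ll'; rewrite dvdn_prime2 // => /eqP->.
Qed.

End Construction.

Local Open Scope quotient_scope.

(** * Residues, Hensel's lemma *)

Section Residue.

Variables (E : fieldType) (v : discrete_valuation E).

Definition red (x : vring v) : residue_field v := \pi_(residue_field v) x.

HB.instance Definition _ :=
  GRing.RMorphism.copy red (\pi_{ideal_quot (@vmax E v)} : vring v -> _).

Lemma red_eq0 x : (red x == 0) = dval_ge v 1 (val x).
Proof.
by rewrite -[0](rmorph0 red) /red -Quotient.idealrBE subr0.
Qed.

Lemma red_surj y : exists x, red x = y.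
Proof. by exists (repr y); rewrite /red reprK. Qed.

Lemma vring_valK x (hx : dval_ge v 0 x) : exists y : vring v, val y = x.
Proof. by exists (VRing hx). Qed.

Definition vval : {rmorphism vring v -> E} := \val.

Lemma val_nat n : val (n%:R : vring v) = n%:R.
Proof. exact: (rmorph_nat vval). Qed.

Lemma val_X (x : vring v) n : val (x ^+ n) = val x ^+ n.
Proof. exact: (rmorphXn vval). Qed.

Lemma val_evi (x : vring v) f : val (evi x f) = evi (val x) f.
Proof. exact: (evi_morph vval). Qed.

End Residue.

Lemma poly_taylor (R : comNzRingType) (f : {poly R}) (x h : R) :
  exists r, f.[x + h] = f.[x] + f^`().[x] * h + h ^+ 2 * r.
Proof.
elim/poly_ind: f => [|f c [r IH]].
  by exists 0; rewrite deriv0 !horner0; ring.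
exists (f^`().[x] + (x + h) * r).
by rewrite derivMXaddC !hornerE IH; ring.
Qed.

Lemma poly_diff (R : comNzRingType) (f : {poly R}) (x y : R) :
  exists r, f.[x] = f.[y] + (x - y) * r.
Proof.
have [r E] := poly_taylor f y (x - y); exists (f^`().[y] + (x - y) * r).
by rewrite -[x in LHS](subrK y) addrC E; ring.
Qed.

Lemma int_poly_primitive p (g : {poly int}) : prime p -> g != 0 ->
  exists k g', g = p%:R ^+ k * g' /\ ~ exists r, g' = p%:R * r.
Proof.
move=> p_pr; elim: {g}_.+1 {-2}g (ltnSn `|lead_coef g|%N) => // n IH g gn g0.
case: (pselect (exists r, g = p%:R * r)) => [[r gE]|ng]; last first.
  by exists 0%N, g; rewrite expr0 mul1r.
have r0 : r != 0 by apply: contraNneq g0 => r0; rewrite gE r0 mulr0.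
have [||k [g' [rE ng']]] := IH r.
- move: gn; rewrite gE -polyC_natr mul_polyC lead_coefZ natz abszM absz_nat => gn.
  have r1 : (0 < `|lead_coef r|)%N by rewrite absz_gt0 lead_coef_eq0.
  by have := prime_gt1 p_pr; move: gn r1; set a := `|_|%N; nia.
- by [].
by exists k.+1, g'; rewrite gE rE exprS mulrA.
Qed.

Lemma exp_p_add1 (R : comNzRingType) (p : nat) (b : R) : prime p ->
  exists r, (1 + b) ^+ p = 1 + b ^+ p + p%:R * b * r.
Proof.
case: p => // q p_pr.
exists (\sum_(i < q) ('C(q.+1, i.+1) %/ q.+1)%:R * b ^+ i).
rewrite exprDn big_ord_recl big_ord_recr /= !bin0 binn expr0 mulr1 !expr1n.
rewrite !mul1r -addrA [X in 1 + X]addrC; congr (1 + (_ + _)).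
rewrite mulr_sumr; apply: eq_bigr => i _; rewrite expr1n mul1r /bump leq0n add1n.
have /dvdnP[k kE] : (q.+1 %| 'C(q.+1, i.+1))%N by rewrite prime_dvd_bin //= ltnS.
by rewrite kE mulnK // exprS -mulr_natr natrM; ring.
Qed.

Section CompleteField.

Variables (E : fieldType) (v : discrete_valuation E).

Section Hensel.

Hypothesis v_complete : dval_complete v.

(** Newton's iteration with the inverse of the derivative at [a] kept fixed: convergence is only
    linear, but each step gains one unit of valuation and stays congruent to [a]. *)
Lemma hensel (f : {poly vring v}) (a : vring v) :
  dval_ge v 1 (val f.[a]) -> ~~ dval_ge v 1 (val f^`().[a]) ->
  exists2 x, f.[x] = 0 & dval_ge v 1 (val (x - a)).
Proof.
move=> fa f'a.
have valD (x y : vring v) : val (x + y) = val x + val y by [].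
have valM (x y : vring v) : val (x * y) = val x * val y by [].
have valN (x : vring v) : val (- x) = - val x by [].
have [u0 vu] := dval_unit (valP _) f'a.
have [u uE] : exists u : vring v, val u = (val f^`().[a])^-1.
  by apply: vring_valK; rewrite /dval_ge dvalV // vu oppr0 lexx orbT.
have uf' : u * f^`().[a] = 1 by apply: val_inj; rewrite valM uE mulVf.
pose x i := iter i (fun y => y - u * f.[y]) a.
have xS i : x i.+1 = x i - u * f.[x i] by [].
have H i : dval_ge v i.+1%:Z (val f.[x i]) /\ dval_ge v 1 (val (x i - a)).
  elim: i => [|i [IH1 IH2]]; first by rewrite subrr dval_ge0.
  have IH1' : dval_ge v 1 (val f.[x i]) by apply: dval_ge_le IH1.
  split; last first.
    rewrite xS addrAC valD valN valM; apply: dval_geB => //.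
    by apply: dval_geMr => //; apply: valP.
  have [r rE] := poly_taylor f (x i) (- (u * f.[x i])).
  have [s sE] := poly_diff f^`() (x i) a.
  have -> : f.[x i.+1] = f.[x i] * (- (u * (x i - a) * s) + f.[x i] * (u ^+ 2 * r)).
    rewrite xS rE sE; rewrite -[X in X + _ * _ + _]mul1r -uf'; ring.
  rewrite valM (_ : i.+2%:Z = i.+1%:Z + 1); last by lia.
  apply: dval_geM => //.
  rewrite valD valN; apply: dval_geD.
    apply: dval_geN; rewrite 2!valM; apply: dval_geMl; last exact: valP.
    by apply: dval_geMr => //; apply: valP.
  by rewrite valM; apply: dval_geMl => //; apply: valP.
have step i : dval_ge v i.+1%:Z (val (x i.+1) - val (x i)).
  rewrite xS valD valN valM addrAC subrr sub0r; apply: dval_geN.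
  by apply: dval_geMr; [apply: valP | case: (H i)].
have far i k : dval_ge v i.+1%:Z (val (x (i + k)%N) - val (x i)).
  elim: k => [|k IH]; first by rewrite addn0 subrr dval_ge0.
  rewrite addnS -[val (x _.+1)](subrK (val (x (i + k)%N))) -addrA.
  by apply: dval_geD => //; apply: dval_ge_le (step _); lia.
have [|l Hl] := v_complete (u := fun i => val (x i)).
  move=> n; exists `|n|%N => i j ni nj.
  have gen k : (`|n| <= k)%N -> dval_ge v n (val (x k) - val (x `|n|%N)).
    move=> nk; rewrite -(subnKC nk); apply: dval_ge_le (far _ _).
    by have := ler_norm n; lia.
  have -> : val (x i) - val (x j) =
    (val (x i) - val (x `|n|%N)) - (val (x j) - val (x `|n|%N)) by ring.
  by apply: dval_geB; apply: gen.
have lx i : dval_ge v i.+1%:Z (l - val (x i)).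
  have [N HN] := Hl i.+1%:Z; have := HN (i + N)%N (leq_addl _ _).
  move=> /dval_geN h; have -> : l - val (x i) =
    - (val (x (i + N)%N) - l) + (val (x (i + N)%N) - val (x i)) by ring.
  by apply: dval_geD => //; apply: far.
have [y yE] : exists y : vring v, val y = l.
  apply: vring_valK; rewrite -[l](subrK (val (x 0%N))); apply: dval_geD.
    by apply: dval_ge_le (lx 0%N).
  exact: valP.
exists y; last by rewrite valD valN yE; apply: (lx 0%N).
apply: val_inj; apply: (@dval_ge_eq0 _ v) => n.
have [r ->] := poly_diff f y (x n).
rewrite valD valM valD valN yE; apply: dval_geD.
  by apply: dval_ge_le (proj1 (H n)); lia.
apply: dval_geMl; last exact: valP.
by apply: dval_ge_le (lx n); lia.
Qed.

End Hensel.

Section ResidueCharacteristic.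

Variable p : nat.
Hypotheses (p_pr : prime p) (p_max : dval_ge v 1 p%:R) (p0 : p%:R != 0 :> E).

Lemma residue_pchar : p \in [pchar (residue_field v)].
Proof.
rewrite inE p_pr -(rmorph_nat (@red E v)) red_eq0.
by rewrite val_nat p_max.
Qed.

Lemma field_pchar0 : [pchar E] =i pred0.
Proof.
move=> q; rewrite !inE; apply/negP => /andP[q_pr /eqP q0].
have : q%:R == 0 :> residue_field v.
  rewrite -(rmorph_nat (@red E v)) red_eq0.
  by rewrite val_nat q0 dval_ge0.
rewrite -(dvdn_pcharf residue_pchar) dvdn_prime2 // => /eqP pq.
by move/eqP: p0; rewrite pq q0.
Qed.

(** After removing powers of [p], the relation stays nonzero in the residue field. The bound on [N]
    later allows one exponent to serve a whole residue field. *)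
Lemma residue_algebraic (y : E) (g : {poly int}) n :
  dval_ge v 0 y -> g != 0 -> evi y g = 0 -> (size g <= n.+1)%N ->
  exists N, [/\ (0 < N)%N, (N <= n)%N & dval_ge v 1 (y ^+ (p ^ N) - y)].
Proof.
move=> /vring_valK[x <-] g0; have [k [g' [gE ng']]] := int_poly_primitive p_pr g0.
rewrite gE rmorphM rmorphXn rmorph_nat => /eqP.
rewrite mulf_eq0 expf_eq0 (negPf p0) andbF /= => /eqP g'x sg.
have g'0 : map_poly intr g' != 0 :> {poly residue_field v}.
  apply: contra_notN ng' => /eqP g'0; apply/dvd_int_polyP => i.
  by rewrite (dvdz_pcharf residue_pchar) -coef_map g'0 coef0.
have sg' : (size g' <= n.+1)%N.
  suff <- : size (p%:R ^+ k * g') = size g' by [].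
  rewrite -polyC_natr -polyC_exp mul_polyC.
  by rewrite size_scale // expf_neq0 // pnatr_eq0 -lt0n prime_gt0.
have [|N [N0 Nn xN]] := root_exp_p residue_pchar (b := red x) g'0 sg'.
  by rewrite -evi_morph; apply/eqP; rewrite red_eq0 val_evi g'x dval_ge0.
exists N; split=> //; move/eqP: xN; rewrite -subr_eq0 -rmorphXn -rmorphB red_eq0.
by rewrite -val_X.
Qed.

End ResidueCharacteristic.

Variable p : nat.
Hypotheses (p_pr : prime p) (vp : v p%:R = p%:Z) (p0 : p%:R != 0 :> E).

Let p_gt0 : (0 < p)%N. Proof. exact: prime_gt0. Qed.

Lemma dval_ge_p : dval_ge v p%:Z p%:R.
Proof. by rewrite /dval_ge vp lexx orbT. Qed.

Lemma dval_ge1_p : dval_ge v 1 p%:R.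
Proof. by apply: dval_ge_le dval_ge_p; rewrite lez_nat. Qed.

Let dval0E x : x != 0 -> v x = 0 -> dval_ge v 0 x.
Proof. by move=> x0 vx; rewrite /dval_ge vx lexx orbT. Qed.

(* A uniformizer [pi] with [pi ^+ p = p * (1 - y * pi)] is determined up to a
   factor congruent to 1 since the residue field has no nontrivial p-th root
   of unity; the p-th power of this factor is then congruent to 1 modulo the
   square of a uniformizer. *)
Lemma twist_unique pi1 y1 pi2 y2 :
  dval_ge v 0 y1 -> dval_ge v 0 y2 ->
  pi1 ^+ p = p%:R * (1 - y1 * pi1) -> pi2 ^+ p = p%:R * (1 - y2 * pi2) ->
  [/\ pi1 != 0, v pi1 = 1 & dval_ge v 1 (y1 - y2)].
Proof.
have unif pi y : dval_ge v 0 y -> pi ^+ p = p%:R * (1 - y * pi) ->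
    [/\ pi != 0, v pi = 1 & v (1 - y * pi) = 0 /\ 1 - y * pi != 0].
  move=> hy E1.
  have pi0 : pi != 0.
    apply/eqP => pi0; move/eqP: E1; rewrite pi0 expr0n gtn_eqF // mulr0 subr0 mulr1.
    by rewrite eq_sym (negPf p0).
  have u0 : 1 - y * pi != 0.
    have : pi ^+ p != 0 by rewrite expf_neq0.
    by rewrite E1 mulf_eq0 negb_or => /andP[].
  have vE : v pi *+ p = p%:Z + v (1 - y * pi) by rewrite -dvalX // E1 dvalM // vp.
  (* Otherwise [v (1 - y * pi)] is at least [v pi], and comparing valuations in the equation makes
     [p - 1] times [v pi] at least [p], although [v pi] is not positive. *)
  have hpi : 1 <= v pi.
    rewrite leNgt; apply/negP => h; have h' : v pi <= 0 by lia.
    have : dval_ge v (v pi) (1 - y * pi).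
      apply: dval_geB; first by rewrite /dval_ge dval1 h' orbT.
      by apply: dval_geMr => //; rewrite /dval_ge lexx orbT.
    rewrite /dval_ge (negPf u0) /=; have := prime_gt1 p_pr; move: vE.
    by rewrite -mulr_natr natz; nia.
  have ypi : dval_ge v 1 (y * pi).
    by apply: dval_geMr => //; rewrite /dval_ge hpi orbT.
  have u1 : v (1 - y * pi) = 0.
    suff [] : 1 - y * pi != 0 /\ v (1 - y * pi) = 0 by [].
    apply: dval_unit.
      by apply: dval_geB; [apply: dval_ge01 | apply: dval_ge_le ypi].
    apply/negP => h; have := dval_gt0N1 v.
    have -> : 1 = (1 - y * pi) + y * pi :> E by rewrite subrK.
    by rewrite dval_geD.
  split=> //; move: vE; rewrite u1 addr0 -mulr_natr natz => vE.
  by have := prime_gt1 p_pr; nia.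
move=> hy1 hy2 E1 E2.
have [pi10 v1 [vu1 u10]] := unif _ _ hy1 E1; have [pi20 v2 [vu2 u20]] := unif _ _ hy2 E2.
have p2 : p.-2.+2 = p by move: (prime_gt1 p_pr); case: (p) => [|[|q]].
split=> //; pose a := pi2 / pi1.
have a0 : a != 0 by rewrite mulf_neq0 ?invr_eq0.
have va : v a = 0 by rewrite dvalM ?invr_eq0 // dvalV // v1 v2.
have ge1 pi y : dval_ge v 0 y -> v pi = 1 -> dval_ge v 1 (y * pi).
  by move=> hy vpi; apply: dval_geMr => //; rewrite /dval_ge vpi lexx orbT.
have aE : (1 - y1 * pi1) * (a ^+ p - 1) = y1 * pi1 - y2 * pi2.
  have : p%:R * ((1 - y1 * pi1) * a ^+ p) = p%:R * (1 - y2 * pi2).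
    by rewrite mulrA -E1 -E2 expr_div_n mulrC mulfVK // expf_neq0.
  by move=> /(mulfI p0) h; rewrite mulrBr h; ring.
have inv1 n x : dval_ge v n ((1 - y1 * pi1) * x) -> dval_ge v n x.
  by rewrite -(dval_ge_shift v n x u10) vu1 addr0.
have ap1 : dval_ge v 1 (a ^+ p - 1).
  by apply: inv1; rewrite aE; apply: dval_geB; apply: ge1.
have [b bE] : exists b : vring v, val b = a - 1.
  by apply: vring_valK; apply: dval_geB; [apply: dval0E | apply: dval_ge01].
have [r rE] := exp_p_add1 b p_pr.
have apE : a ^+ p - 1 = (a - 1) ^+ p + p%:R * (a - 1) * val r.
  have := congr1 (@vval E v) rE.
  rewrite !(rmorphD, rmorphM, rmorphXn, rmorph1, rmorph_nat) /=.
  by rewrite -/(val b) bE addrC subrK => ->; rewrite -/(val r); ring.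
have b1 : dval_ge v 1 (a - 1).
  have b0 : dval_ge v 0 (a - 1) by rewrite -bE; apply: valP.
  apply: (@dval_ge1X _ v _ p) => //.
  have -> : (a - 1) ^+ p = (a ^+ p - 1) - p%:R * (a - 1) * val r by rewrite apE; ring.
  apply: dval_geB => //; apply: dval_geMl; last exact: valP.
  by apply: dval_geMl => //; apply: dval_ge1_p.
have ap2 : dval_ge v 2 (a ^+ p - 1).
  rewrite apE; apply: dval_geD.
    have -> : (a - 1) ^+ p = (a - 1) * (a - 1) * (a - 1) ^+ p.-2.
      by rewrite -[in LHS]p2 2!exprS mulrA.
    apply: dval_geMl; first exact: (dval_geM b1 b1).
    by apply: dval_ge0X; apply: dval_ge_le b1.
  apply: dval_geMl; last exact: valP.
  exact: (dval_geM dval_ge1_p b1).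
(* Up to a unit, [a ^+ p - 1] is [y1 * pi1 - y2 * pi2], that is, [pi1] times [y1 - y2 * a];
   cancelling one factor [pi1] leaves valuation at least 1. *)
have : dval_ge v 2 (pi1 * (y1 - y2 * a)).
  have -> : pi1 * (y1 - y2 * a) = (1 - y1 * pi1) * (a ^+ p - 1).
    by rewrite aE mulrBr mulrCA /a [pi1 * (_ / _)]mulrC mulfVK // mulrC.
  by apply: dval_geMr => //; apply: dval0E.
rewrite -[2]/(1 + 1) -{2}v1 dval_ge_shift // => h.
have -> : y1 - y2 = (y1 - y2 * a) + y2 * (a - 1) by ring.
by apply: dval_geD => //; apply: dval_geMr.
Qed.

Section Algebraic.

Variables (pi c al : E) (Q : {poly int}).
Hypotheses (vpi : v pi = 1) (piE : pi ^+ p = p%:R * (1 - c * pi))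
  (c_ge0 : dval_ge v 0 c)
  (c_trans : forall N, (0 < N)%N -> ~~ dval_ge v 1 (c ^+ (p ^ N) - c))
  (Q0 : Q != 0) (Qal : evi al Q = 0).

Definition simple_ext (s : E) : Prop :=
  exists f g, evi al g != 0 /\ s = evi al f / evi al g.

Lemma simple_extM s t : simple_ext s -> simple_ext t -> simple_ext (s * t).
Proof.
move=> [f [g [g0 ->]]] [f' [g' [g'0 ->]]]; exists (f * f'), (g * g').
by rewrite !rmorphM mulf_neq0 // invfM mulrACA.
Qed.

Lemma simple_extV s : simple_ext s -> simple_ext s^-1.
Proof.
move=> [f [g [g0 ->]]]; rewrite invf_div.
case: (eqVneq (evi al f) 0) => [->|f0]; last by exists g, f.
by exists 0, 1; rewrite rmorph0 rmorph1 oner_neq0 invr0 mul0r mulr0.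
Qed.

Lemma simple_extB s t : simple_ext s -> simple_ext t -> simple_ext (s - t).
Proof.
move=> [f [g [g0 ->]]] [f' [g' [g'0 ->]]].
exists (f * g' - f' * g), (g * g').
split; first by rewrite rmorphM mulf_neq0.
by rewrite rmorphB !rmorphM /= -[- (evi al f' / _)]mulNr addf_div // mulNr.
Qed.

Lemma simple_ext_nat n : simple_ext n%:R.
Proof. by exists n%:R, 1; rewrite rmorph_nat rmorph1 oner_neq0 divr1. Qed.

Lemma simple_extX s n : simple_ext s -> simple_ext (s ^+ n).
Proof.
move=> hs; elim: n => [|n IH]; first exact: (simple_ext_nat 1).
by rewrite exprS; apply: simple_extM.
Qed.

Lemma simple_ext_exprz s (z : int) : simple_ext s -> simple_ext (s ^ z).
Proof.
case: z => n hs; first exact: simple_extX.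
by rewrite NegzE -exprnN; apply/simple_extV/simple_extX.
Qed.

Lemma dval_exprz s (z : int) : s != 0 -> v (s ^ z) = z * v s.
Proof.
move=> s0; case: z => n; first by rewrite -exprnP dvalX // -mulr_natl natz.
by rewrite NegzE -exprnN dvalV ?expf_neq0 // dvalX // -mulr_natl natz mulNr.
Qed.

Lemma simple_ext_residue s : simple_ext s -> dval_ge v 0 s ->
  exists2 N, (0 < N)%N & dval_ge v 1 (s ^+ (p ^ N) - s).
Proof.
move=> [f [g [g0 sE]]] hs.
have [h [h0 sh hE]] := degree_bound f (field_pchar0 p_pr dval_ge1_p p0) Q0 Qal (leqnSn _) g0.
rewrite -sE in hE.
by have [N [N0 _ HN]] := residue_algebraic p_pr dval_ge1_p p0 hs h0 hE sh; exists N.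
Qed.

(* Otherwise powers of s and p would combine to a uniformizer algebraic over
   the rationals, and normalizing it would make the residue of c algebraic. *)
Lemma simple_ext_unramified s : simple_ext s -> s != 0 -> v s <= 0 \/ p%:Z <= v s.
Proof.
move=> hs s0; case: (leP (v s) 0) => [|vs0]; first by left.
case: (leP p%:Z (v s)) => [|vsp]; first by right.
exfalso.
(* Being strictly between 0 and [p], the value [v s] is prime to [p], so a product of powers of [s]
   and [p] has valuation 1. *)
have [a [b ab]] := Bezoutz (v s) p.
have {}ab : a * v s + b * p = 1.
  rewrite ab /gcdz; congr Posz; apply/eqP; rewrite -/(coprime _ _).
  rewrite coprime_sym prime_coprime //; apply/negP => /dvdn_leq.
  by lia.
pose t := s ^ a * p%:R ^ b.
have t0 : t != 0 by rewrite mulf_neq0 ?expfz_neq0.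
have vt : v t = 1 by rewrite dvalM ?expfz_neq0 // !dval_exprz // vp.
have ht : simple_ext t.
  by apply: simple_extM; apply: simple_ext_exprz => //; apply: simple_ext_nat.
pose u := t ^+ p / p%:R.
have u0 : u != 0 by rewrite mulf_neq0 ?invr_eq0 ?expf_neq0.
have vu : v u = 0.
  by rewrite dvalM ?invr_eq0 ?expf_neq0 // dvalX // dvalV // vt vp -mulr_natl natz mulr1 subrr.
have hu : simple_ext u.
  by apply: simple_extM; [apply: simple_extX | apply/simple_extV/simple_ext_nat].
have [N N0 uN] := simple_ext_residue hu (dval0E u0 vu).
(* The divisor is a p-th root of [u] modulo the maximal ideal, so [w ^+ p / p] is congruent to 1. *)
pose w := t / u ^+ (p ^ N.-1).
have w0 : w != 0 by rewrite mulf_neq0 ?invr_eq0 ?expf_neq0.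
have vw : v w = 1.
  by rewrite dvalM ?invr_eq0 ?expf_neq0 // dvalV ?expf_neq0 // dvalX // vu mul0rn oppr0 addr0.
have hw : simple_ext w by apply: simple_extM => //; apply/simple_extV/simple_extX.
pose e := w ^+ p / p%:R.
have eE : 1 - e = (u ^+ (p ^ N) - u) / u ^+ (p ^ N).
  rewrite /e /w expr_div_n -exprM -expnSr prednK // mulrAC -/u mulrBl divff //.
  by rewrite expf_neq0.
have he : dval_ge v 1 (1 - e).
  rewrite eE; apply: dval_geMl => //; apply: dval0E; first by rewrite invr_eq0 expf_neq0.
  by rewrite dvalV ?expf_neq0 // dvalX // vu mul0rn oppr0.
(* This is the twist attached to [w]. By uniqueness it has the residue of [c], but it is algebraic,
   so some Frobenius power fixes its residue. *)
pose y := (1 - e) / w.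
have hy : dval_ge v 0 y.
  rewrite -(dval_ge_shift v 0 y w0) add0r vw /y mulrC mulfVK //.
have hy' : simple_ext y.
  apply: simple_extM; last exact: simple_extV.
  apply: simple_extB; first exact: (simple_ext_nat 1).
  by apply: simple_extM; [apply: simple_extX | apply/simple_extV/simple_ext_nat].
have wE : w ^+ p = p%:R * (1 - y * w).
  by rewrite /y mulfVK // opprB addrC subrK /e mulrC mulfVK.
have [_ _ cy] := twist_unique c_ge0 hy piE wE.
have [K K0 yK] := simple_ext_residue hy' hy.
have := c_trans K0; move/negP; apply.
have -> : c ^+ (p ^ K) - c = (c ^+ (p ^ K) - y ^+ (p ^ K)) + (y ^+ (p ^ K) - y) - (c - y).
  by ring.
apply: dval_geB => //; apply: dval_geD => //; rewrite subrXX; apply: dval_geMl => //.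
by apply: dval_ge_sum => i _; apply: dval_ge0M; apply: dval_ge0X.
Qed.

End Algebraic.

End CompleteField.

Local Close Scope quotient_scope.

(** * An undecidable existential theory *)

Lemma term_code_inj : injective term_code.
Proof.
elim=> [i|||t IHt u IHu|t IHt|t IHt u IHu] [j|||t' u'|t'|t' u'] /= /cpair_inj[] //.
- by move=> _ ->.
- by move=> _ /cpair_inj[/IHt-> /IHu->].
- by move=> _ /IHt->.
- by move=> _ /cpair_inj[/IHt-> /IHu->].
Qed.

Lemma formula_code_inj : injective formula_code.
Proof.
elim=> [t u|f IHf|f IHf g IHg|f IHf g IHg|i f IHf|i f IHf]
  [t' u'|f'|f' g'|f' g'|i' f'|i' f'] /= /cpair_inj[] //.
- by move=> _ /cpair_inj[/term_code_inj-> /term_code_inj->].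
- by move=> _ /IHf->.
- by move=> _ /cpair_inj[/IHf-> /IHg->].
- by move=> _ /cpair_inj[/IHf-> /IHg->].
- by move=> _ /cpair_inj[-> /IHf->].
- by move=> _ /cpair_inj[-> /IHf->].
Qed.

(** The negative half of the last clause speaks of residues because a sentence recovers [c] only
    modulo the maximal ideal. The second clause expresses, inside the valuation ring, that
    nonconstant monic integer polynomials have zeros in the residue field. *)
Definition twisted_field (p : nat) (A : nat -> Prop) (E : fieldType)
    (v : discrete_valuation E) : Prop :=
  exists pi c : E,
    [/\ dval_complete v,
        forall g : {poly int}, g \is monic -> (1 < size g)%N ->
          exists2 x, dval_ge v 0 x & dval_ge v 1 (evi x g),
        [/\ pi != 0, v pi = 1, pi ^+ p = p%:R * (1 - c * pi), dval_ge v 0 c &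
          forall N, (0 < N)%N -> ~~ dval_ge v 1 (c ^+ (p ^ N) - c)] &
        forall l, prime l -> l != p ->
          (A l -> exists z, z ^+ l = c) /\
          (~ A l -> forall z, dval_ge v 0 z -> ~~ dval_ge v 1 (z ^+ l - c))].

Lemma twisted_dval_p p A E v : (0 < p)%N -> @twisted_field p A E v ->
  v p%:R = p%:Z /\ p%:R != 0 :> E.
Proof.
move=> p_gt0 [pi [c [_ _ [pi0 vpi piE c0 _] _]]].
have p0 : p%:R != 0 :> E.
  apply: contraNneq pi0 => p0; move: piE; rewrite p0 mul0r => /eqP.
  by rewrite expf_eq0 => /andP[].
split=> //.
have cpi : dval_ge v 1 (c * pi).
  by apply: dval_geMr => //; rewrite /dval_ge vpi lexx orbT.
have [u0 vu] : 1 - c * pi != 0 /\ v (1 - c * pi) = 0.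
  apply: dval_unit.
    by apply: dval_geB; [apply: dval_ge01 | apply: dval_ge_le cpi].
  apply/negP => h; have := dval_gt0N1 v.
  have -> : 1 = (1 - c * pi) + c * pi :> E by rewrite subrK.
  by rewrite dval_geD.
have := congr1 v piE; rewrite dvalX // dvalM // vu addr0 vpi => <-.
by rewrite -mulr_natr natz mul1r.
Qed.

Fixpoint tpow (t : term) (n : nat) : term :=
  if n is n'.+1 then TMul t (tpow t n') else TOne.

Fixpoint tnum (n : nat) : term :=
  if n is n'.+1 then TAdd TOne (tnum n') else TZero.

Lemma teval_pow (R : nzRingType) (e : nat -> R) t n :
  teval e (tpow t n) = teval e t ^+ n.
Proof. by elim: n => //= n ->; rewrite exprS. Qed.

Lemma teval_num (R : nzRingType) (e : nat -> R) n : teval e (tnum n) = n%:R.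
Proof. by elim: n => //= n ->; rewrite mulrS. Qed.

Lemma all_vars_pow P t n : all P (term_vars t) -> all P (term_vars (tpow t n)).
Proof. by move=> H; elim: n => //= n IH; rewrite all_cat H. Qed.

Lemma vars_num n : term_vars (tnum n) = [::].
Proof. by elim: n. Qed.

(* The variables 0, 1, 2, 3 stand for a uniformizer, the twist [y] attached to
   it, an l-th root of [y], and a witness of the integrality of [y]. *)
Definition root_sentence (p l : nat) : formula :=
  FEx 0 (FEx 1 (FEx 2 (FEx 3
    (FAnd (FEq (tpow (TVar 0) p)
               (TMul (tnum p) (TAdd TOne (TOpp (TMul (TVar 1) (TVar 0))))))
    (FAnd (FEq (tpow (TVar 3) p.+1)
               (TAdd TOne (TMul (tnum p) (tpow (TVar 1) p.+1))))
          (FEq (TVar 1) (tpow (TVar 2) l))))))).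

Lemma root_sentence_closed p l : sentence (root_sentence p l).
Proof.
rewrite /sentence /root_sentence; cbn [free_vars].
set s := (X in filter _ (filter _ (filter _ (filter _ X)))).
apply/nilP/eqP; rewrite -!filter_predI -[_ == _]negbK -has_filter -all_predC.
apply/allP => x xs; rewrite /= -!negb_or negbK.
have : all (fun j => j \in [:: 0; 1; 2; 3]%N) s.
  rewrite /s; cbn [term_vars]; rewrite !vars_num !all_cat.
  by rewrite !all_vars_pow.
by move=> /allP/(_ x xs); rewrite !inE; case/or4P => /eqP ->.
Qed.

Lemma root_sentenceP (R : nzRingType) (e : nat -> R) p l :
  holds e (root_sentence p l) <-> exists pi y z w : R,
    [/\ pi ^+ p = p%:R * (1 - y * pi), w ^+ p.+1 = 1 + p%:R * y ^+ p.+1 & y = z ^+ l].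
Proof.
cbn [root_sentence holds]; split=> -[pi [y [z [w H]]]]; exists pi, y, z, w; move: H;
  cbn [teval]; rewrite !teval_pow !teval_num.
  by case=> H1 [H2 H3].
by case=> H1 H2 H3; split.
Qed.

(** If [v y < 0], the term [p * y ^+ p.+1] has negative valuation and dominates 1, so [p.+1] divides
    its valuation and hence [p]. As [p.+1] is also prime to [p], the converse is a case of Hensel's
    lemma. *)
Lemma integral_root (E : fieldType) (v : discrete_valuation E) p (w y : E) :
  (0 < p)%N -> v p%:R = p%:Z -> p%:R != 0 :> E ->
  w ^+ p.+1 = 1 + p%:R * y ^+ p.+1 -> dval_ge v 0 y.
Proof.
move=> p_gt0 vp p0 E1; rewrite /dval_ge; case: (eqVneq y 0) => //= y0.
rewrite leNgt; apply/negP => vy.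
set x := p%:R * _ in E1.
have x0 : x != 0 by rewrite mulf_neq0 // expf_neq0.
have vx : v x = p%:Z + v y *+ p.+1 by rewrite dvalM ?expf_neq0 // vp dvalX.
have vx0 : v x < 0 by move: vx; rewrite -mulr_natr natz; nia.
have x1 : 1 + x != 0.
  apply/negP => /eqP x1; move: vx0; have -> : x = - 1 by apply/eqP; rewrite -subr_eq0 opprK addrC x1.
  by rewrite dvalN1 ltxx.
have v1x : v (1 + x) = v x.
  apply/le_anti/andP; split.
    rewrite leNgt; apply/negP => h.
    have : dval_ge v (v x + 1) x.
      have {2}-> : x = (1 + x) - 1 by ring.
      by apply: dval_geB; rewrite /dval_ge ?(negPf x1) ?dval1 /=; [lia | apply/orP; right; lia].
    by rewrite /dval_ge (negPf x0) /=; lia.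
  have : dval_ge v (v x) (1 + x).
    apply: dval_geD; first by rewrite /dval_ge dval1 ltW ?orbT.
    by rewrite /dval_ge lexx orbT.
  by rewrite /dval_ge (negPf x1).
have w0 : w != 0 by apply: contraNneq x1 => w0; rewrite -E1 w0 expr0n.
have := congr1 v E1; rewrite dvalX // v1x vx -[v w *+ _]mulr_natr -[v y *+ _]mulr_natr !natz => h.
have : (v w - v y) * p.+1%:Z = p%:Z by rewrite mulrBl h; ring.
move: (v w - v y) => k kp.
by have [k0|k1] : k <= 0 \/ 1 <= k; [lia | nia | nia].
Qed.

Lemma twisted_root_sentence p A E v l : prime p -> prime l -> l != p ->
  @twisted_field p A E v -> (holds (fun=> 0 : E) (root_sentence p l) <-> A l).
Proof.
move=> p_pr l_pr lp H; have [vp p0] := twisted_dval_p (prime_gt0 p_pr) H.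
case: H => pi [c [v_complete _ [_ vpi piE c0 _] /(_ l l_pr lp)[Al nAl]]].
rewrite root_sentenceP; split=> [[pi' [y [z [w [E1 E2 E3]]]]]|/Al[z zE]].
  have hy := integral_root (prime_gt0 p_pr) vp p0 E2.
  have [_ _ yc] := twist_unique p_pr vp p0 hy c0 E1 piE.
  apply: contrapT => /nAl /(_ z) H.
  have : ~~ dval_ge v 1 (z ^+ l - c).
    apply: H; case: (eqVneq z 0) => [->|z0]; first exact: dval_ge0.
    move: hy; rewrite E3 /dval_ge expf_eq0 (negPf z0) andbF /= dvalX //.
    by rewrite pmulrn_lge0 // prime_gt0.
  by rewrite -E3 yc.
have [y yE] := vring_valK c0.
pose f : {poly vring v} := 'X^(p.+1) - (1 + p%:R * y ^+ p.+1)%:P.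
have fE x : f.[x] = x ^+ p.+1 - (1 + p%:R * y ^+ p.+1).
  by rewrite /f hornerD hornerN hornerC hornerXn.
(* The starting point 1 works: the value there is a multiple of [p] and the derivative [p.+1] is a
   unit. *)
have [||w w0 _] := @hensel E v v_complete f 1.
- rewrite fE expr1n opprD addrA subrr sub0r; apply: dval_geN.
  rewrite -/(vval v _) rmorphM rmorph_nat; apply: dval_geMl; last exact: valP.
  exact: dval_ge1_p.
- rewrite /f derivB derivXn derivC subr0 hornerMn hornerXn expr1n.
  rewrite val_nat; apply/negP => h; have := dval_gt0N1 v.
  have -> : 1 = p.+1%:R - p%:R :> E by rewrite -addn1 natrD; ring.
  by rewrite dval_geB // dval_ge1_p.
exists pi, c, z, (val w); split=> //.
move: w0; rewrite fE => /eqP; rewrite subr_eq0 => /eqP /(congr1 (vval v)).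
by rewrite !(rmorphXn, rmorphD, rmorph1, rmorphM, rmorph_nat) /= -/(val y) yE.
Qed.

(** Euclid's argument: the least prime divisor of [n! + 1] exceeds [n]. *)
Lemma prime_sequence p : exists l : nat -> nat,
  injective l /\ forall i, prime (l i) /\ l i != p.
Proof.
pose l i := iter i (fun n => pdiv (n`!).+1) (pdiv (p`!).+1).
have up n : (n < pdiv (n`!).+1)%N.
  rewrite ltnNge; apply/negP => h.
  have d : (pdiv (n`!).+1 %| n`!)%N by rewrite dvdn_fact // pdiv_gt0 h.
  have := pdiv_dvd (n`!).+1; rewrite -[X in (_ %| X)%N]addn1 (dvdn_addr _ d) dvdn1.
  by move=> /eqP h1; have := @pdiv_prime (n`!).+1; rewrite h1 ltnS fact_gt0 => /(_ isT).
have mono i j : (i < j)%N -> (l i < l j)%N.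
  elim: j => // j IH; rewrite ltnS leq_eqVlt => /orP[/eqP->|/IH h]; first exact: up.
  exact: ltn_trans h (up _).
have pl i : (p < l i)%N.
  by case: i => [|i]; [exact: up | apply: ltn_trans (mono 0%N i.+1 isT); exact: up].
exists l; split=> [i j E|i]; last first.
  split; last by rewrite gtn_eqF.
  by case: i => [|i]; apply: pdiv_prime; rewrite ltnS fact_gt0.
by case: (ltngtP i j) => // /mono; rewrite E ltnn.
Qed.

(** An arbitrary set is encoded on primes other than [p]. Choice attaches one theory to each set,
    and the sentences [root_sentence p (l i)] recover the set from it, as the diagonal argument
    requires. *)
Theorem undecidable_twisted_field p : prime p ->
  exists A (E : fieldType) (v : discrete_valuation E), twisted_field p A v /\
    ~ decidable_set (codes formula_code (existential_theory E)).
Proof.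
move=> p_pr; have [L [pL _]] := exists_closure p_pr.
have [l [l_inj l_pr]] := prime_sequence p.
pose B (A : nat -> Prop) n := exists2 i, n = l i & A i.
have /choice[T HT] : forall A : nat -> Prop, exists T : nat -> Prop,
    exists (E : fieldType) (v : discrete_valuation E), twisted_field p (B A) v /\
      T = codes formula_code (existential_theory E).
  move=> A; have [E [v [pi [c H]]]] := exists_field (B A) p_pr pL.
  by exists (codes formula_code (existential_theory E)), E, v; split=> //; exists pi, c.
have [|A nT] := @undecidable_member T.
  have gen A : forall i, T A (formula_code (root_sentence p (l i))) <-> A i.
    move=> i; have [E [v [tw ->]]] := HT A; have [li_pr lip] := l_pr i.
    have := twisted_root_sentence p_pr li_pr lip tw.
    have -> : B (A) (l i) <-> A i.
      by split=> [[j /l_inj ->]|Ai] //; exists i.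
    move=> <-; split=> [[f [_ _ Hf] /formula_code_inj fE]|Hf]; first by rewrite -fE.
    exists (root_sentence p (l i)) => //; split=> //.
    exact: root_sentence_closed.
  by move=> A A' TT i; split=> /gen/TT/gen.
have [E [v [tw TE]]] := HT A; exists (B A), E, v; split=> //.
by rewrite -TE.
Qed.

Local Open Scope quotient_scope.

(** * Numbers as terms *)

(* Term codes are extended by an inverse (tag 6), numerals (7), integers (8),
   integer polynomials in X (9) and the constants X (10) and Z (11); every
   number is a term. *)
Definition nvar i := cpair 0 i.
Definition nzero := cpair 1 0.
Definition none := cpair 2 0.
Definition nadd a b := cpair 3 (cpair a b).
Definition nopp a := cpair 4 a.
Definition nmul a b := cpair 5 (cpair a b).
Definition ninv a := cpair 6 a.
Definition nnum k := cpair 7 k.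
Definition nint k := cpair 8 k.
Definition npol l := cpair 9 l.
Definition nX := cpair 10 0.
Definition nZ := cpair 11 0.

Fixpoint sdec_rec (fuel n : nat) : seq nat :=
  match fuel, n with
  | fuel'.+1, m.+1 => c1 m :: sdec_rec fuel' (c2 m)
  | _, _ => [::]
  end.

Definition sdec n := sdec_rec n n.

Lemma sdec_rec_fuel f n : (n <= f)%N -> sdec_rec f n = sdec n.
Proof.
rewrite /sdec; elim: f {-2}f n (leqnn f) => [|k IH] f n fk nf.
  by move: fk nf; rewrite leqn0 => /eqP->; rewrite leqn0 => /eqP->.
case: f fk nf => [|f] fk nf; first by move: nf; rewrite leqn0 => /eqP->.
case: n nf => // n nf /=; congr (_ :: _).
rewrite (IH f) ?(leq_trans (c2_le n)) //.
by rewrite (IH n) ?c2_le //; apply: leq_trans nf fk.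
Qed.

Lemma sdec0 : sdec 0 = [::]. Proof. by []. Qed.

Lemma sdecS x l : sdec (cpair x l).+1 = x :: sdec l.
Proof. by rewrite {1}/sdec /= c1K c2K sdec_rec_fuel // cpair_ge2. Qed.

Lemma seq_codeK s : sdec (seq_code s) = s.
Proof. by elim: s => //= x s IH; rewrite sdecS IH. Qed.

Lemma seq_code_ind (P : nat -> Prop) :
  P 0%N -> (forall x l, P l -> P (cpair x l).+1) -> forall n, P n.
Proof.
move=> P0 PS; elim/ltn_ind => -[|n] IH //; rewrite -(cpair_unpair n).
by apply: PS; apply: IH; rewrite ltnS c2_le.
Qed.

Lemma sdecK l : seq_code (sdec l) = l.
Proof. by elim/seq_code_ind: l => // x l IH; rewrite sdecS /= IH. Qed.

Definition idec (n : nat) : int := if odd n then Negz n./2 else Posz n./2.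

Lemma int_codeK z : idec (int_code z) = z.
Proof. by case: z => n /=; rewrite /idec /= odd_double ?uphalf_double ?doubleK. Qed.

(** Variables, inverses, polynomials in X and the constants X and Z are left free: their
    interpretation changes from one theory to another. *)
Record good_val (R : comNzRingType) (f : nat -> R) : Prop := GoodVal {
  gv0 : f nzero = 0;
  gv1 : f none = 1;
  gvD : forall a b, f (nadd a b) = f a + f b;
  gvN : forall a, f (nopp a) = - f a;
  gvM : forall a b, f (nmul a b) = f a * f b;
  gvnum : forall k, f (nnum k) = k%:R;
  gvint : forall k, f (nint k) = (idec k)%:~R
}.

Lemma good_val_teval (R : comNzRingType) (f : nat -> R) t : good_val f ->
  f (term_code t) = teval (fun i => f (nvar i)) t.
Proof.
move=> gf; elim: t => [i|||t IHt u IHu|t IHt|t IHt u IHu] //=.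
- exact: gv0.
- exact: gv1.
- by rewrite -IHt -IHu -gvD.
- by rewrite -IHt -gvN.
- by rewrite -IHt -IHu -gvM.
Qed.

Section Evaluation.

Variables (R : comNzRingType) (iv : R -> R) (e pv : nat -> R) (x z : R).

Fixpoint val_rec (fuel n : nat) : R :=
  if fuel is fuel'.+1 then
    match c1 n with
    | 0 => e (c2 n)
    | 1 => 0
    | 2 => 1
    | 3 => val_rec fuel' (c1 (c2 n)) + val_rec fuel' (c2 (c2 n))
    | 4 => - val_rec fuel' (c2 n)
    | 5 => val_rec fuel' (c1 (c2 n)) * val_rec fuel' (c2 (c2 n))
    | 6 => iv (val_rec fuel' (c2 n))
    | 7 => (c2 n)%:R
    | 8 => (idec (c2 n))%:~R
    | 9 => pv (c2 n)
    | 10 => x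
    | 11 => z
    | _ => 0
    end
  else 0.

Definition nval n := val_rec n.+1 n.

Lemma val_rec_fuel f n : (n < f)%N -> val_rec f n = nval n.
Proof.
rewrite /nval; elim: f {-2}f n (leqnn f) => [|k IH] f n fk nf.
  by move: nf; rewrite ltnNge (leq_trans fk).
case: f fk nf => [|f] // fk nf /=.
have lt2 : (2 < c1 n)%N -> (c2 n < n)%N.
  by move=> h; rewrite -[X in (_ < X)%N](cpair_unpair n) cpair_gt2 // ltnW // ltnW.
have H j : (2 < c1 n)%N -> (j <= c2 n)%N -> val_rec f j = val_rec n j.
  move=> h jn; have jn' : (j < n)%N by apply: leq_ltn_trans (lt2 h).
  transitivity (val_rec j.+1 j); [|symmetry]; apply: (IH) => //.
    exact: leq_trans jn' nf.
  exact: leq_trans nf fk.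
case E : (c1 n) H => [|[|[|[|[|[|[|t]]]]]]] // H.
- by rewrite !H ?c1_le ?c2_le.
- by rewrite H.
- by rewrite !H ?c1_le ?c2_le.
- by rewrite H.
Qed.

Lemma nvalE n : nval n =
    match c1 n with
    | 0 => e (c2 n)
    | 1 => 0
    | 2 => 1
    | 3 => nval (c1 (c2 n)) + nval (c2 (c2 n))
    | 4 => - nval (c2 n)
    | 5 => nval (c1 (c2 n)) * nval (c2 (c2 n))
    | 6 => iv (nval (c2 n))
    | 7 => (c2 n)%:R
    | 8 => (idec (c2 n))%:~R
    | 9 => pv (c2 n)
    | 10 => x
    | 11 => z
    | _ => 0
    end.
Proof.
rewrite {1}/nval /=.
have H j : (2 < c1 n)%N -> (j <= c2 n)%N -> val_rec n j = nval j.
  move=> h jn; apply: val_rec_fuel; apply: leq_ltn_trans jn _.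
  by rewrite -[X in (_ < X)%N](cpair_unpair n) cpair_gt2 // ltnW // ltnW.
case E : (c1 n) H => [|[|[|[|[|[|[|t]]]]]]] // H.
- by rewrite !H ?c1_le ?c2_le.
- by rewrite H.
- by rewrite !H ?c1_le ?c2_le.
- by rewrite H.
Qed.

Lemma nval_good : good_val nval.
Proof. by split=> *; rewrite nvalE !(c1K, c2K). Qed.

Lemma nval_var i : nval (nvar i) = e i. Proof. by rewrite nvalE c1K c2K. Qed.
Lemma nval_inv a : nval (ninv a) = iv (nval a). Proof. by rewrite nvalE c1K c2K. Qed.
Lemma nval_pol l : nval (npol l) = pv l. Proof. by rewrite nvalE c1K c2K. Qed.
Lemma nvalX : nval nX = x. Proof. by rewrite nvalE c1K. Qed.
Lemma nvalZ : nval nZ = z. Proof. by rewrite nvalE c1K. Qed.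

End Evaluation.

(** * Rings presented by facts *)

Record ring_congr (E : nat -> nat -> Prop) : Prop := RingCongr {
  rcR : forall a, E a a;
  rcS : forall a b, E a b -> E b a;
  rcT : forall a b c, E a b -> E b c -> E a c;
  rcD : forall a b c d, E a b -> E c d -> E (nadd a c) (nadd b d);
  rcM : forall a b c d, E a b -> E c d -> E (nmul a c) (nmul b d);
  rcN : forall a b, E a b -> E (nopp a) (nopp b);
  rcDA : forall a b c, E (nadd a (nadd b c)) (nadd (nadd a b) c);
  rcDC : forall a b, E (nadd a b) (nadd b a);
  rcD0 : forall a, E (nadd nzero a) a;
  rcDN : forall a, E (nadd (nopp a) a) nzero;
  rcMA : forall a b c, E (nmul a (nmul b c)) (nmul (nmul a b) c);
  rcMC : forall a b, E (nmul a b) (nmul b a);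
  rcM1 : forall a, E (nmul none a) a;
  rcMD : forall a b c, E (nmul (nadd a b) c) (nadd (nmul a c) (nmul b c))
}.

Section QuotientRing.

Variable E : nat -> nat -> Prop.
Hypotheses (HE : ring_congr E) (E10 : ~ E none nzero).

Definition congr_rel (a b : nat) : bool := `[< E a b >].

Lemma congr_refl : reflexive congr_rel.
Proof. by move=> a; apply/asboolP; apply: rcR HE a. Qed.

Lemma congr_sym : symmetric congr_rel.
Proof. by move=> a b; apply/asboolP/asboolP; apply: rcS HE _ _. Qed.

Lemma congr_trans : transitive congr_rel.
Proof. by move=> b a c /asboolP ab /asboolP bc; apply/asboolP; apply: rcT HE _ _ _ ab bc. Qed.

Definition congr_equiv := EquivRel congr_rel congr_refl congr_sym congr_trans.

Definition qring : Type := {eq_quot congr_equiv}.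

HB.instance Definition _ := Choice.on qring.

Definition qcl (a : nat) : qring := \pi_{eq_quot congr_equiv} a.

Lemma qclP a b : qcl a = qcl b <-> E a b.
Proof. by split=> [/eqmodP/asboolP|h] //; apply/eqmodP/asboolP. Qed.

Definition qrep (u : qring) : nat := repr (u : {eq_quot congr_equiv}).

Lemma qrepK u : qcl (qrep u) = u. Proof. exact: reprK. Qed.

Lemma qrep_cl a : E (qrep (qcl a)) a. Proof. by apply/qclP; rewrite qrepK. Qed.

Lemma qcl_surj u : exists a, qcl a = u. Proof. by exists (qrep u); rewrite qrepK. Qed.

Definition qadd u w := qcl (nadd (qrep u) (qrep w)).
Definition qmul u w := qcl (nmul (qrep u) (qrep w)).
Definition qopp u := qcl (nopp (qrep u)).

Lemma qclD a b : qcl (nadd a b) = qadd (qcl a) (qcl b).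
Proof. by apply/qclP/(rcD HE); apply: rcS HE _ _ _; apply: qrep_cl. Qed.

Lemma qclM a b : qcl (nmul a b) = qmul (qcl a) (qcl b).
Proof. by apply/qclP/(rcM HE); apply: rcS HE _ _ _; apply: qrep_cl. Qed.

Lemma qclN a : qcl (nopp a) = qopp (qcl a).
Proof. by apply/qclP/(rcN HE); apply: rcS HE _ _ _; apply: qrep_cl. Qed.

Lemma qaddA : associative qadd.
Proof.
move=> u w t; case: (qcl_surj u) (qcl_surj w) (qcl_surj t) => a <- [b <-] [c <-].
by rewrite -!qclD; apply/qclP; apply: rcDA HE _ _ _.
Qed.

Lemma qaddC : commutative qadd.
Proof.
move=> u w; case: (qcl_surj u) (qcl_surj w) => a <- [b <-].
by rewrite -!qclD; apply/qclP; apply: rcDC HE _ _.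
Qed.

Lemma qadd0 : left_id (qcl nzero) qadd.
Proof.
by move=> u; case: (qcl_surj u) => a <-; rewrite -qclD; apply/qclP; apply: rcD0 HE _.
Qed.

Lemma qaddN : left_inverse (qcl nzero) qopp qadd.
Proof.
move=> u; case: (qcl_surj u) => a <-; rewrite -qclN -qclD.
by apply/qclP; apply: rcDN HE _.
Qed.

HB.instance Definition _ := GRing.isZmodule.Build qring qaddA qaddC qadd0 qaddN.

Lemma qmulA : associative qmul.
Proof.
move=> u w t; case: (qcl_surj u) (qcl_surj w) (qcl_surj t) => a <- [b <-] [c <-].
by rewrite -!qclM; apply/qclP; apply: rcMA HE _ _ _.
Qed.

Lemma qmulC : commutative qmul.
Proof.
move=> u w; case: (qcl_surj u) (qcl_surj w) => a <- [b <-].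
by rewrite -!qclM; apply/qclP; apply: rcMC HE _ _.
Qed.

Lemma qmul1 : left_id (qcl none) qmul.
Proof.
by move=> u; case: (qcl_surj u) => a <-; rewrite -qclM; apply/qclP; apply: rcM1 HE _.
Qed.

Lemma qmulD : left_distributive qmul qadd.
Proof.
move=> u w t; case: (qcl_surj u) (qcl_surj w) (qcl_surj t) => a <- [b <-] [c <-].
by rewrite -qclD -!qclM -qclD; apply/qclP; apply: rcMD HE _ _ _.
Qed.

Lemma qone_neq0 : qcl none != 0 :> qring.
Proof. by apply/eqP => /qclP. Qed.

HB.instance Definition _ :=
  GRing.Zmodule_isComNzRing.Build qring qmulA qmulC qmul1 qmulD qone_neq0.

(** The term model of a context; rings here are nontrivial, hence the assumption that 1 = 0 is not a
    fact. *)
Lemma quotient_ring : exists (R : comNzRingType) (f : nat -> R),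
  [/\ f nzero = 0, f none = 1,
      [/\ forall a b, f (nadd a b) = f a + f b, forall a, f (nopp a) = - f a &
          forall a b, f (nmul a b) = f a * f b],
      forall u, exists a, f a = u & forall a b, f a = f b <-> E a b].
Proof.
exists qring, qcl; split=> //; last exact: qclP; last exact: qcl_surj.
by split; [exact: qclD | exact: qclN | exact: qclM].
Qed.

Variable iv : nat -> nat.
Hypotheses (HI : forall a b, E a b -> E (iv a) (iv b))
  (HV : forall a, E a nzero \/ E (nmul a (iv a)) none).

Definition qinv (u : qring) : qring := if u == 0 then 0 else qcl (iv (qrep u)).

Lemma qmulV u : u != 0 -> qinv u * u = 1.
Proof.
move=> u0; rewrite /qinv (negPf u0) mulrC -{1}(qrepK u) -[_ * _]qclM.
apply/qclP; case: (HV (qrep u)) => // /qclP; rewrite qrepK => u0'.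
by rewrite u0' eqxx in u0.
Qed.

Lemma qinv0 : qinv 0 = 0. Proof. by rewrite /qinv eqxx. Qed.

HB.instance Definition _ := GRing.ComNzRing_isField.Build qring qmulV qinv0.

Lemma quotient_field : exists (K : fieldType) (f : nat -> K),
  [/\ f nzero = 0, f none = 1,
      [/\ forall a b, f (nadd a b) = f a + f b, forall a, f (nopp a) = - f a,
          forall a b, f (nmul a b) = f a * f b &
          forall a, f a != 0 -> f (iv a) = (f a)^-1],
      forall u, exists a, f a = u & forall a b, f a = f b <-> E a b].
Proof.
exists qring, qcl; split=> //; last exact: qclP; last exact: qcl_surj.
split; [exact: qclD | exact: qclN | exact: qclM | move=> a a0].
apply: (mulfI a0); rewrite divff // -[_ * _]qclM; apply/qclP.
by case: (HV a) => // /qclP a0'; rewrite a0' eqxx in a0.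
Qed.

End QuotientRing.

Local Close Scope quotient_scope.

(** * Axioms of rings with integer constants *)

(* Facts carry the tags 1: input, 2: equation in a context, 3: doubling,
   4: value of a rational polynomial, 12-16: syntax of formulas, 17, 18: truth
   and falsity of a formula in a context, 19: monic list, 20: entry of a list,
   21-24: syntax of rational polynomials, 25: integrality, 26: derivative. *)
Definition pfact k a := PP (PN k) a.
Definition pE g a b := pfact 2 (PP g (PP a b)).
Definition pA a b := PP (PN 3) (PP a b).
Definition pO a := PP (PN 4) a.
Definition pM a b := PP (PN 5) (PP a b).
Definition pNum k := PP (PN 7) k.
Definition pInt k := PP (PN 8) k.
Definition pPol l := PP (PN 9) l.
Definition pZero := PN nzero.
Definition pOne := PN none.

Definition fE g a b := cpair 2 (cpair g (cpair a b)).
Definition fD a k := cpair 3 (cpair a k).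
Definition fH s B C (ctd : nat * nat * nat) :=
  cpair 4 (cpair s (cpair B (cpair C (cpair ctd.1.1 (cpair ctd.1.2 ctd.2))))).

Definition hstep (B C r : nat) (ctd : nat * nat * nat) : nat * nat * nat :=
  let: (c, t, d) := ctd in
  (nmul C c,
   nadd (nmul (nint (c1 r)) (nmul d (nmul C c))) (nmul (nnum (c2 r)) (nmul B t)),
   nmul (nnum (c2 r)) d).

(* For the list s of the n coefficients of P, the terms (c, t, d) stand for C^n,
   d C^n P(B/C) and a common denominator d of P. *)
Definition hterm (s : seq nat) B C : nat * nat * nat :=
  foldr (hstep B C) (none, nzero, none) s.

(** Each context [g] carries its own congruence. Doubling is tabulated by facts because the code of
    an integer is even or odd according to its sign and patterns cannot halve a number. The last two
    rules compute [hterm] along a list. *)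
Definition common_rules : seq rule :=
  let g := PV 0 in let a := PV 1 in let b := PV 2 in let c := PV 3 in
  let d := PV 4 in let k := PV 5 in let l := PV 6 in let r := PV 7 in
  [:: ([::], [:: pE g a a]);
      ([:: pE g a b], [:: pE g b a]);
      ([:: pE g a b; pE g b c], [:: pE g a c]);
      ([:: pE g a b; pE g c d], [:: pE g (pA a c) (pA b d)]);
      ([:: pE g a b; pE g c d], [:: pE g (pM a c) (pM b d)]);
      ([:: pE g a b], [:: pE g (pO a) (pO b)]);
      ([::], [:: pE g (pA a (pA b c)) (pA (pA a b) c)]);
      ([::], [:: pE g (pA a b) (pA b a)]);
      ([::], [:: pE g (pA pZero a) a]);
      ([::], [:: pE g (pA (pO a) a) pZero]);
      ([::], [:: pE g (pM a (pM b c)) (pM (pM a b) c)]);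
      ([::], [:: pE g (pM a b) (pM b a)]);
      ([::], [:: pE g (pM pOne a) a]);
      ([::], [:: pE g (pM (pA a b) c) (pA (pM a c) (pM b c))]);
      ([::], [:: pE g (pNum (PN 0)) pZero]);
      ([::], [:: pE g (pNum (PS a)) (pA pOne (pNum a))]);
      ([::], [:: pfact 3 (PP (PN 0) (PN 0))]);
      ([:: pfact 3 (PP a b)], [:: pfact 3 (PP (PS (PS a)) (PS b))]);
      ([:: pfact 3 (PP a b)], [:: pE g (pInt a) (pNum b)]);
      ([:: pfact 3 (PP a b)], [:: pE g (pInt (PS a)) (pO (pNum (PS b)))]);
      ([::], [:: pfact 4 (PP (PN 0) (PP a (PP b (PP pOne (PP pZero pOne)))))]);
      ([:: pfact 4 (PP g (PP a (PP b (PP c (PP d k)))))],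
       [:: pfact 4 (PP (PS (PP (PP l r) g)) (PP a (PP b (PP (pM b c) (PP
         (pA (pM (pInt l) (pM k (pM b c))) (pM (pNum r) (pM a d)))
         (pM (pNum r) k))))))])].

Record common_facts (M : nat -> Prop) : Prop := CommonFacts {
  cf_ring : forall g, ring_congr (fun a b => M (fE g a b));
  cf_num0 : forall g, M (fE g (nnum 0) nzero);
  cf_numS : forall g k, M (fE g (nnum k.+1) (nadd none (nnum k)));
  cf_double0 : M (fD 0 0);
  cf_doubleS : forall a k, M (fD a k) -> M (fD a.+2 k.+1);
  cf_int_even : forall g a k, M (fD a k) -> M (fE g (nint a) (nnum k));
  cf_int_odd : forall g a k, M (fD a k) -> M (fE g (nint a.+1) (nopp (nnum k.+1)));
  cf_h0 : forall B C, M (fH 0 B C (none, nzero, none));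
  cf_hS : forall s B C ctd a b, M (fH s B C ctd) ->
    M (fH (cpair (cpair a b) s).+1 B C (hstep B C (cpair a b) ctd))
}.

Lemma common_rulesP M : Pall (rule_ok M) common_rules <-> common_facts M.
Proof.
split.
  (* A rule is used by instantiating its pattern variables, in order, with the entries of the list
     given to [nth]. *)
  case=> R1 [R2 [R3 [R4 [R5 [R6 [R7 [R8 [R9 [R10 [R11 [R12 [R13 [R14]]]]]]]]]]]]].
  case=> S1 [S2 [S3 [S4 [S5 [S6 [S7 [S8 _]]]]]]].
  split.
  - move=> g; split.
    + by move=> a; case: (R1 (nth 0%N [:: g; a]) I).
    + by move=> a b h; case: (R2 (nth 0%N [:: g; a; b]) (conj h I)).
    + by move=> a b c h h'; case: (R3 (nth 0%N [:: g; a; b; c]) (conj h (conj h' I))).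
    + by move=> a b c d h h'; case: (R4 (nth 0%N [:: g; a; b; c; d]) (conj h (conj h' I))).
    + by move=> a b c d h h'; case: (R5 (nth 0%N [:: g; a; b; c; d]) (conj h (conj h' I))).
    + by move=> a b h; case: (R6 (nth 0%N [:: g; a; b]) (conj h I)).
    + by move=> a b c; case: (R7 (nth 0%N [:: g; a; b; c]) I).
    + by move=> a b; case: (R8 (nth 0%N [:: g; a; b]) I).
    + by move=> a; case: (R9 (nth 0%N [:: g; a]) I).
    + by move=> a; case: (R10 (nth 0%N [:: g; a]) I).
    + by move=> a b c; case: (R11 (nth 0%N [:: g; a; b; c]) I).
    + by move=> a b; case: (R12 (nth 0%N [:: g; a; b]) I).
    + by move=> a; case: (R13 (nth 0%N [:: g; a]) I).
    + by move=> a b c; case: (R14 (nth 0%N [:: g; a; b; c]) I).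
  - by move=> g; case: (S1 (nth 0%N [:: g]) I).
  - by move=> g k; case: (S2 (nth 0%N [:: g; k]) I).
  - by case: (S3 (nth 0%N [::]) I).
  - by move=> a k h; case: (S4 (nth 0%N [:: 0%N; a; k]) (conj h I)).
  - by move=> g a k h; case: (S5 (nth 0%N [:: g; a; k]) (conj h I)).
  - by move=> g a k h; case: (S6 (nth 0%N [:: g; a; k]) (conj h I)).
  - by move=> B C; case: (S7 (nth 0%N [:: 0%N; B; C]) I).
  - move=> s B C [[c t] d] a b h.
    have := S8 (nth 0%N [:: s; B; C; c; t; d; a; b]) (conj h I).
    by rewrite /hstep c1K c2K; case.
move=> H; do ![split] => //; move=> e /=.
all: try by move=> _; left; apply: (rcR (cf_ring H _)).
- by case=> h _; left; apply: (rcS (cf_ring H _)).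
- by case=> h [h' _]; left; apply: (rcT (cf_ring H _)) h h'.
- by case=> h [h' _]; left; apply: (rcD (cf_ring H _)).
- by case=> h [h' _]; left; apply: (rcM (cf_ring H _)).
- by case=> h _; left; apply: (rcN (cf_ring H _)).
- by move=> _; left; apply: (rcDA (cf_ring H _)).
- by move=> _; left; apply: (rcDC (cf_ring H _)).
- by move=> _; left; apply: (rcD0 (cf_ring H _)).
- by move=> _; left; apply: (rcDN (cf_ring H _)).
- by move=> _; left; apply: (rcMA (cf_ring H _)).
- by move=> _; left; apply: (rcMC (cf_ring H _)).
- by move=> _; left; apply: (rcM1 (cf_ring H _)).
- by move=> _; left; apply: (rcMD (cf_ring H _)).
- by move=> _; left; apply: (cf_num0 H).
- by move=> _; left; apply: (cf_numS H).
- by move=> _; left; apply: (cf_double0 H).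
- by case=> h _; left; apply: (cf_doubleS H).
- by case=> h _; left; apply: (cf_int_even H).
- by case=> h _; left; apply: (cf_int_odd H).
- by move=> _; left; apply: (cf_h0 H).
- case=> h _; left.
  have := @cf_hS _ H _ _ _ (e 3, e 4, e 5) (e 6) (e 7) h.
  by rewrite /hstep c1K c2K.
Qed.

Section CommonModel.

Variable M : nat -> Prop.
Hypothesis HM : common_facts M.

Lemma model_double k : M (fD k.*2 k).
Proof.
elim: k => [|k IH]; first exact: (cf_double0 HM).
by rewrite doubleS; apply: (cf_doubleS HM).
Qed.

Lemma model_hterm s B C : M (fH (seq_code s) B C (hterm s B C)).
Proof.
elim: s => [|r s IH]; first exact: (cf_h0 HM).
by have := @cf_hS _ HM _ B C _ (c1 r) (c2 r) IH; rewrite cpair_unpair.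
Qed.

Lemma model_good_val g (R : comNzRingType) (f : nat -> R) :
  f nzero = 0 -> f none = 1 -> (forall a b, f (nadd a b) = f a + f b) ->
  (forall a, f (nopp a) = - f a) -> (forall a b, f (nmul a b) = f a * f b) ->
  (forall a b, M (fE g a b) -> f a = f b) -> good_val f.
Proof.
move=> f0 f1 fD fN fM fE.
have fnum k : f (nnum k) = k%:R.
  elim: k => [|k IH]; first by rewrite (fE _ _ (cf_num0 HM g)).
  by rewrite (fE _ _ (cf_numS HM g k)) fD f1 IH mulrS.
split=> // k; rewrite /idec -{1}(odd_double_half k).
case: (odd k) => /=.
  rewrite add1n (fE _ _ (cf_int_odd HM g (model_double _))) fN fnum.
  by rewrite NegzE rmorphN /= -pmulrn.
by rewrite add0n (fE _ _ (cf_int_even HM g (model_double _))) fnum.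
Qed.

(** The terms modulo the equations of a context form a ring, so checking an equation in all rings
    that satisfy the context suffices; formal derivations are thereby replaced by computations in
    rings. *)
Lemma model_eqP g a b :
  (forall (R : comNzRingType) (f : nat -> R), good_val f ->
     (forall a b, M (fE g a b) -> f a = f b) -> f a = f b) -> M (fE g a b).
Proof.
move=> H; have Rg := cf_ring HM g.
(* If 1 = 0 is a fact of the context there is no nontrivial term model, and every term is shown
   equal to 0 directly from the axioms. *)
case: (pselect (M (fE g none nzero))) => [E10|nE10].
  suff z c : M (fE g c nzero) by apply: (rcT Rg) (z a) _; apply: (rcS Rg).
  apply: (rcT Rg) (rcS Rg (rcM1 Rg c)) _.
  apply: (rcT Rg) (rcM Rg E10 (rcR Rg c)) _.
  have zc := rcMD Rg nzero nzero c.
  have zz : M (fE g (nmul (nadd nzero nzero) c) (nmul nzero c)).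
    by apply: (rcM Rg); [apply: (rcD0 Rg) | apply: (rcR Rg)].
  have h : M (fE g (nadd (nmul nzero c) (nmul nzero c)) (nmul nzero c)).
    by apply: (rcT Rg) (rcS Rg zc) zz.
  set u := nmul nzero c in h *.
  have h1 := rcD Rg (rcR Rg (nopp u)) h.
  have h2 := rcT Rg h1 (rcDN Rg u).
  have h3 := rcT Rg (rcS Rg (rcDA Rg (nopp u) u u)) h2.
  apply: (rcT Rg) h3; apply: (rcS Rg).
  exact: (rcT Rg) (rcD Rg (rcDN Rg u) (rcR Rg u)) (rcD0 Rg u).
have [R [f [f0 f1 [fD fN fM] _ fP]]] := quotient_ring Rg nE10.
apply/fP; apply: H; last by move=> c d /fP.
by apply: (model_good_val f0 f1 fD fN fM (g := g)) => c d /fP.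
Qed.

End CommonModel.

(** An equation in a context is interpreted as equality under all evaluations compatible with the
    context, a family that may be empty. *)
Lemma family_common (M : nat -> Prop) :
  (forall g, exists (I : Type) (D : I -> Prop) (R : comNzRingType) (f : I -> nat -> R),
     (forall i, good_val (f i)) /\
     forall a b, M (fE g a b) <-> forall i, D i -> f i a = f i b) ->
  (forall a k, M (fD a k) <-> a = k.*2) ->
  (forall s B C ctd, M (fH s B C ctd) <-> ctd = hterm (sdec s) B C) ->
  common_facts M.
Proof.
move=> HE HD HH; split.
- move=> g; have [I [D [R [f [gf EP]]]]] := HE g; split.
  + by move=> a; apply/EP.
  + by move=> a b /EP h; apply/EP => i Di; rewrite h.
  + by move=> a b c /EP h /EP h'; apply/EP => i Di; rewrite h ?h'.
  + by move=> a b c d /EP h /EP h'; apply/EP => i Di; rewrite !(gvD (gf i)) h ?h'.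
  + by move=> a b c d /EP h /EP h'; apply/EP => i Di; rewrite !(gvM (gf i)) h ?h'.
  + by move=> a b /EP h; apply/EP => i Di; rewrite !(gvN (gf i)) h.
  + by move=> a b c; apply/EP => i _; rewrite !(gvD (gf i)) addrA.
  + by move=> a b; apply/EP => i _; rewrite !(gvD (gf i)) addrC.
  + by move=> a; apply/EP => i _; rewrite (gvD (gf i)) (gv0 (gf i)) add0r.
  + by move=> a; apply/EP => i _; rewrite (gvD (gf i)) (gvN (gf i)) (gv0 (gf i)) addNr.
  + by move=> a b c; apply/EP => i _; rewrite !(gvM (gf i)) mulrA.
  + by move=> a b; apply/EP => i _; rewrite !(gvM (gf i)) mulrC.
  + by move=> a; apply/EP => i _; rewrite (gvM (gf i)) (gv1 (gf i)) mul1r.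
  + by move=> a b c; apply/EP => i _; rewrite !(gvM (gf i), gvD (gf i)) mulrDl.
- by move=> g; have [I [D [R [f [gf EP]]]]] := HE g; apply/EP => i _; rewrite (gvnum (gf i)) (gv0 (gf i)).
- move=> g k; have [I [D [R [f [gf EP]]]]] := HE g; apply/EP => i _.
  by rewrite (gvD (gf i)) !(gvnum (gf i)) (gv1 (gf i)) mulrS.
- exact/HD.
- by move=> a k /HD->; apply/HD.
- move=> g a k /HD->; have [I [D [R [f [gf EP]]]]] := HE g; apply/EP => i _.
  by rewrite (gvint (gf i)) (gvnum (gf i)) /idec odd_double doubleK.
- move=> g a k /HD->; have [I [D [R [f [gf EP]]]]] := HE g; apply/EP => i _.
  rewrite (gvint (gf i)) (gvN (gf i)) (gvnum (gf i)) /idec /= odd_double /=.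
  by rewrite uphalf_double NegzE rmorphN.
- by move=> B C; apply/HH.
- by move=> s B C ctd a b /HH->; apply/HH; rewrite sdecS.
Qed.

(** * Values of polynomials *)

Definition hint_step (q : int) (r : nat) (ctd : int * {poly int} * int) :=
  let: (c, t, d) := ctd in
  (q * c, (idec (c1 r) * (d * (q * c)))%:P + (c2 r)%:Z *: ('X * t), (c2 r)%:Z * d).

(** The triple of [hterm] with an integer [q] as denominator and a variable as numerator: clearing
    denominators in the value of a rational polynomial gives an integer polynomial in this
    numerator. *)
Definition hint (s : seq nat) (q : int) : int * {poly int} * int :=
  foldr (hint_step q) (1, 0, 1) s.

Lemma hterm_val (R : comNzRingType) (f : nat -> R) s B C q :
  good_val f -> f C = q%:~R ->
  [/\ f (hterm s B C).1.1 = (hint s q).1.1%:~R,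
      f (hterm s B C).1.2 = evi (f B) (hint s q).1.2 &
      f (hterm s B C).2 = (hint s q).2%:~R].
Proof.
move=> gf fC; elim: s => [|r s [IHc IHt IHd]] /=.
  by rewrite (gv1 gf) (gv0 gf) rmorph0.
move: IHc IHt IHd; rewrite /hstep /hint_step.
case: (hterm s B C) => [[c t] d]; case: (hint s q) => [[ci ti] di] /= IHc IHt IHd.
rewrite !(gvM gf, gvD gf, gvnum gf, gvint gf) IHc IHt IHd fC; split.
- by rewrite intrM.
- rewrite rmorphD /= eviC -mul_polyC !rmorphM /= eviC eviX -pmulrn.
  by [].
- by rewrite intrM.
Qed.

Lemma hint_root (K : fieldType) (P : {poly rat}) (q : int) (b : K) :
  (forall z : int, z%:~R = 0 :> K -> z = 0) -> q != 0 ->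
  evi b (hint (map rat_code P) q).1.2 = 0 <-> root (map_poly ratr P) (b / q%:~R).
Proof.
move=> K0 q0; have q0' : q%:~R != 0 :> K by apply: contra_neq q0 => /K0.
rewrite map_polyE.
suff H (l : seq rat) : let: (c, t, d) := hint (map rat_code l) q in
    [/\ c != 0, d != 0 & evi b t = d%:~R * c%:~R * (Poly (map ratr l)).[b / q%:~R]].
  move: (H P); case: (hint _ _) => [[c t] d] /= [c0 d0 ->].
  have cK : c%:~R != 0 :> K by apply: contra_neq c0 => /K0.
  have dK : d%:~R != 0 :> K by apply: contra_neq d0 => /K0.
  rewrite /root; split=> [/eqP|/eqP->]; last by rewrite mulr0.
  by rewrite !mulf_eq0 (negPf cK) (negPf dK).
elim: l => [|a l] /=; first by rewrite rmorph0 horner0 mulr0.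
case: (hint _ _) => [[c t] d] /= [c0 d0 tE].
have denE : (`|denq a|%N : int) = denq a by rewrite absz_denq.
have den0 : (denq a)%:~R != 0 :> K.
  by apply: contra_neq (denq_neq0 a) => /K0.
rewrite /rat_code c1K c2K denE int_codeK; split; rewrite ?mulf_neq0 //.
rewrite rmorphD /= eviC -mul_polyC !rmorphM /= eviC eviX tE.
rewrite cons_poly_def hornerMXaddC /ratr ?rmorphM /=; field.
by rewrite q0' den0.
Qed.

Definition tint (z : int) : nat := nint (int_code z).

Definition tpoly (g : {poly int}) (B : nat) : nat :=
  foldr (fun c acc => nadd (tint c) (nmul B acc)) nzero g.

Lemma tpoly_val (R : comNzRingType) (f : nat -> R) g B :
  good_val f -> f (tpoly g B) = evi (f B) g.
Proof.
move=> gf; suff H (s : seq int) : f (foldr (fun c acc => nadd (tint c) (nmul B acc)) nzero s) =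
    evi (f B) (Poly s) by rewrite /tpoly H polyseqK.
elim: s => [|c s IH] /=; first by rewrite (gv0 gf) rmorph0.
rewrite (gvD gf) (gvM gf) IH (gvint gf) int_codeK cons_poly_def.
by rewrite rmorphD rmorphM /= eviC eviX addrC mulrC.
Qed.

(** * Recognizing codes of existential sentences *)

Definition fEq a b := cpair 12 (cpair a b).
Definition fMem L i := cpair 13 (cpair L i).
Definition fTm L n := cpair 14 (cpair L n).
Definition fQf L n := cpair 15 (cpair L n).
Definition fEf L n := cpair 16 (cpair L n).

(** Constructor rules come with inversion rules, and impossible codes are refuted, so every model
    gives the tags 12 to 16 their intended meaning. [L] lists the variables allowed to occur free; a
    quantifier adds its variable to [L]. *)
Definition syntax_rules : seq rule :=
  let eq a b := pfact 12 (PP a b) in let mem L i := pfact 13 (PP L i) in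
  let tm L n := pfact 14 (PP L n) in let qf L n := pfact 15 (PP L n) in
  let ef L n := pfact 16 (PP L n) in
  let L := PV 0 in let a := PV 1 in let b := PV 2 in let k := PV 3 in
  let S4 := PS (PS (PS (PS k))) in
  [:: ([::], [:: eq a a]);
      ([:: eq (PN 0) (PS b)], [::]);
      ([:: eq (PS a) (PN 0)], [::]);
      ([:: eq (PS a) (PS b)], [:: eq a b]);
      ([::], [:: mem (PS (PP a L)) a]);
      ([:: mem L a], [:: mem (PS (PP b L)) a]);
      ([:: mem (PN 0) a], [::]);
      ([:: mem (PS (PP b L)) a], [:: eq a b; mem L a]);
      ([:: mem L a], [:: tm L (PP (PN 0) a)]);
      ([:: tm L (PP (PN 0) a)], [:: mem L a]);
      ([::], [:: tm L pZero]);
      ([::], [:: tm L pOne]);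
      ([:: tm L (PP (PN 1) (PS a))], [::]);
      ([:: tm L (PP (PN 2) (PS a))], [::]);
      ([:: tm L a; tm L b], [:: tm L (pA a b)]);
      ([:: tm L (pA a b)], [:: tm L a]);
      ([:: tm L (pA a b)], [:: tm L b]);
      ([:: tm L a], [:: tm L (pO a)]);
      ([:: tm L (pO a)], [:: tm L a]);
      ([:: tm L a; tm L b], [:: tm L (pM a b)]);
      ([:: tm L (pM a b)], [:: tm L a]);
      ([:: tm L (pM a b)], [:: tm L b]);
      ([:: tm L (PP (PS (PS S4)) a)], [::]);
      ([:: tm L a; tm L b], [:: qf L (PP (PN 0) (PP a b))]);
      ([:: qf L (PP (PN 0) (PP a b))], [:: tm L a]);
      ([:: qf L (PP (PN 0) (PP a b))], [:: tm L b]);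
      ([:: qf L a], [:: qf L (PP (PN 1) a)]);
      ([:: qf L (PP (PN 1) a)], [:: qf L a]);
      ([:: qf L a; qf L b], [:: qf L (PP (PN 2) (PP a b))]);
      ([:: qf L (PP (PN 2) (PP a b))], [:: qf L a]);
      ([:: qf L (PP (PN 2) (PP a b))], [:: qf L b]);
      ([:: qf L a; qf L b], [:: qf L (PP (PN 3) (PP a b))]);
      ([:: qf L (PP (PN 3) (PP a b))], [:: qf L a]);
      ([:: qf L (PP (PN 3) (PP a b))], [:: qf L b]);
      ([:: qf L (PP S4 a)], [::]);
      ([:: qf L a], [:: ef L a]);
      ([:: ef (PS (PP a L)) b], [:: ef L (PP (PN 4) (PP a b))]);
      ([:: ef L (PP (PN 4) (PP a b))], [:: ef (PS (PP a L)) b]);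
      ([:: ef L (PP (PN 0) a)], [:: qf L (PP (PN 0) a)]);
      ([:: ef L (PP (PN 1) a)], [:: qf L (PP (PN 1) a)]);
      ([:: ef L (PP (PN 2) a)], [:: qf L (PP (PN 2) a)]);
      ([:: ef L (PP (PN 3) a)], [:: qf L (PP (PN 3) a)]);
      ([:: ef L (PP (PS S4) a)], [::])].

Definition is_term L n :=
  exists2 t, term_code t = n & {subset term_vars t <= sdec L}.
Definition is_qf L n :=
  exists2 f, formula_code f = n & quantifier_free f /\ {subset free_vars f <= sdec L}.
Definition is_ef L n :=
  exists2 f, formula_code f = n & existential f /\ {subset free_vars f <= sdec L}.

Record syntax_facts (M : nat -> Prop) : Prop := SyntaxFacts {
  sf_eq : forall i j, M (fEq i j) <-> i = j;
  sf_mem : forall L i, M (fMem L i) <-> i \in sdec L;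
  sf_tm : forall L n, M (fTm L n) <-> is_term L n;
  sf_qf : forall L n, M (fQf L n) <-> is_qf L n;
  sf_ef : forall L n, M (fEf L n) <-> is_ef L n
}.

Lemma subset_catP (s t u : seq nat) :
  {subset s ++ t <= u} <-> {subset s <= u} /\ {subset t <= u}.
Proof.
split=> [H|[H H'] i]; last by rewrite mem_cat => /orP[/H|/H'].
by split=> i h; apply: H; rewrite mem_cat h ?orbT.
Qed.

Lemma existential_qf f : quantifier_free f -> existential f.
Proof. by case: f. Qed.

Ltac invert_code := move=> /cpair_inj[] //.
Lemma syntax_rules_ok M : syntax_facts M -> Pall (rule_ok M) syntax_rules.
Proof.
case=> Heq Hmem Htm Hqf Hef.
do ![split]; move=> e /=.
- by move=> _; left; apply/Heq.
- by case=> /Heq.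
- by case=> /Heq.
- by case=> /Heq[h] _; left; apply/Heq.
- by move=> _; left; apply/Hmem; rewrite sdecS mem_head.
- by case=> /Hmem h _; left; apply/Hmem; rewrite sdecS in_cons h orbT.
- by case=> /Hmem.
- case=> /Hmem; rewrite sdecS in_cons => /orP[/eqP h|h] _; first by left; apply/Heq.
  by right; left; apply/Hmem.
- case=> /Hmem h _; left; apply/Htm; exists (TVar (e 1%N)) => // i.
  by rewrite inE => /eqP->.
- case=> /Htm[[i|||t u|t|t u]] /=; invert_code => _ <- s _; left; apply/Hmem.
  by apply: s; rewrite inE.
- by move=> _; left; apply/Htm; exists TZero.
- by move=> _; left; apply/Htm; exists TOne.
- by case=> /Htm[[i|||t u|t|t u]] /=; invert_code.
- by case=> /Htm[[i|||t u|t|t u]] /=; invert_code.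
- case=> /Htm[t <- ts] [/Htm[u <- us] _]; left; apply/Htm.
  by exists (TAdd t u) => //; apply/subset_catP.
- case=> /Htm[[i|||t u|t|t u]] /=; invert_code => _; move=> /cpair_inj[<- _] /subset_catP[s _] _.
  by left; apply/Htm; exists t.
- case=> /Htm[[i|||t u|t|t u]] /=; invert_code => _; move=> /cpair_inj[_ <-] /subset_catP[_ s] _.
  by left; apply/Htm; exists u.
- by case=> /Htm[t <- ts] _; left; apply/Htm; exists (TOpp t).
- case=> /Htm[[i|||t u|t|t u]] /=; invert_code => _ <- s _.
  by left; apply/Htm; exists t.
- case=> /Htm[t <- ts] [/Htm[u <- us] _]; left; apply/Htm.
  by exists (TMul t u) => //; apply/subset_catP.
- case=> /Htm[[i|||t u|t|t u]] /=; invert_code => _; move=> /cpair_inj[<- _] /subset_catP[s _] _.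
  by left; apply/Htm; exists t.
- case=> /Htm[[i|||t u|t|t u]] /=; invert_code => _; move=> /cpair_inj[_ <-] /subset_catP[_ s] _.
  by left; apply/Htm; exists u.
- by case=> /Htm[[i|||t u|t|t u]] /=; invert_code.
- case=> /Htm[t <- ts] [/Htm[u <- us] _]; left; apply/Hqf.
  by exists (FEq t u) => //; split=> //; apply/subset_catP.
- case=> /Hqf[[t u|f|f g|f g|i f|i f]] /=; invert_code => _.
  move=> /cpair_inj[<- _] [_ /subset_catP[s _]] _.
  by left; apply/Htm; exists t.
- case=> /Hqf[[t u|f|f g|f g|i f|i f]] /=; invert_code => _.
  move=> /cpair_inj[_ <-] [_ /subset_catP[_ s]] _.
  by left; apply/Htm; exists u.
- by case=> /Hqf[t <- ts] _; left; apply/Hqf; exists (FNot t).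
- case=> /Hqf[[t u|f|f g|f g|i f|i f]] /=; invert_code => _ <- s _.
  by left; apply/Hqf; exists f.
- case=> /Hqf[t <- [qt ts]] [/Hqf[u <- [qu us]] _]; left; apply/Hqf.
  by exists (FAnd t u) => //; split; rewrite /= ?qt //; apply/subset_catP.
- case=> /Hqf[[t u|f|f g|f g|i f|i f]] /=; invert_code => _.
  move=> /cpair_inj[<- _] [/andP[qf qg] /subset_catP[s _]] _.
  by left; apply/Hqf; exists f.
- case=> /Hqf[[t u|f|f g|f g|i f|i f]] /=; invert_code => _.
  move=> /cpair_inj[_ <-] [/andP[qf qg] /subset_catP[_ s]] _.
  by left; apply/Hqf; exists g.
- case=> /Hqf[t <- [qt ts]] [/Hqf[u <- [qu us]] _]; left; apply/Hqf.
  by exists (FOr t u) => //; split; rewrite /= ?qt //; apply/subset_catP.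
- case=> /Hqf[[t u|f|f g|f g|i f|i f]] /=; invert_code => _.
  move=> /cpair_inj[<- _] [/andP[qf qg] /subset_catP[s _]] _.
  by left; apply/Hqf; exists f.
- case=> /Hqf[[t u|f|f g|f g|i f|i f]] /=; invert_code => _.
  move=> /cpair_inj[_ <-] [/andP[qf qg] /subset_catP[_ s]] _.
  by left; apply/Hqf; exists g.
- case=> /Hqf[[t u|f|f g|f g|i f|i f]] /=; invert_code; by move=> _ _ [].
- case=> /Hqf[f <- [qf s]] _; left; apply/Hef; exists f => //; split=> //.
  exact: existential_qf.
- case=> /Hef[f <- [ef s]] _; left; apply/Hef; exists (FEx (e 1%N) f) => //; split=> // i /=.
  rewrite mem_filter => /andP[ia /s]; rewrite sdecS in_cons (negPf ia) //.
- case=> /Hef[[t u|f|f g|f g|i f|i f]] /=; invert_code => _.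
  move=> /cpair_inj[<- <-] [ef s] _; left; apply/Hef; exists f => //; split=> // j jf.
  rewrite sdecS in_cons; case: eqP => //= /eqP ji; apply: s.
  by rewrite mem_filter ji.
- case=> /Hef[f fE [ef s]] _; left; apply/Hqf; exists f => //; split=> //.
  by case: f fE ef {s} => [t u|f|f g|f g|i f|i f] //=; invert_code.
- case=> /Hef[f fE [ef s]] _; left; apply/Hqf; exists f => //; split=> //.
  by case: f fE ef {s} => [t u|f|f g|f g|i f|i f] //=; invert_code.
- case=> /Hef[f fE [ef s]] _; left; apply/Hqf; exists f => //; split=> //.
  by case: f fE ef {s} => [t u|f|f g|f g|i f|i f] //=; invert_code.
- case=> /Hef[f fE [ef s]] _; left; apply/Hqf; exists f => //; split=> //.
  by case: f fE ef {s} => [t u|f|f g|f g|i f|i f] //=; invert_code.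
- case=> /Hef[[t u|f|f g|f g|i f|i f]] /=; invert_code; by move=> _ _ [].
Qed.

Lemma c2_ltn n : (0 < c1 n)%N -> (c2 n < n)%N.
Proof. by move=> h; rewrite -[X in (_ < X)%N](cpair_unpair n) cpair_gt2. Qed.

Lemma syntax_rulesP M : Pall (rule_ok M) syntax_rules -> syntax_facts M.
Proof.
case=> E1 [E2 [E3 [E4 [M1 [M2 [M3 [M4]]]]]]].
case=> T1 [T1' [T2 [T3 [T2' [T3' [T4 [T4a [T4b [T5 [T5a [T6 [T6a [T6b [T7]]]]]]]]]]]]]].
case=> Q1 [Q1a [Q1b [Q2 [Q2a [Q3 [Q3a [Q3b [Q4 [Q4a [Q4b [Q5]]]]]]]]]]].
case=> X1 [X2 [X2a [Y0 [Y1 [Y2 [Y3 [X3 _]]]]]]].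
have Heq i j : M (fEq i j) <-> i = j.
  split=> [|->]; last by case: (E1 (nth 0%N [:: 0; j]%N) I).
  elim: i j => [|i IH] [|j] // h.
  - by case: (E2 (nth 0%N [:: 0; 0; j]%N) (conj h I)).
  - by case: (E3 (nth 0%N [:: 0; i]%N) (conj h I)).
  - by case: (E4 (nth 0%N [:: 0; i; j]%N) (conj h I)) => // /IH->.
have Hmem L i : M (fMem L i) <-> i \in sdec L.
  elim/seq_code_ind: L => [|x L IH].
    by split=> // h; case: (M3 (nth 0%N [:: 0; i]%N) (conj h I)).
  rewrite sdecS in_cons; split=> [h|/orP[/eqP->|/IH h]].
  - case: (M4 (nth 0%N [:: L; i; x]%N) (conj h I)) => [/Heq /= ->|]; first by rewrite eqxx.
    by case=> // /IH ->; rewrite orbT.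
  - by case: (M1 (nth 0%N [:: L; x]%N) I).
  - by case: (M2 (nth 0%N [:: L; i; x]%N) (conj h I)).
have Htm L n : M (fTm L n) <-> is_term L n.
  split=> [|[t <-]].
    elim/ltn_ind: n => n IH; rewrite -(cpair_unpair n).
    have lt2 := @c2_ltn n.
    case: (c1 n) lt2 => [|[|[|[|[|[|k]]]]]] lt2 h.
    - case: (T1' (nth 0%N [:: L; c2 n]%N) (conj h I)) => // /Hmem hm.
      by exists (TVar (c2 n)) => // i; rewrite inE => /eqP->.
    - case: (c2 n) h => [|x] h; first by exists TZero.
      by case: (T2' (nth 0%N [:: L; x]%N) (conj h I)).
    - case: (c2 n) h => [|x] h; first by exists TOne.
      by case: (T3' (nth 0%N [:: L; x]%N) (conj h I)).
    - rewrite -(cpair_unpair (c2 n)) in h *.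
      case: (T4a (nth 0%N [:: L; c1 (c2 n); c2 (c2 n)]%N) (conj h I)) => // /IH[|t tE ts].
        exact: leq_ltn_trans (c1_le _) (lt2 _).
      case: (T4b (nth 0%N [:: L; c1 (c2 n); c2 (c2 n)]%N) (conj h I)) => // /IH[|u uE us].
        exact: leq_ltn_trans (c2_le _) (lt2 _).
      by exists (TAdd t u); [rewrite /= tE uE | apply/subset_catP].
    - case: (T5a (nth 0%N [:: L; c2 n]%N) (conj h I)) => // /IH[|t tE ts]; first exact: lt2.
      by exists (TOpp t); rewrite /= ?tE.
    - rewrite -(cpair_unpair (c2 n)) in h *.
      case: (T6a (nth 0%N [:: L; c1 (c2 n); c2 (c2 n)]%N) (conj h I)) => // /IH[|t tE ts].
        exact: leq_ltn_trans (c1_le _) (lt2 _).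
      case: (T6b (nth 0%N [:: L; c1 (c2 n); c2 (c2 n)]%N) (conj h I)) => // /IH[|u uE us].
        exact: leq_ltn_trans (c2_le _) (lt2 _).
      by exists (TMul t u); [rewrite /= tE uE | apply/subset_catP].
    - by case: (T7 (nth 0%N [:: L; c2 n; 0; k]%N) (conj h I)).
  elim: t => [i|||t IHt u IHu|t IHt|t IHt u IHu] /= s.
  - have h : M (fMem L i) by apply/Hmem/s; rewrite mem_head.
    by case: (T1 (nth 0%N [:: L; i]%N) (conj h I)).
  - by case: (T2 (nth 0%N [:: L]%N) I).
  - by case: (T3 (nth 0%N [:: L]%N) I).
  - move/subset_catP: s => [/IHt h /IHu h'].
    by case: (T4 (nth 0%N [:: L; term_code t; term_code u]%N) (conj h (conj h' I))).
  - by move/IHt: s => h; case: (T5 (nth 0%N [:: L; term_code t]%N) (conj h I)).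
  - move/subset_catP: s => [/IHt h /IHu h'].
    by case: (T6 (nth 0%N [:: L; term_code t; term_code u]%N) (conj h (conj h' I))).
have Hqf L n : M (fQf L n) <-> is_qf L n.
  split=> [|[f <- []]].
    elim/ltn_ind: n => n IH; rewrite -(cpair_unpair n).
    have lt2 := @c2_ltn n.
    case: (c1 n) lt2 => [|[|[|[|k]]]] lt2 h.
    - rewrite -(cpair_unpair (c2 n)) in h *.
      case: (Q1a (nth 0%N [:: L; c1 (c2 n); c2 (c2 n)]%N) (conj h I)) => // /Htm[t tE ts].
      case: (Q1b (nth 0%N [:: L; c1 (c2 n); c2 (c2 n)]%N) (conj h I)) => // /Htm[u uE us].
      by exists (FEq t u); [rewrite /= tE uE | split=> //; apply/subset_catP].
    - case: (Q2a (nth 0%N [:: L; c2 n]%N) (conj h I)) => // /IH[|t tE ts]; first exact: lt2.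
      by exists (FNot t); rewrite /= ?tE.
    - rewrite -(cpair_unpair (c2 n)) in h *.
      case: (Q3a (nth 0%N [:: L; c1 (c2 n); c2 (c2 n)]%N) (conj h I)) => // /IH[|t tE [qt ts]].
        exact: leq_ltn_trans (c1_le _) (lt2 _).
      case: (Q3b (nth 0%N [:: L; c1 (c2 n); c2 (c2 n)]%N) (conj h I)) => // /IH[|u uE [qu us]].
        exact: leq_ltn_trans (c2_le _) (lt2 _).
      by exists (FAnd t u); [rewrite /= tE uE | split; rewrite /= ?qt //; apply/subset_catP].
    - rewrite -(cpair_unpair (c2 n)) in h *.
      case: (Q4a (nth 0%N [:: L; c1 (c2 n); c2 (c2 n)]%N) (conj h I)) => // /IH[|t tE [qt ts]].
        exact: leq_ltn_trans (c1_le _) (lt2 _).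
      case: (Q4b (nth 0%N [:: L; c1 (c2 n); c2 (c2 n)]%N) (conj h I)) => // /IH[|u uE [qu us]].
        exact: leq_ltn_trans (c2_le _) (lt2 _).
      by exists (FOr t u); [rewrite /= tE uE | split; rewrite /= ?qt //; apply/subset_catP].
    - by case: (Q5 (nth 0%N [:: L; c2 n; 0; k]%N) (conj h I)).
  elim: f => [t u|f IHf|f IHf g IHg|f IHf g IHg|i f IHf|i f IHf] //= qf s.
  - move/subset_catP: s => [s s'].
    have h : M (fTm L (term_code t)) by apply/Htm; exists t.
    have h' : M (fTm L (term_code u)) by apply/Htm; exists u.
    by case: (Q1 (nth 0%N [:: L; term_code t; term_code u]%N) (conj h (conj h' I))).
  - by have h := IHf qf s; case: (Q2 (nth 0%N [:: L; formula_code f]%N) (conj h I)).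
  - move/subset_catP: s => [s s']; move/andP: qf => [/IHf/(_ s) h /IHg/(_ s') h'].
    by case: (Q3 (nth 0%N [:: L; formula_code f; formula_code g]%N) (conj h (conj h' I))).
  - move/subset_catP: s => [s s']; move/andP: qf => [/IHf/(_ s) h /IHg/(_ s') h'].
    by case: (Q4 (nth 0%N [:: L; formula_code f; formula_code g]%N) (conj h (conj h' I))).
split=> // L n; split=> [|[f <- []]].
  elim/ltn_ind: n L => n IH L.
  have qfef m : M (fQf L m) -> is_ef L m.
    by move=> /Hqf[f fE [qf s]]; exists f => //; split=> //; apply: existential_qf.
  rewrite -(cpair_unpair n); have lt2 := @c2_ltn n.
  case: (c1 n) lt2 => [|[|[|[|[|k]]]]] lt2 h.
  - by case: (Y0 (nth 0%N [:: L; c2 n]%N) (conj h I)) => // /qfef.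
  - by case: (Y1 (nth 0%N [:: L; c2 n]%N) (conj h I)) => // /qfef.
  - by case: (Y2 (nth 0%N [:: L; c2 n]%N) (conj h I)) => // /qfef.
  - by case: (Y3 (nth 0%N [:: L; c2 n]%N) (conj h I)) => // /qfef.
  - rewrite -(cpair_unpair (c2 n)) in h *.
    case: (X2a (nth 0%N [:: L; c1 (c2 n); c2 (c2 n)]%N) (conj h I)) => // /IH[|f fE [ef s]].
      exact: leq_ltn_trans (c2_le _) (lt2 _).
    exists (FEx (c1 (c2 n)) f); first by rewrite /= fE.
    split=> // i /=; rewrite mem_filter => /andP[ia /s].
    by rewrite sdecS in_cons (negPf ia).
  - by case: (X3 (nth 0%N [:: L; c2 n; 0; k]%N) (conj h I)).
elim: f L => [t u|f _|f _ g _|f _ g _|i f IHf|i f IHf] L //= ef s.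
- have h : M (fQf L (formula_code (FEq t u))) by apply/Hqf; exists (FEq t u).
  by case: (X1 (nth 0%N [:: L; formula_code (FEq t u)]%N) (conj h I)).
- have h : M (fQf L (formula_code (FNot f))) by apply/Hqf; exists (FNot f).
  by case: (X1 (nth 0%N [:: L; formula_code (FNot f)]%N) (conj h I)).
- have h : M (fQf L (formula_code (FAnd f g))) by apply/Hqf; exists (FAnd f g).
  by case: (X1 (nth 0%N [:: L; formula_code (FAnd f g)]%N) (conj h I)).
- have h : M (fQf L (formula_code (FOr f g))) by apply/Hqf; exists (FOr f g).
  by case: (X1 (nth 0%N [:: L; formula_code (FOr f g)]%N) (conj h I)).
- have h : M (fEf (cpair i L).+1 (formula_code f)).
    apply: IHf => // j jf; rewrite sdecS in_cons; case: eqP => //= /eqP ji.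
    by apply: s; rewrite mem_filter ji.
  by case: (X2 (nth 0%N [:: L; i; formula_code f]%N) (conj h I)).
Qed.

Lemma is_ef0 n : is_ef 0 n <-> exists2 f, formula_code f = n & sentence f /\ existential f.
Proof.
split=> [[f fE [ef s]]|[f fE [s ef]]]; exists f => //; split=> //.
  by rewrite /sentence; case: (free_vars f) s => // i l /(_ i); rewrite mem_head => /(_ isT).
by move=> i; rewrite (nilP s).
Qed.

(** * Existential sentences in characteristic p *)

Fixpoint matrix_of (f : formula) : formula :=
  if f is FEx _ g then matrix_of g else f.

Fixpoint atoms (f : formula) : seq (term * term) :=
  match f with
  | FEq t u => [:: (t, u)]
  | FNot f | FEx _ f | FAll _ f => atoms f
  | FAnd f g | FOr f g => atoms f ++ atoms g
  end.

Lemma matrix_qf f : existential f -> quantifier_free (matrix_of f).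
Proof. by elim: f. Qed.

Lemma matrix_id f : quantifier_free f -> matrix_of f = f.
Proof. by case: f. Qed.

Lemma teval_morph (R S : nzRingType) (phi : {rmorphism R -> S}) e t :
  teval (fun i => phi (e i)) t = phi (teval e t).
Proof.
elim: t => [i|||t IHt u IHu|t IHt|t IHt u IHu] //=; rewrite ?rmorph0 ?rmorph1 //.
- by rewrite IHt IHu rmorphD.
- by rewrite IHt rmorphN.
- by rewrite IHt IHu rmorphM.
Qed.

Lemma teval_ext (R : nzRingType) (e e' : nat -> R) t :
  (forall i, i \in term_vars t -> e i = e' i) -> teval e t = teval e' t.
Proof.
elim: t => [i|||t IHt u IHu|t IHt|t IHt u IHu] //= H.
- by apply: H; rewrite mem_head.
- by rewrite IHt ?IHu // => i h; apply: H; rewrite mem_cat h ?orbT.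
- by rewrite IHt.
- by rewrite IHt ?IHu // => i h; apply: H; rewrite mem_cat h ?orbT.
Qed.

Lemma holds_atoms (R S : nzRingType) (e : nat -> R) (e' : nat -> S) f :
  quantifier_free f ->
  Pall (fun tu => teval e tu.1 = teval e tu.2 <-> teval e' tu.1 = teval e' tu.2) (atoms f) ->
  holds e f <-> holds e' f.
Proof.
elim: f => [t u|f IHf|f IHf g IHg|f IHf g IHg|i f IHf|i f IHf] //=.
- by move=> _ [].
- by move=> qf H; split=> nh h; apply: nh; apply/(IHf qf H).
- by move=> /andP[qf qg] /Pall_cat[/(IHf qf) -> /(IHg qg) ->].
- by move=> /andP[qf qg] /Pall_cat[/(IHf qf) -> /(IHg qg) ->].
Qed.

Lemma atoms_vars f : quantifier_free f ->
  Pall (fun tu => {subset term_vars tu.1 ++ term_vars tu.2 <= free_vars f}) (atoms f).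
Proof.
have mono (s t : seq nat) : {subset s <= t} -> forall l : seq (term * term),
    Pall (fun tu => {subset term_vars tu.1 ++ term_vars tu.2 <= s}) l ->
    Pall (fun tu => {subset term_vars tu.1 ++ term_vars tu.2 <= t}) l.
  by move=> st; elim=> //= tu l IH [h /IH h']; split=> // i /h/st.
elim: f => [t u|f IHf|f IHf g IHg|f IHf g IHg|i f IHf|i f IHf] //=.
- by split.
- by move=> /andP[/IHf h /IHg h']; apply/Pall_cat; split;
    [apply: mono h|apply: mono h'] => i hi; rewrite mem_cat hi ?orbT.
- by move=> /andP[/IHf h /IHg h']; apply/Pall_cat; split;
    [apply: mono h|apply: mono h'] => i hi; rewrite mem_cat hi ?orbT.
Qed.

Lemma Pall_imp (T : Type) (P Q : T -> Prop) s :
  (forall x, P x -> Q x) -> Pall P s -> Pall Q s.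
Proof. by move=> PQ; elim: s => //= x s IH [/PQ h /IH]. Qed.

Lemma holds_ext (R : nzRingType) (e e' : nat -> R) f : quantifier_free f ->
  (forall i, i \in free_vars f -> e i = e' i) -> holds e f <-> holds e' f.
Proof.
move=> qf H; apply: holds_atoms => //; apply: Pall_imp (atoms_vars qf) => -[t u] /= s.
by rewrite (teval_ext (e' := e')) ?(@teval_ext _ e e' u) // => i h; apply/H/s;
  rewrite mem_cat h ?orbT.
Qed.

Lemma holds_matrix (R : nzRingType) (e : nat -> R) f :
  existential f -> holds e f -> exists e' : nat -> R, holds e' (matrix_of f).
Proof.
elim: f e => [t u|f IHf|f IHf g IHg|f IHf g IHg|i f IHf|i f IHf] e //= ef h; try by exists e.
by case: h => x /IHf; apply.
Qed.

Lemma matrix_holds (R : nzRingType) (e e' : nat -> R) f : existential f ->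
  (forall i, i \in free_vars f -> e i = e' i) -> holds e (matrix_of f) -> holds e' f.
Proof.
elim: f e' => [t u|f _|f _ g _|f _ g _|i f IHf|i f IHf] e' //= ef H.
- by move=> h; apply/(holds_ext (e := e) (e' := e') (f := FEq t u)).
- by move=> h; apply/(holds_ext (e := e) (e' := e') (f := FNot f)).
- by move=> h; apply/(holds_ext (e := e) (e' := e') (f := FAnd f g)).
- by move=> h; apply/(holds_ext (e := e) (e' := e') (f := FOr f g)).
- move=> h; exists (e i); apply: IHf h => // j jf /=.
  by case: (eqVneq j i) => [->//|ji]; apply: H; rewrite mem_filter ji.
Qed.

Fixpoint tower_var N (i : nat) : tower N :=
  match N return tower N with
  | 0 => 0
  | N'.+1 => if i == N' then 'X else (tower_var N' i)%:P
  end.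

Lemma tower_eval_var (K : fieldType) (x : nat -> K) N i : (i < N)%N ->
  tower_eval x N (tower_var N i) = x i.
Proof.
elim: N => // N IH; rewrite ltnS leq_eqVlt /=.
case: eqP => [-> _|_ /= h]; first by rewrite map_polyX /horner_eval hornerX.
by rewrite map_polyC /horner_eval hornerC /= IH.
Qed.

Lemma teval_tower (K : fieldType) (x : nat -> K) N t :
  (forall i, i \in term_vars t -> (i < N)%N) ->
  tower_eval x N (teval (tower_var N) t) = teval x t.
Proof.
by move=> H; rewrite -teval_morph; apply: teval_ext => i /H; apply: tower_eval_var.
Qed.

Lemma bounded_list (s : seq nat) : exists N, forall i, i \in s -> (i < N)%N.
Proof.
elim: s => [|x s [N H]]; first by exists 0%N.
exists (maxn x.+1 N) => i; rewrite in_cons leq_max => /orP[/eqP->|/H->]; last by rewrite orbT.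
by rewrite ltnSn.
Qed.

(** Equations between atoms persist under specialization; the inequations that hold are gathered
    into one product [s] whose value has to stay nonzero. *)
Lemma algebraic_solution (K : fieldType) (L : closedFieldType) p (f : formula) (x : nat -> K) :
  p \in [pchar K] -> p \in [pchar L] -> quantifier_free f -> holds x f ->
  exists y : nat -> L, holds y f.
Proof.
move=> pK pL qf xf; have [N HN] := bounded_list (free_vars f).
pose T t := teval (tower_var N) t.
have TE (F : fieldType) (z : nat -> F) : Pall (fun tu => forall w : F,
    (tower_eval z N (T tu.1 - T tu.2) == 0) = (teval z tu.1 == teval z tu.2)) (atoms f).
  apply: Pall_imp (atoms_vars qf) => -[t u] /= s w.
  by rewrite rmorphB /= !teval_tower ?subr_eq0 // => i h; apply/HN/s; rewrite mem_cat h ?orbT.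
have [s xs Hs] : exists2 s, tower_eval x N s != 0 &
    forall y : nat -> L, tower_eval y N s != 0 ->
      Pall (fun tu => tower_eval x N (T tu.1 - T tu.2) != 0 ->
                      tower_eval y N (T tu.1 - T tu.2) != 0) (atoms f).
  elim: (atoms f) => [|[t u] l [s xs Hs]]; first by exists 1 => //; rewrite rmorph1 oner_neq0.
  pose d := T t - T u; have [d0|d0] := eqVneq (tower_eval x N d) 0.
    by exists s => // y /Hs h; split=> //=; rewrite -/d d0 eqxx.
  exists (d * s); first by rewrite rmorphM mulf_neq0.
  by move=> y; rewrite rmorphM mulf_eq0 negb_or => /andP[h /Hs h'].
have [y ys Hy] := specialization pK pL xs; exists y.
apply/(holds_atoms (e := x)) => //.
have := Hs y ys; have := TE _ x; have := TE _ y.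
elim: (atoms f) => [|[t u] l IH] //= [/(_ 0) ty /IH{}IH] [/(_ 0) tx /IH{}IH] [h /IH{}IH].
split=> //; split=> /eqP.
  by rewrite -tx => /eqP/Hy/eqP; rewrite ty => /eqP.
by rewrite -ty => yE; apply/eqP; rewrite -tx; apply: contraLR yE => /h.
Qed.

Definition lpoly (l : nat) : {poly int} := Poly (map Posz (sdec l)).

Lemma lpoly_cons k l : lpoly (cpair k l).+1 = (Posz k)%:P + 'X * lpoly l.
Proof. by rewrite /lpoly sdecS /= cons_poly_def addrC mulrC. Qed.

Lemma lpoly0 : lpoly 0 = 0.
Proof. by rewrite /lpoly sdec0. Qed.

Lemma lpolyXn j : exists l, lpoly l = 'X^j.
Proof.
elim: j => [|j [l IH]].
  by exists (cpair 1 0).+1; rewrite lpoly_cons lpoly0 mulr0 addr0.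
by exists (cpair 0 l).+1; rewrite lpoly_cons IH add0r -exprS.
Qed.

Section FiniteField.

Variables (p : nat) (L : fieldType).
Hypotheses (p_pr : prime p) (pL : p \in [pchar L])
  (L_fin : forall b : L, exists2 N, (0 < N)%N & b ^+ (p ^ N) = b).

Lemma common_exponent (y : nat -> L) n :
  exists2 N, (0 < N)%N & forall i, (i < n)%N -> y i ^+ (p ^ N) = y i.
Proof.
elim: n => [|n [N N0 HN]]; first by exists 1%N.
have [N' N'0 HN'] := L_fin (y n); exists (N * N')%N; first by rewrite muln_gt0 N0.
move=> i; rewrite ltnS leq_eqVlt => /orP[/eqP->|/HN]; last exact: exp_p_iter.
by rewrite mulnC exp_p_iter.
Qed.

Lemma evi_inverse (th : L) (G : {poly int}) : evi th G != 0 ->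
  exists W, evi th (G * W) = 1.
Proof.
move=> d0; have [N N0 dN] := L_fin (evi th G).
have pN : (1 < p ^ N)%N by rewrite -(exp1n N) ltn_exp2r // prime_gt1.
exists (G ^+ (p ^ N).-2); rewrite rmorphM rmorphXn /= -exprS.
apply: (mulfI d0); rewrite -exprS mulr1 -[RHS]dN; congr (_ ^+ _).
by case: (p ^ N)%N pN => [|[|]].
Qed.

(** Finitely many elements lie in a common finite field, where each is 0 or a power of one root of
    unity [th]; they become polynomials in [th], to be computed modulo [p] and its minimal
    polynomial. *)
Lemma finite_parameter (y : nat -> L) n : exists (th : L) (l : nat) (u : nat -> nat),
  [/\ evi th (lpoly l) = 0, lpoly l \is monic, (1 < size (sdec l))%N /\ last 0%N (sdec l) = 1%N,
      forall f, evi th f = 0 -> exists h r, f = lpoly l * h + p%:R * r &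
      forall i, (i < n)%N -> y i = evi th (lpoly (u i))].
Proof.
have [N N0 HN] := common_exponent y n.
have pN : (1 < p ^ N)%N by rewrite -(exp1n N) ltn_exp2r // prime_gt1.
have [m [th [m0 thm Hth]]] := exists_generator L pN.
have [l [l1 ll lm l0 lmin]] := exists_min_poly pL m0 thm.
have /choice[u Hu] i : exists u, (i < n)%N -> y i = evi th (lpoly u).
  case: (ltnP i n) => // ni; last by exists 0%N.
  case: (Hth _ (HN _ ni)) => [->|[j ->]]; first by exists 0%N; rewrite lpoly0 rmorph0.
  by have [v vE] := lpolyXn j; exists v; rewrite vE rmorphXn /= eviX.
exists th, (seq_code l), u; rewrite /lpoly seq_codeK; split=> //.
exact: (min_polyP lm l0 lmin).
Qed.

End FiniteField.

(** A template for models: shared tags get their intended meaning, [E] interprets equations in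
    contexts, and [X] the input and the tags peculiar to one theory. *)
Definition base_fact (E : nat -> nat -> nat -> Prop) (X : nat -> nat -> Prop)
    (m : nat) : Prop :=
  let y := c2 m in
  match c1 m with
  | 0 => True
  | 2 => E (c1 y) (c1 (c2 y)) (c2 (c2 y))
  | 3 => c1 y = (c2 y).*2
  | 4 => let B := c1 (c2 y) in let C := c1 (c2 (c2 y)) in let w := c2 (c2 (c2 y)) in
         hterm (sdec (c1 y)) B C = (c1 w, c1 (c2 w), c2 (c2 w))
  | 12 => c1 y = c2 y
  | 13 => c2 y \in sdec (c1 y)
  | 14 => is_term (c1 y) (c2 y)
  | 15 => is_qf (c1 y) (c2 y)
  | 16 => is_ef (c1 y) (c2 y)
  | t => X t y
  end.

Lemma base_fE E X g a b : base_fact E X (fE g a b) = E g a b.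
Proof. by rewrite /base_fact !(c1K, c2K). Qed.

Lemma base_syntax E X : syntax_facts (base_fact E X).
Proof. by split=> *; rewrite /base_fact !(c1K, c2K). Qed.

Lemma base_common E X :
  (forall g, exists (I : Type) (D : I -> Prop) (R : comNzRingType) (f : I -> nat -> R),
     (forall i, good_val (f i)) /\
     forall a b, E g a b <-> forall i, D i -> f i a = f i b) ->
  common_facts (base_fact E X).
Proof.
move=> H; apply: family_common => [g|a k|s B C ctd].
- have [I [D [R [f [gf EP]]]]] := H g; exists I, D, R, f; split=> // a b.
  by rewrite base_fE.
- by rewrite /base_fact !(c1K, c2K).
- rewrite /base_fact /fH !(c1K, c2K).
  by case: ctd => -[c t] d /=; split.
Qed.

(** The field axiom appears as a disjunction. The last rule gives 0 the inverse 0, so that [ninv]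
    agrees with the inverse of a [fieldType] at every element. *)
Definition inverse_rules : seq rule :=
  let g := PV 0 in let a := PV 1 in let b := PV 2 in let inv a := PP (PN 6) a in
  [:: ([:: pE g a b], [:: pE g (inv a) (inv b)]);
      ([::], [:: pE g a pZero; pE g (pM a (inv a)) pOne]);
      ([:: pE g pOne pZero], [::]);
      ([:: pE g a pZero], [:: pE g (inv a) pZero])].

Lemma inverse_field M : common_facts M -> Pall (rule_ok M) inverse_rules ->
  exists (K : fieldType) (f : nat -> K),
    [/\ good_val f, forall a, f (ninv a) = (f a)^-1,
        forall u, exists a, f a = u & forall a b, f a = f b <-> M (fE 0 a b)].
Proof.
move=> HM [R1 [R2 [R3 [R4 _]]]].
have HI a b : M (fE 0 a b) -> M (fE 0 (ninv a) (ninv b)).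
  by move=> h; case: (R1 (nth 0%N [:: 0; a; b]%N) (conj h I)).
have HV a : M (fE 0 a nzero) \/ M (fE 0 (nmul a (ninv a)) none).
  by case: (R2 (nth 0%N [:: 0; a]%N) I) => [|[|//]]; [left|right].
have H10 : ~ M (fE 0 none nzero).
  by move=> h; case: (R3 (nth 0%N [::]) (conj h I)).
have [K [f [f0 f1 [fD fN fM fV] fs fP]]] := quotient_field (cf_ring HM 0) H10 HV.
exists K, f; split=> [|a|//|//].
  by apply: (model_good_val HM f0 f1 fD fN fM (g := 0)) => a b /fP.
have [a0|/fV //] := eqVneq (f a) 0; rewrite a0 invr0 -f0; apply/fP.
have h : M (fE 0 a nzero) by apply/fP; rewrite a0.
by case: (R4 (nth 0%N [:: 0; a]%N) (conj h I)) => [|[]].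
Qed.

Lemma inverse_rules_ok M (K : fieldType) (f : nat -> K) : good_val f ->
  (forall a, f (ninv a) = (f a)^-1) -> (forall g a b, M (fE g a b) <-> f a = f b) ->
  Pall (rule_ok M) inverse_rules.
Proof.
move=> gf fV fP; do ![split]; move=> e /=.
- by case=> /fP h _; left; apply/fP; rewrite !fV h.
- move=> _; case: (eqVneq (f (e 1%N)) 0) => a0; [left|right; left]; apply/fP.
    by rewrite (gv0 gf).
  by rewrite (gvM gf) fV divff // (gv1 gf).
- by case=> /fP; rewrite (gv0 gf) (gv1 gf) => /eqP; rewrite oner_eq0.
- by case=> /fP h _; left; apply/fP; rewrite fV h (gv0 gf) invr0.
Qed.

(** * Solutions in arbitrary fields of characteristic p *)

Definition fTr g n := cpair 17 (cpair g n).
Definition fFa g n := cpair 18 (cpair g n).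
Definition fIn n := cpair 1 n.

(** Only elimination rules for truth and falsity: as in a Hintikka set, they are passed down to
    subformulas and need not be decided. Quantifiers are dropped without renaming, which is harmless
    for an existential prefix, where a repeated variable is bound by its innermost quantifier. *)
Definition truth_rules p : seq rule :=
  let g := PV 0 in let a := PV 1 in let b := PV 2 in
  let tr n := pfact 17 (PP g n) in let fa n := pfact 18 (PP g n) in
  [:: ([::], [:: pE g (pNum (PN p)) pZero]);
      ([:: tr (PP (PN 0) (PP a b))], [:: pE g a b]);
      ([:: tr (PP (PN 1) a)], [:: fa a]);
      ([:: tr (PP (PN 2) (PP a b))], [:: tr a]);
      ([:: tr (PP (PN 2) (PP a b))], [:: tr b]);
      ([:: tr (PP (PN 3) (PP a b))], [:: tr a; tr b]);
      ([:: tr (PP (PN 4) (PP a b))], [:: tr b]);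
      ([:: fa (PP (PN 0) (PP a b)); pE g a b], [::]);
      ([:: fa (PP (PN 1) a)], [:: tr a]);
      ([:: fa (PP (PN 2) (PP a b))], [:: fa a; fa b]);
      ([:: fa (PP (PN 3) (PP a b))], [:: fa a]);
      ([:: fa (PP (PN 3) (PP a b))], [:: fa b]);
      ([:: pfact 1 a], [:: pfact 16 (PP (PN 0) a)]);
      ([:: pfact 1 a], [:: pfact 17 (PP (PN 0) a)])].

(* Its models are the characteristic p fields together with a solution of the
   quantifier-free part of the input. *)
Definition satisfiability_theory p : seq rule :=
  common_rules ++ syntax_rules ++ inverse_rules ++ truth_rules p.

Section Satisfiability.

Variables (p : nat) (k : fieldType).
Hypotheses (p_pr : prime p) (pk : p \in [pchar k]).

Lemma satisfiability_consistent n : codes formula_code (existential_theory k) n ->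
  consistent (satisfiability_theory p) n.
Proof.
move=> [f [sf ef /(holds_matrix ef)[e he]] cE].
pose v := nval (fun x => x^-1) e (fun=> 0) 0 (0 : k).
have gv : good_val v by apply: nval_good.
pose X t y := match t with
  | 1 => y = n
  | 17 => exists2 h, formula_code h = c2 y & existential h /\ holds e (matrix_of h)
  | 18 => exists2 h, formula_code h = c2 y & quantifier_free h /\ ~ holds e h
  | _ => False end.
pose M := base_fact (fun _ a b => v a = v b) X.
have ME g a b : M (fE g a b) <-> v a = v b by rewrite /M base_fE.
have vt t : v (term_code t) = teval e t.
  by rewrite (good_val_teval _ gv); congr teval; apply/funext => i; rewrite /v nval_var.
have MT g m : M (fTr g m) <->
    exists2 h, formula_code h = m & existential h /\ holds e (matrix_of h).
  by rewrite /M /base_fact !(c1K, c2K) /= c2K.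
have MF g m : M (fFa g m) <->
    exists2 h, formula_code h = m & quantifier_free h /\ ~ holds e h.
  by rewrite /M /base_fact !(c1K, c2K) /= c2K.
have MI m : M (fIn m) <-> m = n by rewrite /M /base_fact !(c1K, c2K).
exists M; last exact/MI.
split; first by [].
do ![apply/Pall_cat; split].
- apply/common_rulesP/base_common => g; exists unit, (fun=> True), k, (fun=> v).
  by split=> // a b; split=> [h _ _|/(_ tt I)].
- exact/syntax_rules_ok/base_syntax.
- by apply: (inverse_rules_ok gv) => // a; rewrite /v nval_inv.
do ![split]; move=> s /=.
- by move=> _; left; apply/ME; rewrite (gvnum gv) (gv0 gv); apply: pcharf0.
- case=> /MT[[t u|h|h h'|h h'|i h|i h]] /=; invert_code => _.
  by move=> /cpair_inj[<- <-] [_ E] _; left; apply/ME; rewrite !vt.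
- case=> /MT[[t u|h|h h'|h h'|i h|i h]] /=; invert_code => _ <- [qh E] _.
  by left; apply/MF; exists h.
- case=> /MT[[t u|h|h h'|h h'|i h|i h]] /=; invert_code => _.
  move=> /cpair_inj[<- _] [/andP[q q'] [E E']] _.
  by left; apply/MT; exists h => //; rewrite matrix_id // existential_qf.
- case=> /MT[[t u|h|h h'|h h'|i h|i h]] /=; invert_code => _.
  move=> /cpair_inj[_ <-] [/andP[q q'] [E E']] _.
  by left; apply/MT; exists h' => //; rewrite matrix_id // existential_qf.
- case=> /MT[[t u|h|h h'|h h'|i h|i h]] /=; invert_code => _.
  move=> /cpair_inj[<- <-] [/andP[q q'] [E|E]] _; [left|right; left]; apply/MT.
    by exists h => //; rewrite matrix_id // existential_qf.
  by exists h' => //; rewrite matrix_id // existential_qf.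
- case=> /MT[[t u|h|h h'|h h'|i h|i h]] /=; invert_code => _.
    by move=> /cpair_inj[_ <-] [eh E] _; left; apply/MT; exists h.
- case=> /MF[[t u|h|h h'|h h'|i h|i h]] /=; invert_code => _.
  by move=> /cpair_inj[<- <-] [_ E] [/ME h _]; case: E; rewrite -!vt.
- case=> /MF[[t u|h|h h'|h h'|i h|i h]] /=; invert_code => _ <- [qh E] _.
  left; apply/MT; exists h => //; rewrite matrix_id // existential_qf //; split=> //.
  exact: contrapT.
- case=> /MF[[t u|h|h h'|h h'|i h|i h]] /=; invert_code => _.
  move=> /cpair_inj[<- <-] [/andP[q q'] /not_andP[E|E]] _; [left|right; left]; apply/MF.
    by exists h.
  by exists h'.
- case=> /MF[[t u|h|h h'|h h'|i h|i h]] /=; invert_code => _.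
  move=> /cpair_inj[<- _] [/andP[q q'] /not_orP[E E']] _.
  by left; apply/MF; exists h.
- case=> /MF[[t u|h|h h'|h h'|i h|i h]] /=; invert_code => _.
  move=> /cpair_inj[_ <-] [/andP[q q'] /not_orP[E E']] _.
  by left; apply/MF; exists h'.
- case=> /MI -> _; left; apply/(sf_ef (base_syntax _ _))/is_ef0.
  by exists f.
- by case=> /MI -> _; left; apply/MT; exists f.
Qed.

End Satisfiability.

Lemma satisfiability_field p n : prime p -> consistent (satisfiability_theory p) n ->
  exists (K : fieldType) (f : formula) (e : nat -> K),
    [/\ p \in [pchar K], formula_code f = n, sentence f, existential f &
        holds e (matrix_of f)].
Proof.
move=> p_pr [M [M0 /Pall_cat[/common_rulesP HM /Pall_cat[/syntax_rulesP HS]]]].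
move=> /Pall_cat[/(inverse_field HM)[K [v [gv vV vs vP]]]].
case=> C0 [T0 [T1 [T2 [T2' [T3 [T4 [F0 [F1 [F2 [F3 [F3' [I0 [I1 _]]]]]]]]]]]]] Mn.
have [|[]] // := I0 (nth 0%N [:: 0; n]%N) (conj Mn I).
move=> /(sf_ef HS)/is_ef0[f cE [sf ef]].
have [|[]] // := I1 (nth 0%N [:: 0; n]%N) (conj Mn I).
rewrite -[inst _ _]/(fTr 0 n) => trn.
pose e i := v (nvar i).
have vt t : v (term_code t) = teval e t by apply: good_val_teval.
have H h : quantifier_free h ->
    (M (fTr 0 (formula_code h)) -> holds e h) /\
    (M (fFa 0 (formula_code h)) -> ~ holds e h).
  elim: h => [t u|h IH|h IH h' IH'|h IH h' IH'|i h IH|i h IH] //=.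
  - split=> m.
      have [|[]] // := T0 (nth 0%N [:: 0; term_code t; term_code u]%N) (conj m I).
      by move=> /vP; rewrite !vt.
    rewrite -!vt => /vP m'.
    by case: (F0 (nth 0%N [:: 0; term_code t; term_code u]%N) (conj m (conj m' I))).
  - move=> /IH[IHt IHf]; split=> m.
      by have [/IHf|[]] := T1 (nth 0%N [:: 0; formula_code h]%N) (conj m I).
    have [/IHt hh|[]] // := F1 (nth 0%N [:: 0; formula_code h]%N) (conj m I).
  - move=> /andP[/IH[IHt IHf] /IH'[IHt' IHf']].
    pose s := nth 0%N [:: 0; formula_code h; formula_code h']%N; split=> m.
      have [/IHt|[]] // := T2 s (conj m I).
      by have [/IHt'|[]] := T2' s (conj m I).
    by case=> hh hh'; have [/IHf|[/IHf'|[]]] := F2 s (conj m I).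
  - move=> /andP[/IH[IHt IHf] /IH'[IHt' IHf']].
    pose s := nth 0%N [:: 0; formula_code h; formula_code h']%N; split=> m.
      by have [/IHt|[/IHt'|[]]] := T3 s (conj m I); [left|right].
    by case=> hh; [have [/IHf|[]] := F3 s (conj m I)|have [/IHf'|[]] := F3' s (conj m I)].
exists K, f, e; split=> //.
  rewrite inE p_pr /= -(gvnum gv) -(gv0 gv); apply/eqP/vP.
  by case: (C0 (nth 0%N [:: 0]%N) I) => [|[]].
have {trn} : M (fTr 0 (formula_code f)) by rewrite cE.
elim: f ef {cE sf} => [t u|h _|h _ h' _|h _ h' _|i h IH|i h _] //= ef.
- exact: (H (FEq t u) ef).1.
- exact: (H (FNot h) ef).1.
- exact: (H (FAnd h h') ef).1.
- exact: (H (FOr h h') ef).1.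
move=> m; apply: IH => //.
by case: (T4 (nth 0%N [:: 0; i; formula_code h]%N) (conj m I)) => [|[]].
Qed.

(** * Certificates over finite fields *)

Definition fMon l := cpair 19 l.
Definition fAs s i u := cpair 20 (cpair s (cpair i u)).

(* X stands for a root of a monic polynomial given by its list of coefficients. *)
Definition list_rules : seq rule :=
  let g := PV 0 in let l := PV 1 in let k := PV 2 in
  [:: ([::], [:: pE g (pPol (PN 0)) pZero]);
      ([::], [:: pE g (pPol (PS (PP k l))) (pA (pNum k) (pM (PN nX) (pPol l)))]);
      ([::], [:: pfact 19 (PS (PP k (PN (seq_code [:: 1%N]))))]);
      ([:: pfact 19 l], [:: pfact 19 (PS (PP k l))])].

Record list_facts (M : nat -> Prop) : Prop := ListFacts {
  lf_0 : forall g, M (fE g (npol 0) nzero);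
  lf_S : forall g k l, M (fE g (npol (cpair k l).+1) (nadd (nnum k) (nmul nX (npol l))));
  lf_mon : forall s, (1 < size s)%N -> last 0%N s = 1%N -> M (fMon (seq_code s))
}.

Lemma list_rulesP M : Pall (rule_ok M) list_rules -> list_facts M.
Proof.
case=> R1 [R2 [R3 [R4 _]]]; split.
- by move=> g; case: (R1 (nth 0%N [:: g]) I) => [|[]].
- by move=> g k l; case: (R2 (nth 0%N [:: g; l; k]) I) => [|[]].
- elim=> [|a [|b [|c s]] IH] // _ h.
    rewrite /= in h; rewrite h.
    by case: (R3 (nth 0%N [:: 0; 0; a]%N) I) => [|[]].
  by case: (R4 (nth 0%N [:: 0; seq_code [:: b, c & s]; a]%N) (conj (IH isT h) I)) => [|[]].
Qed.

Lemma list_facts_val M g (R : comNzRingType) (f : nat -> R) l : list_facts M ->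
  good_val f -> (forall a b, M (fE g a b) -> f a = f b) ->
  f (npol l) = evi (f nX) (lpoly l).
Proof.
move=> HL gf fP; elim/seq_code_ind: l => [|k l IH].
  by rewrite (fP _ _ (lf_0 HL g)) (gv0 gf) lpoly0 rmorph0.
rewrite (fP _ _ (lf_S HL g k l)) (gvD gf) (gvM gf) (gvnum gf) IH lpoly_cons.
by rewrite rmorphD rmorphM /= eviC eviX.
Qed.

Definition is_mon l := lpoly l \is monic /\ (1 < size (lpoly l))%N.

Lemma list_rules_ok (M : nat -> Prop) :
  (forall g, exists (I : Type) (D : I -> Prop) (R : comNzRingType) (f : I -> nat -> R),
     [/\ forall i, good_val (f i), forall i l, f i (npol l) = evi (f i nX) (lpoly l) &
         forall a b, M (fE g a b) <-> forall i, D i -> f i a = f i b]) ->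
  (forall l, M (fMon l) <-> is_mon l) -> Pall (rule_ok M) list_rules.
Proof.
move=> H MM; do ![split]; move=> e /=.
- move=> _; left; have [I [D [R [f [gf fpol ME]]]]] := H (e 0%N).
  apply: (ME (npol 0) nzero).2 => i _.
  by rewrite fpol (gv0 (gf i)) lpoly0 rmorph0.
- move=> _; left; have [I [D [R [f [gf fpol ME]]]]] := H (e 0%N).
  apply/ME => i _; rewrite (gvD (gf i)) (gvM (gf i)) (gvnum (gf i)).
  by rewrite !fpol lpoly_cons rmorphD rmorphM /= eviC eviX.
- move=> _; left; apply/MM; rewrite /is_mon lpoly_cons lpoly_cons lpoly0 mulr0 addr0 mulr1.
  by rewrite addrC monicE lead_coefXaddC size_XaddC.
- case=> /MM[m s] _; left; apply/MM; rewrite /is_mon lpoly_cons addrC mulrC.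
  have l0 : lpoly (e 1%N) != 0 by rewrite -size_poly_gt0 ltnW.
  have ks : (size (Posz (e 2%N))%:P%R < size (lpoly (e 1%N) * 'X)%R)%N.
    rewrite size_mulX // size_polyC; apply: leq_ltn_trans (leq_b1 _) _.
    by rewrite ltnS ltnW.
  rewrite monicE lead_coefDl //.
  rewrite lead_coefMX -monicE; split=> //.
  by rewrite size_MXaddC (negPf l0) /= ltnS ltnW.
Qed.

(** Introduction rules, dual to the elimination rules above. In the context [PP l s], X is a root of
    [l] in characteristic [p] and each variable listed in [s] is a polynomial in X. An inequation is
    certified by an inverse of the difference, so it persists in every nonzero ring satisfying the
    context. The last rule forbids a certificate for the input. *)
Definition certified_rules p : seq rule :=
  let g := PV 0 in let a := PV 1 in let b := PV 2 in let c := PV 3 in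
  let l := PV 4 in let s := PV 5 in let i := PV 6 in
  let tr n := pfact 17 (PP g n) in let fa n := pfact 18 (PP g n) in
  let as_ s i a := pfact 20 (PP s (PP i a)) in
  [:: ([::], [:: as_ (PS (PP a s)) (PN 0) a]);
      ([:: as_ s i a], [:: as_ (PS (PP b s)) (PS i) a]);
      ([:: as_ s i a], [:: pE (PP l s) (PP (PN 0) i) (pPol a)]);
      ([::], [:: pE (PP l s) (pPol l) pZero]);
      ([::], [:: pE (PP l s) (pNum (PN p)) pZero]);
      ([:: pE g a b], [:: tr (PP (PN 0) (PP a b))]);
      ([:: fa a], [:: tr (PP (PN 1) a)]);
      ([:: tr a; tr b], [:: tr (PP (PN 2) (PP a b))]);
      ([:: tr a], [:: tr (PP (PN 3) (PP a b))]);
      ([:: tr b], [:: tr (PP (PN 3) (PP a b))]);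
      ([:: tr b], [:: tr (PP (PN 4) (PP a b))]);
      ([:: pE g (pM (pA a (pO b)) c) pOne], [:: fa (PP (PN 0) (PP a b))]);
      ([:: tr a], [:: fa (PP (PN 1) a)]);
      ([:: fa a], [:: fa (PP (PN 2) (PP a b))]);
      ([:: fa b], [:: fa (PP (PN 2) (PP a b))]);
      ([:: fa a; fa b], [:: fa (PP (PN 3) (PP a b))]);
      ([:: pfact 1 a; pfact 16 (PP (PN 0) a); pfact 19 l; pfact 17 (PP (PP l s) a)], [::])].

(* It has a model unless the input is certified to hold in every field of
   characteristic p containing roots of all monic integer polynomials. *)
Definition certificate_theory p : seq rule :=
  common_rules ++ syntax_rules ++ list_rules ++ certified_rules p.

(** A solution specializes to the algebraic closure of the prime field, where its coordinates are
    polynomials in one root of unity. All atomic facts then become identities modulo the minimal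
    polynomial and [p], hence hold in every ring satisfying the context and are facts of any
    model. *)
Lemma certificate_complete p n : prime p -> consistent (satisfiability_theory p) n ->
  ~ consistent (certificate_theory p) n.
Proof.
move=> p_pr /(satisfiability_field p_pr)[K [f [e [pK cE sf ef he]]]].
move=> [M [M0 /Pall_cat[/common_rulesP HM /Pall_cat[/syntax_rulesP HS]]]].
move=> /Pall_cat[/list_rulesP HL].
case=> A1 [A2 [A3 [A4 [A5 [T0 [T1 [T2 [T3 [T3' [T4 [F0 [F1 [F2 [F2' [F3 [Z _]]]]]]]]]]]]]]]] Mn.
have [L [pL L_fin]] := exists_closure p_pr.
have qf := matrix_qf ef.
have [y hy] := algebraic_solution pK pL qf he.
have [N HN] := bounded_list (free_vars (matrix_of f)).
have [th [l [u [lth lm [l1 llast] lmin yu]]]] := finite_parameter p_pr pL L_fin y N.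
pose s := seq_code (mkseq u N); pose g := cpair l s.
have Mas i t : (i < size t)%N -> M (fAs (seq_code t) i (nth 0%N t i)).
  elim: t i => [|x t IH] [|i] //= it.
    by case: (A1 (nth 0%N [:: 0; x; 0; 0; 0; seq_code t]%N) I) => [|[]].
  case: (A2 (nth 0%N [:: 0; nth 0 t i; x; 0; 0; seq_code t; i]%N) (conj (IH i it) I)) => [|[]] //.
have Mvar i : (i < N)%N -> M (fE g (nvar i) (npol (u i))).
  move=> iN; have := @Mas i (mkseq u N); rewrite size_mkseq nth_mkseq // => /(_ iN) m.
  by case: (A3 (nth 0%N [:: 0; u i; 0; 0; l; s; i]%N) (conj m I)) => [|[]].
have Ml : M (fE g (npol l) nzero).
  by case: (A4 (nth 0%N [:: 0; 0; 0; 0; l; s]%N) I) => [|[]].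
have Mp : M (fE g (nnum p) nzero).
  by case: (A5 (nth 0%N [:: 0; 0; 0; 0; l; s]%N) I) => [|[]].
have valE (R : comNzRingType) (v : nat -> R) (h : {poly int}) : good_val v ->
    (forall a b, M (fE g a b) -> v a = v b) -> evi th h = 0 -> evi (v nX) h = 0.
  move=> gv vP /lmin[h1 [h2 ->]].
  rewrite rmorphD !rmorphM /= -(list_facts_val l HL gv vP) (vP _ _ Ml) (gv0 gv) mul0r.
  by rewrite rmorph_nat -(gvnum gv) (vP _ _ Mp) (gv0 gv) mul0r addr0.
pose G t := teval (fun i => lpoly (u i)) t.
have GE t : (forall i, i \in term_vars t -> (i < N)%N) -> evi th (G t) = teval y t.
  by move=> tN; rewrite -teval_morph; apply: teval_ext => i /tN /yu.
have valG (R : comNzRingType) (v : nat -> R) t : good_val v ->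
    (forall a b, M (fE g a b) -> v a = v b) ->
    (forall i, i \in term_vars t -> (i < N)%N) -> v (term_code t) = evi (v nX) (G t).
  move=> gv vP tN; rewrite (good_val_teval _ gv) -teval_morph; apply: teval_ext => i /tN iN.
  by rewrite (vP _ _ (Mvar _ iN)) (list_facts_val _ HL gv vP).
have H h : quantifier_free h -> {subset free_vars h <= free_vars (matrix_of f)} ->
    (holds y h -> M (fTr g (formula_code h))) /\
    (~ holds y h -> M (fFa g (formula_code h))).
  elim: h => [t t'|h IH|h IH h' IH'|h IH h' IH'|i h IH|i h IH] //=.
  - move=> _ /subset_catP[st st'].
    have tN : forall i, i \in term_vars t -> (i < N)%N by move=> i /st/HN.
    have tN' : forall i, i \in term_vars t' -> (i < N)%N by move=> i /st'/HN.
    split=> ht.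
      have m : M (fE g (term_code t) (term_code t')).
        apply: (model_eqP HM) => R v gv vP; rewrite !valG //; apply/eqP.
        rewrite -subr_eq0 -rmorphB; apply/eqP/valE => //.
        by rewrite rmorphB /= !GE // ht subrr.
      by case: (T0 (nth 0%N [:: g; term_code t; term_code t']%N) (conj m I)) => [|[]].
    (* A nonzero difference is invertible in the finite field, and its inverse is again a polynomial
       in [th]. *)
    have [|W WE] := evi_inverse p_pr L_fin (th := th) (G := G t - G t').
      by rewrite rmorphB /= !GE // subr_eq0; apply/eqP.
    have m : M (fE g (nmul (nadd (term_code t) (nopp (term_code t'))) (tpoly W nX)) none).
      apply: (model_eqP HM) => R v gv vP; rewrite (gvM gv) (gvD gv) (gvN gv) (gv1 gv).
      rewrite !valG // tpoly_val //; apply/eqP.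
      rewrite -subr_eq0 -rmorphB -rmorphM -(rmorph1 (evi (v nX))) -rmorphB.
      by apply/eqP/valE => //; rewrite rmorphB rmorph1 [X in X - _]WE subrr.
    by case: (F0 (nth 0%N [:: g; term_code t; term_code t'; tpoly W nX]%N) (conj m I)) => [|[]].
  - move=> /IH{}IH /IH[IHt IHf]; split=> hh.
      by case: (T1 (nth 0%N [:: g; formula_code h]%N) (conj (IHf hh) I)) => [|[]].
    by case: (F1 (nth 0%N [:: g; formula_code h]%N) (conj (IHt (contrapT hh)) I)) => [|[]].
  - move=> /andP[/IH{}IH /IH'{}IH'] /subset_catP[/IH[IHt IHf] /IH'[IHt' IHf']].
    pose w := nth 0%N [:: g; formula_code h; formula_code h']%N; split.
      by case=> /IHt m /IHt' m'; case: (T2 w (conj m (conj m' I))) => [|[]].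
    move=> /not_andP[/IHf m|/IHf' m]; first by case: (F2 w (conj m I)) => [|[]].
    by case: (F2' w (conj m I)) => [|[]].
  - move=> /andP[/IH{}IH /IH'{}IH'] /subset_catP[/IH[IHt IHf] /IH'[IHt' IHf']].
    pose w := nth 0%N [:: g; formula_code h; formula_code h']%N; split.
      case=> [/IHt m|/IHt' m]; first by case: (T3 w (conj m I)) => [|[]].
      by case: (T3' w (conj m I)) => [|[]].
    by move=> /not_orP[/IHf m /IHf' m']; case: (F3 w (conj m (conj m' I))) => [|[]].
have trf : M (fTr g (formula_code f)).
  have {H} := (H _ qf (fun i h => h)).1 hy.
  elim: f ef {cE sf he qf hy HN} => [t t'|h _|h _ h' _|h _ h' _|i h IH|i h _] //= eh /(IH eh) m.
  by case: (T4 (nth 0%N [:: g; i; formula_code h]%N) (conj m I)) => [|[]].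
have m1 : M (fEf 0 n) by apply/(sf_ef HS)/is_ef0; exists f.
have m2 : M (fMon l) by rewrite -(sdecK l); apply: (lf_mon HL).
rewrite cE in trf.
by case: (Z (nth 0%N [:: 0; n; 0; 0; l; s]%N) (conj Mn (conj m1 (conj m2 (conj trf I))))).
Qed.

Section CertificateSound.

Variables (p : nat) (k : fieldType).
Hypotheses (pk : p \in [pchar k])
  (k_roots : forall m : {poly int}, m \is monic -> (1 < size m)%N ->
     exists x : k, evi x m = 0).

(** Facts in a context are interpreted as truth at all roots of [l] in [k] with the assignment
    prescribed by [s]. If the last rule fired, a root in [k] of the monic polynomial would turn the
    certificate into a solution in [k]. *)
Lemma certificate_sound n : ~ codes formula_code (existential_theory k) n ->
  consistent (certificate_theory p) n.
Proof.
move=> nS.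
pose v (i : k * (nat -> k)) := nval (fun=> 0) i.2 (fun l => evi i.1 (lpoly l)) i.1 0.
pose D g (i : k * (nat -> k)) := evi i.1 (lpoly (c1 g)) = 0 /\
  forall j, (j < size (sdec (c2 g)))%N -> i.2 j = evi i.1 (lpoly (nth 0%N (sdec (c2 g)) j)).
have gv i : good_val (v i) by apply: nval_good.
pose X t y := match t with
  | 1 => y = n
  | 17 => forall i, D (c1 y) i -> forall h, formula_code h = c2 y -> existential h ->
      holds i.2 (matrix_of h)
  | 18 => forall i, D (c1 y) i -> forall h, formula_code h = c2 y -> quantifier_free h ->
      ~ holds i.2 h
  | 19 => is_mon y
  | 20 => (c1 (c2 y) < size (sdec (c1 y)))%N /\ c2 (c2 y) = nth 0%N (sdec (c1 y)) (c1 (c2 y))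
  | _ => False end.
pose M := base_fact (fun g a b => forall i, D g i -> v i a = v i b) X.
have ME g a b : M (fE g a b) <-> forall i, D g i -> v i a = v i b by rewrite /M base_fE.
have vt i t : v i (term_code t) = teval i.2 t.
  by rewrite (good_val_teval _ (gv i)); congr teval; apply/funext => j; rewrite /v nval_var.
have MT g m : M (fTr g m) <-> forall i, D g i -> forall h, formula_code h = m ->
    existential h -> holds i.2 (matrix_of h).
  by rewrite /M /base_fact !(c1K, c2K) /= c1K c2K.
have MF g m : M (fFa g m) <-> forall i, D g i -> forall h, formula_code h = m ->
    quantifier_free h -> ~ holds i.2 h.
  by rewrite /M /base_fact !(c1K, c2K) /= c1K c2K.
have MI m : M (fIn m) <-> m = n by rewrite /M /base_fact !(c1K, c2K).
have MM l : M (fMon l) <-> is_mon l by rewrite /M /base_fact !(c1K, c2K).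
have MA s i a : M (fAs s i a) <-> (i < size (sdec s))%N /\ a = nth 0%N (sdec s) i.
  by rewrite /M /base_fact !(c1K, c2K) /= !(c1K, c2K).
exists M; last exact/MI.
split; first by [].
do ![apply/Pall_cat; split].
- apply/common_rulesP/base_common => g; exists (k * (nat -> k))%type, (D g), k, v.
  by split.
- exact/syntax_rules_ok/base_syntax.
- apply: list_rules_ok => // g; exists (k * (nat -> k))%type, (D g), k, v.
  by split=> // i l; rewrite /v nval_pol nvalX.
do ![split]; move=> e /=.
- by move=> _; left; apply/MA; rewrite sdecS.
- by case=> /MA[h h'] _; left; apply/MA; rewrite sdecS.
- case=> /MA[h ->] _; left; apply/ME => i [_ Di]; rewrite /v nval_var nval_pol.
  by move: Di; rewrite c2K; apply.
- move=> _; left; apply/ME => i [Di _]; rewrite [RHS](gv0 (gv i)) /v nval_pol.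
  by move: Di; rewrite c1K.
- by move=> _; left; apply/ME => i _; rewrite (gvnum (gv i)) (gv0 (gv i)) pcharf0.
- case=> /ME h _; left; apply/MT => i Di [t u|f|f f'|f f'|j f|j f] /=; invert_code => _.
  by move=> /cpair_inj[tE uE] _; rewrite -!vt tE uE h.
- case=> /MF h _; left; apply/MT => i Di [t u|f|f f'|f f'|j f|j f] /=; invert_code => _.
  by move=> fE qf; apply: h fE qf.
- case=> /MT h [/MT h' _]; left; apply/MT => i Di [t u|f|f f'|f f'|j f|j f] /=; invert_code => _.
  move=> /cpair_inj[fE fE'] /andP[q q'].
  by split; [rewrite -(matrix_id q)|rewrite -(matrix_id q')];
    [apply: h fE _ | apply: h' fE' _] => //; apply: existential_qf.
- case=> /MT h _; left; apply/MT => i Di [t u|f|f f'|f f'|j f|j f] /=; invert_code => _.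
  move=> /cpair_inj[fE fE'] /andP[q q']; left; rewrite -(matrix_id q).
  by apply: h fE _ => //; apply: existential_qf.
- case=> /MT h _; left; apply/MT => i Di [t u|f|f f'|f f'|j f|j f] /=; invert_code => _.
  move=> /cpair_inj[fE fE'] /andP[q q']; right; rewrite -(matrix_id q').
  by apply: h fE' _ => //; apply: existential_qf.
- case=> /MT h _; left; apply/MT => i Di [t u|f|f f'|f f'|j f|j f] /=; invert_code => _.
  by move=> /cpair_inj[_ fE] ef; apply: h fE ef.
- case=> /ME h _; left; apply/MF => i Di [t u|f|f f'|f f'|j f|j f] /=; invert_code => _.
  move=> /cpair_inj[tE uE] _ E; have := h i Di; rewrite (gvM (gv i)) (gvD (gv i)) (gvN (gv i)).
  by rewrite (gv1 (gv i)) -tE -uE !vt E subrr mul0r => /esym/eqP; rewrite oner_eq0.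
- case=> /MT h _; left; apply/MF => i Di [t u|f|f f'|f f'|j f|j f] /=; invert_code => _.
  move=> fE qf; apply; rewrite -(matrix_id qf).
  by apply: h fE _ => //; apply: existential_qf.
- case=> /MF h _; left; apply/MF => i Di [t u|f|f f'|f f'|j f|j f] /=; invert_code => _.
  by move=> /cpair_inj[fE _] /andP[q q'] [hf _]; apply: (h i Di f).
- case=> /MF h _; left; apply/MF => i Di [t u|f|f f'|f f'|j f|j f] /=; invert_code => _.
  by move=> /cpair_inj[_ fE] /andP[q q'] [_ hf]; apply: (h i Di f').
- case=> /MF h [/MF h' _]; left; apply/MF => i Di [t u|f|f f'|f f'|j f|j f] /=; invert_code => _.
  move=> /cpair_inj[fE fE'] /andP[q q'] [hf|hf]; first exact: (h i Di f).
  exact: (h' i Di f').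
- case=> /MI -> [/(sf_ef (base_syntax _ _))/is_ef0[f fE [sf ef]] [/MM[lm l1] [/MT h _]]].
  have [x x0] := k_roots lm l1; apply: nS; exists f => //; split=> //.
  pose a j := evi x (lpoly (nth 0%N (sdec (e 5%N)) j)).
  apply: (matrix_holds (e := a)) => //; first by move=> i; rewrite (nilP sf).
  by apply: (h (x, a)) => //; split; rewrite ?c1K ?c2K.
Qed.

End CertificateSound.

(** A circle of implications: truth in [k] makes the first theory consistent, this makes the second
    one inconsistent, and this in turn gives truth in [k]. *)
Lemma decidable_existential_theory p (k : fieldType) : prime p -> p \in [pchar k] ->
  (forall m : {poly int}, m \is monic -> (1 < size m)%N -> exists x : k, evi x m = 0) ->
  decidable_set (codes formula_code (existential_theory k)).
Proof.
move=> p_pr pk k_roots.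
have A1 n := @satisfiability_consistent p k pk n.
have A2 n := @certificate_complete p n p_pr.
have A3 n := @certificate_sound p k pk k_roots n.
apply: (@decidable_of_theories (satisfiability_theory p) (certificate_theory p)) => n.
  split=> [/A1 //|/A2 h]; apply: contrapT => /A3; exact: h.
split=> [/A1/A2 //|h]; apply: contrapT => /A3; exact: h.
Qed.

(** * Recognizing codes of rational polynomials *)

Definition fAdd a b c := cpair 21 (cpair a (cpair b c)).
Definition fCop a b := cpair 22 (cpair a b).
Definition fRt r := cpair 23 r.
Definition fPl n := cpair 24 n.

(** Coprimality, needed to recognize fractions in lowest terms, follows the subtractive Euclidean
    algorithm in both directions. As with formulas, introduction and inversion rules together pin
    down which numbers are codes. *)
Definition poly_rules : seq rule :=
  let add a b c := pfact 21 (PP a (PP b c)) in let cop a b := pfact 22 (PP a b) in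
  let rt r := pfact 23 r in let pl n := pfact 24 n in
  let dbl a k := pfact 3 (PP a k) in
  let a := PV 0 in let b := PV 1 in let c := PV 2 in let d := PV 3 in
  [:: ([::], [:: add a (PN 0) a]);
      ([:: add a b c], [:: add a (PS b) (PS c)]);
      ([::], [:: cop (PN 0) (PN 1)]);
      ([:: cop a b; add a b c], [:: cop a c]);
      ([:: cop a c; add a b c], [:: cop a b]);
      ([:: cop a b], [:: cop b a]);
      ([:: cop (PN 0) (PN 0)], [::]);
      ([:: cop (PN 0) (PS (PS b))], [::]);
      ([:: dbl a b; cop b (PS d)], [:: rt (PP a (PS d))]);
      ([:: dbl a b; cop (PS b) (PS d)], [:: rt (PP (PS a) (PS d))]);
      ([:: rt (PP a (PN 0))], [::]);
      ([:: rt (PP a (PS d)); dbl a b], [:: cop b (PS d)]);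
      ([:: rt (PP (PS a) (PS d)); dbl a b], [:: cop (PS b) (PS d)]);
      ([::], [:: pl (PN 0)]);
      ([:: rt (PP (PS a) d)], [:: pl (PS (PP (PP (PS a) d) (PN 0)))]);
      ([:: rt a; pl (PS b)], [:: pl (PS (PP a (PS b)))]);
      ([:: pl (PS (PP a b))], [:: rt a]);
      ([:: pl (PS (PP (PP (PN 0) d) (PN 0)))], [::]);
      ([:: pl (PS (PP a (PS b)))], [:: pl (PS b)])].

Definition is_rat r := (0 < c2 r)%N && coprime `|idec (c1 r)| (c2 r).

(** The default [cpair 1 0] lets the empty list, the code of the zero polynomial, pass the test for
    a nonzero leading coefficient. *)
Definition is_poly n :=
  all is_rat (sdec n) /\ c1 (last (cpair 1 0) (sdec n)) != 0%N.

Record poly_facts (M : nat -> Prop) : Prop := PolyFacts {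
  pf_add : forall a b, M (fAdd a b (a + b)%N);
  pf_cop : forall a b, M (fCop a b) <-> coprime a b;
  pf_rt : forall r, M (fRt r) <-> is_rat r;
  pf_pl : forall n, M (fPl n) <-> is_poly n
}.

Lemma idec_double a : idec a.*2 = a. 
Proof. by rewrite /idec odd_double doubleK. Qed.

Lemma absz_idec_odd a : `|idec a.*2.+1|%N = a.+1.
Proof. by rewrite /idec /= odd_double uphalf_double. Qed.

Lemma is_poly_cons r n : is_poly (cpair r n.+1).+1 <-> is_rat r /\ is_poly n.+1.
Proof.
rewrite /is_poly sdecS -(cpair_unpair n) sdecS /=.
by split=> [[/and3P[-> -> ->] ->]|[-> [/andP[-> ->] ->]]].
Qed.

Lemma poly_rules_ok M : (forall a b c, M (fAdd a b c) <-> (a + b)%N = c) ->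
  (forall a k, M (fD a k) <-> a = k.*2) -> poly_facts M -> Pall (rule_ok M) poly_rules.
Proof.
move=> MA MD [_ MC MR MP]; do ![split]; move=> e /=.
- by move=> _; left; apply/MA; rewrite addn0.
- by case=> /MA <- _; left; apply/MA; rewrite addnS.
- by move=> _; left; apply: (MC 0%N 1%N).2.
- by case=> /MC h [/MA <- _]; left; apply/MC; rewrite /coprime gcdnDl.
- by case=> /MC h [/MA E _]; left; apply/MC; move: h; rewrite -E /coprime gcdnDl.
- by case=> /MC h _; left; apply/MC; rewrite coprime_sym.
- by case=> /MC.
- by case=> /MC.
- case=> /MD E [/MC h _]; left; apply/MR.
  by rewrite /is_rat c1K c2K E idec_double.
- case=> /MD E [/MC h _]; left; apply/MR.
  by rewrite /is_rat c1K c2K E absz_idec_odd.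
- by case=> /MR; rewrite /is_rat c2K.
- case=> /MR h [/MD E _]; left; apply/MC; move: h.
  by rewrite /is_rat c1K c2K E idec_double.
- case=> /MR h [/MD E _]; left; apply/MC; move: h.
  by rewrite /is_rat c1K c2K E absz_idec_odd.
- by move=> _; left; apply: (MP 0%N).2; rewrite /is_poly /= c1K.
- by case=> /MR h _; left; apply/MP; rewrite /is_poly sdecS sdec0 /= h !c1K.
- by case=> /MR h [/MP h' _]; left; apply/MP/is_poly_cons.
- by case=> /MP; rewrite /is_poly sdecS /= => -[/andP[h _] _] _; left; apply/MR.
- by case=> /MP; rewrite /is_poly sdecS sdec0 /= !c1K => -[].
- by case=> /MP/is_poly_cons[_ h] _; left; apply/MP.
Qed.

Lemma poly_rulesP M : common_facts M -> Pall (rule_ok M) poly_rules -> poly_facts M.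
Proof.
move=> HM; case=> A1 [A2 [C1 [C2 [C3 [C4 [C5 [C6 [R1 [R2 [R3 [R4 [R5]]]]]]]]]]]].
case=> P1 [P2 [P3 [P4 [P5 [P6 _]]]]].
have MA a b : M (fAdd a b (a + b)%N).
  elim: b => [|b IH]; first by rewrite addn0; case: (A1 (nth 0%N [:: a]) I) => [|[]].
  by rewrite addnS; case: (A2 (nth 0%N [:: a; b; a + b]%N) (conj IH I)) => [|[]].
have sym a b : M (fCop a b) -> M (fCop b a).
  by move=> h; case: (C4 (nth 0%N [:: a; b]%N) (conj h I)) => [|[]].
have MC a b : M (fCop a b) <-> coprime a b.
  (* Induction on the sum, which the subtractive Euclidean step lowers; the symmetry rule allows
     assuming [a <= b]. *)
  have [n ab] : exists n, (a + b < n)%N by exists (a + b).+1.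
  elim: n a b ab => // n IH a b; wlog ab : a b / (a <= b)%N.
    move=> H; case: (leqP a b) => [/H //|/ltnW ba] h.
    rewrite coprime_sym; rewrite addnC in h.
    by split=> [/sym|] /(H _ _ ba h) // /sym.
  move=> abn; case: a ab abn => [|a] ab abn.
    rewrite /coprime gcd0n; case: b {ab abn} => [|[|b]].
    - by split=> // h; case: (C5 (nth 0%N [::]) (conj h I)).
    - by split=> // _; case: (C1 (nth 0%N [::]) I) => [|[]].
    - by split=> // h; case: (C6 (nth 0%N [:: 0; b]%N) (conj h I)).
  have abn' : (a.+1 + (b - a.+1) < n)%N by move: ab abn; lia.
  have m := MA a.+1 (b - a.+1)%N.
  rewrite -{2}(subnKC ab) /coprime gcdnDl -[_ == 1%N]/(coprime _ _) -(IH _ _ abn').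
  rewrite subnKC // in m; split=> h.
    by case: (C3 (nth 0%N [:: a.+1; b - a.+1; b]%N) (conj h (conj m I))) => [|[]].
  by case: (C2 (nth 0%N [:: a.+1; b - a.+1; b]%N) (conj h (conj m I))) => [|[]].
have MR r : M (fRt r) <-> is_rat r.
  rewrite /is_rat -{1}(cpair_unpair r); move: (c1 r) (c2 r) => z [|d] /=.
    by split=> // h; case: (R3 (nth 0%N [:: z]) (conj h I)).
  rewrite -(odd_double_half z); case: (odd z); move: (z./2) => k.
    rewrite add1n absz_idec_odd -MC; have m := model_double HM k; split=> h.
      by case: (R5 (nth 0%N [:: k.*2; k; 0; d]%N) (conj h (conj m I))) => [|[]].
    by case: (R2 (nth 0%N [:: k.*2; k; 0; d]%N) (conj m (conj h I))) => [|[]].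
  rewrite add0n idec_double -MC; have m := model_double HM k; split=> h.
    by case: (R4 (nth 0%N [:: k.*2; k; 0; d]%N) (conj h (conj m I))) => [|[]].
  by case: (R1 (nth 0%N [:: k.*2; k; 0; d]%N) (conj m (conj h I))) => [|[]].
split=> //; elim/seq_code_ind => [|r [|m] IH].
- split=> _; first by rewrite /is_poly /= c1K.
  by case: (P1 (nth 0%N [::]) I) => [|[]].
- rewrite /is_poly sdecS sdec0 /= andbT -MR -{1 2 3}(cpair_unpair r).
  move: (c1 r) (c2 r) => [|z] d; rewrite c1K.
    by split=> [h|[]] //; case: (P5 (nth 0%N [:: 0; 0; 0; d]%N) (conj h I)).
  split=> [h|[h _]].
    by case: (P4 (nth 0%N [:: cpair z.+1 d; 0]%N) (conj h I)) => [|[]].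
  by case: (P2 (nth 0%N [:: z; 0; 0; d]%N) (conj h I)) => [|[]].
- rewrite is_poly_cons -IH -MR; split=> [h|[h h']].
    split; first by case: (P4 (nth 0%N [:: r; m.+1]%N) (conj h I)) => [|[]].
    by case: (P6 (nth 0%N [:: r; m]%N) (conj h I)) => [|[]].
  by case: (P3 (nth 0%N [:: r; m]%N) (conj h (conj h' I))) => [|[]].
Qed.

Lemma is_ratP r : is_rat r <-> exists q, rat_code q = r.
Proof.
rewrite /is_rat; split=> [/andP[d0 cop]|[q <-]].
  have idecK z : int_code (idec z) = z.
    rewrite /idec -[RHS]odd_double_half; case: (odd z) => //=.
  exists ((idec (c1 r))%:~R / (c2 r)%:Z%:~R); rewrite /rat_code.
  rewrite coprimeq_num // coprimeq_den // gtr0_sg ?ltz_nat // mul1r eqz_nat.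
  by rewrite (gtn_eqF d0) idecK /= cpair_unpair.
rewrite /rat_code c1K c2K int_codeK absz_gt0 denq_neq0.
exact: coprime_num_den.
Qed.

Lemma is_polyP n : is_poly n <-> exists P, poly_code P = n.
Proof.
have c10 : c1 (rat_code 1) != 0%N by rewrite /rat_code c1K.
split=> [[sr sl]|[P <-]].
  have [s sE] : exists s, map rat_code s = sdec n.
    elim: (sdec n) sr {sl} => [|r l IH] /=; first by exists [::].
    by case/andP=> /is_ratP[q <-] /IH[s <-]; exists (q :: s).
  exists (Poly s); rewrite /poly_code (@PolyK _ 1); first by rewrite sE sdecK.
  case: s sE => [|q s] sE; first exact: oner_neq0.
  move: sl; rewrite -sE /= last_map; apply: contraNneq => ->.
  by rewrite /rat_code c1K.
rewrite /is_poly /poly_code seq_codeK; split.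
  by apply/allP => r /mapP[q _ ->]; apply/is_ratP; exists q.
case E: (polyseq P) => [|q s] /=; first by rewrite c1K.
rewrite last_map /rat_code c1K; have := valP P; rewrite /= E /=.
rewrite -numq_eq0; case: (numq _) => [[|m]|m] //.
Qed.

(** * Unramified extensions of the rationals *)

Definition fO a := cpair 25 a.

(** Every nonzero element has an integral inverse or an integral quotient by [p]: this makes [p] a
    uniformizer. All variables are identified and spare codes get fixed values, so that one element
    generates the field; for the zero polynomial this element is set to 0 to keep it algebraic. *)
Definition unramified_rules p : seq rule :=
  let a := PV 0 in let b := PV 1 in let i := PV 2 in let c := PV 3 in
  let t := PV 4 in let d := PV 5 in
  let eq a b := pE (PN 0) a b in let O a := pfact 25 a in
  let inv a := PP (PN 6) a in let v0 := PP (PN 0) (PN 0) in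
  [:: ([::], [:: O pOne]);
      ([:: O a; O b], [:: O (pA a (pO b))]);
      ([:: O a; O b], [:: O (pM a b)]);
      ([:: eq a b; O a], [:: O b]);
      ([::], [:: eq a pZero; O (inv a); O (pM a (inv (pNum (PN p))))]);
      ([:: O (inv (pNum (PN p)))], [::]);
      ([:: eq (pNum (PN p)) pZero], [::]);
      ([::], [:: eq (PP (PN 0) i) v0]);
      ([::], [:: eq (PP (PN 1) i) pZero]);
      ([::], [:: eq (PP (PN 2) i) pOne]);
      ([::], [:: eq (PP (PS (PS (PS (PS (PS (PS (PS (PS (PS b))))))))) i) pZero]);
      ([:: pfact 1 (PN 0)], [:: eq v0 pZero]);
      ([:: pfact 1 a], [:: pfact 24 a]);
      ([:: pfact 1 a; pfact 4 (PP a (PP v0 (PP pOne (PP c (PP t d)))))], [:: eq t pZero])].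

(* Its models are the fields generated by a zero of the input with a valuation
   for which p is a uniformizer. *)
Definition unramified_theory p : seq rule :=
  common_rules ++ poly_rules ++ inverse_rules ++ unramified_rules p.

Lemma pchar0_int (K : fieldType) : [pchar K] =i pred0 -> forall z : int, z%:~R = 0 :> K -> z = 0.
Proof.
move=> cK; have nK m : m.+1%:R = 0 :> K -> False.
  by move=> /eqP /natf0_pchar[] // q; rewrite cK.
case=> [[|m]|m] //; first by rewrite -pmulrn => /nK.
by rewrite NegzE rmorphN /= -pmulrn => /eqP; rewrite oppr_eq0 => /eqP/nK.
Qed.

(** If the integer numerator vanished, every natural number would be a root of [P]. *)
Lemma hint_neq0 (P : {poly rat}) : P != 0 -> (hint (map rat_code P) 1).1.2 != 0.
Proof.
apply: contra_neq => h0; apply: (@roots_geq_poly_eq0 _ _ (map (fun i => i%:R) (iota 0 (size P)))).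
- apply/allP => _ /mapP[i _ ->].
  have rE : map_poly ratr P = P.
    by apply: map_poly_id => x _; rewrite /ratr divq_num_den.
  have rat0 (z : int) : z%:~R = 0 :> rat -> z = 0.
    by move=> /eqP; rewrite intr_eq0 => /eqP.
  have [h _] := @hint_root rat P 1 i%:R rat0 (oner_neq0 _).
  by move: h; rewrite h0 rmorph0 divr1 rE; apply.
- rewrite map_inj_uniq ?iota_uniq // => i j /eqP; rewrite eqr_nat => /eqP //.
- by rewrite size_map size_iota.
Qed.

Section UnramifiedConsistent.

Variables (p : nat) (E : fieldType) (v : discrete_valuation E) (pi c : E).
Hypotheses (p_pr : prime p) (vp : v p%:R = p%:Z) (p0 : p%:R != 0 :> E)
  (vpi : v pi = 1) (piE : pi ^+ p = p%:R * (1 - c * pi)) (c_ge0 : dval_ge v 0 c)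
  (c_trans : forall N, (0 < N)%N -> ~~ dval_ge v 1 (c ^+ (p ^ N) - c)).

(** Terms take values in [E] itself, but all of them lie in the subfield generated by [al], where no
    valuation is strictly between 0 and that of [p]; this is exactly the disjunctive rule on
    integrality. *)
Lemma unramified_consistent n : codes poly_code (has_zero E) n ->
  consistent (unramified_theory p) n.
Proof.
move=> [P Pz Pn]; have E0 := pchar0_int (field_pchar0 p_pr (dval_ge1_p p_pr vp) p0).
have [al [Q [Q0 Qal Pal al0]]] : exists (al : E) (Q : {poly int}), [/\ Q != 0,
    evi al Q = 0, root (map_poly ratr P) al & P = 0 -> al = 0].
  (* Every element is a zero of the zero polynomial; 0 is chosen, as the rule for the input 0
     demands. *)
  have [P0|P0] := eqVneq P 0.
    exists 0, 'X; rewrite polyX_eq0 eviX P0; split=> //.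
    by rewrite map_polyE /= polyseq0 /= rootE horner0.
  have [b Pb] := Pz; exists b, (hint (map rat_code P) 1).1.2.
  split=> //; [exact: hint_neq0 | | by move=> P0'; rewrite P0' eqxx in P0].
  by apply/(hint_root P b E0) => //; rewrite divr1.
pose f := nval (fun x => x^-1) (fun=> al) (fun=> 0) 0 (0 : E).
have gf : good_val f by apply: nval_good.
have f_inv a : f (ninv a) = (f a)^-1 by rewrite /f nval_inv.
have sal : simple_ext al al by exists 'X, 1; rewrite eviX rmorph1 oner_neq0 divr1.
have s0 : simple_ext al 0 by apply: (simple_ext_nat al 0).
have sN s : simple_ext al s -> simple_ext al (- s).
  by move=> h; rewrite -[- s]sub0r; apply: simple_extB.
have sf a : simple_ext al (f a).
  elim/ltn_ind: a => a IH; rewrite /f nvalE -/f.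
  have lt2 := @c2_ltn a.
  have l1 : (0 < c1 a)%N -> (c1 (c2 a) < a)%N by move=> /lt2; apply: leq_ltn_trans; apply: c1_le.
  have l2 : (0 < c1 a)%N -> (c2 (c2 a) < a)%N by move=> /lt2; apply: leq_ltn_trans; apply: c2_le.
  case: (c1 a) lt2 l1 l2 => [|[|[|[|[|[|[|[|[|[|[|[|k]]]]]]]]]]]] // lt2 l1 l2.
  - exact: (simple_ext_nat al 1).
  - rewrite -[X in _ + X]opprK; apply: simple_extB; first exact/IH/l1.
    exact/sN/IH/l2.
  - exact/sN/IH/lt2.
  - by apply: simple_extM; apply: IH; [apply: l1|apply: l2].
  - exact/simple_extV/IH/lt2.
  - exact: simple_ext_nat.
  - case: (idec _) => m; first exact: simple_ext_nat.
    by rewrite NegzE rmorphN; apply: sN; apply: simple_ext_nat.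
have f_var i : f (nvar i) = al by rewrite /f nval_var.
have f_junk i : [/\ f (cpair 1 i) = 0, f (cpair 2 i) = 1 &
    forall k, f (cpair k.+1.+4.+4 i) = 0].
  by rewrite /f; split=> [||[|[|[|k]]]]; rewrite nvalE c1K.
clearbody f.
pose X t y := match t with
  | 1 => y = n
  | 21 => (c1 y + c1 (c2 y))%N = c2 (c2 y)
  | 22 => coprime (c1 y) (c2 y)
  | 23 => is_rat y
  | 24 => is_poly y
  | 25 => dval_ge v 0 (f y)
  | _ => False end.
pose M := base_fact (fun _ a b => f a = f b) X.
have ME g a b : M (fE g a b) <-> f a = f b by rewrite /M base_fE.
have MO a : M (fO a) <-> dval_ge v 0 (f a) by rewrite /M /base_fact !(c1K, c2K).
have MI m : M (fIn m) <-> m = n by rewrite /M /base_fact !(c1K, c2K).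
have MP : poly_facts M.
  by split=> *; rewrite /M /base_fact !(c1K, c2K) /= ?(c1K, c2K).
have fp : f (nnum p) = p%:R by apply: gvnum gf p.
have MH s B C ctd : M (fH s B C ctd) -> ctd = hterm (sdec s) B C.
  rewrite /M /base_fact !(c1K, c2K) => ->; by case: ctd => [[]].
have M0 : M 0%N by [].
have Mcommon : Pall (rule_ok M) common_rules.
  apply/common_rulesP/base_common => g; exists unit, (fun=> True), E, (fun=> f).
  by split=> // a b; split=> [h _ _|/(_ tt I)].
have Mpoly : Pall (rule_ok M) poly_rules.
  by apply: poly_rules_ok => // *; rewrite /M /base_fact !(c1K, c2K) /= ?(c1K, c2K).
clearbody M.
exists M; last exact/MI.
split=> //; do ![apply/Pall_cat; split=> //]; first exact: (inverse_rules_ok gf).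
do ![split]; move=> e /=.
- by move=> _; left; apply: (MO none).2; rewrite (gv1 gf) dval_ge01.
- by case=> /MO h [/MO h' _]; left; apply/MO; rewrite (gvD gf) (gvN gf) dval_geB.
- by case=> /MO h [/MO h' _]; left; apply/MO; rewrite (gvM gf) dval_ge0M.
- by case=> /ME h [/MO h' _]; left; apply/MO; rewrite -h.
- move=> _; case: (eqVneq (f (e 0%N)) 0) => a0.
    by left; apply/ME; rewrite (gv0 gf).
  right; case: (simple_ext_unramified p_pr vp p0 vpi piE c_ge0 c_trans Q0 Qal (sf (e 0%N)) a0).
    by move=> h; left; apply/MO; rewrite f_inv /dval_ge dvalV // oppr_ge0 h orbT.
  move=> h; right; left; apply/MO; rewrite (gvM gf) f_inv [f (cpair 7 p)]fp.
  by rewrite /dval_ge dvalM ?invr_eq0 // dvalV // vp subr_ge0 h orbT.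
- case=> /MO; rewrite f_inv [f (cpair 7 p)]fp /dval_ge invr_eq0 (negPf p0) dvalV // vp.
  by rewrite oppr_ge0 lez_nat leqNgt prime_gt0.
- by case=> /ME; rewrite (gvnum gf) (gv0 gf) => /eqP; rewrite (negPf p0).
- by move=> _; left; apply/ME; rewrite [LHS]f_var [RHS](f_var 0%N).
- by move=> _; left; apply/ME; rewrite (gv0 gf); case: (f_junk (e 2%N)).
- by move=> _; left; apply/ME; rewrite (gv1 gf); case: (f_junk (e 2%N)).
- by move=> _; left; apply/ME; rewrite (gv0 gf); case: (f_junk (e 2%N)) => _ _ /(_ (e 1%N)).
- case=> /MI n0 _; left; apply: (ME 0%N (nvar 0) nzero).2; rewrite (gv0 gf) f_var; apply: al0.
  move: Pn; rewrite -n0 /poly_code; case PE: (polyseq P) => // _.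
  by apply/eqP; rewrite -size_poly_eq0 PE.
- by case=> /MI -> _; left; apply/(pf_pl MP)/is_polyP; exists P.
- case=> /MI -> [h _]; left; apply/ME; rewrite (gv0 gf).
  have := MH n (nvar 0) none (e 3%N, e 4%N, e 5%N) h; rewrite -Pn seq_codeK => hE.
  case: (@hterm_val _ f (map rat_code P) (nvar 0) none 1 gf); first by rewrite (gv1 gf).
  move=> _ + _; rewrite -hE /= f_var => ->.
  by apply/(hint_root P al E0) => //; rewrite divr1.
Qed.

End UnramifiedConsistent.

(** * The discrete valuation of a valuation ring in which p generates the maximal ideal *)

Section ValuationRing.

Variables (p : nat) (K : fieldType) (O : K -> Prop).
Hypotheses (p_pr : prime p) (O1 : O 1) (OB : forall x y, O x -> O y -> O (x - y))
  (OM : forall x y, O x -> O y -> O (x * y)) (p0 : p%:R != 0 :> K)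
  (O_dec : forall x, x = 0 \/ O x^-1 \/ O (x / p%:R)) (O_p : ~ O p%:R^-1).

Lemma O_0 : O 0. Proof. by rewrite -(subrr 1); apply: OB. Qed.

Lemma O_N x : O x -> O (- x).
Proof. by move=> h; rewrite -sub0r; apply: OB => //; apply: O_0. Qed.

Lemma O_D x y : O x -> O y -> O (x + y).
Proof. by move=> h h'; rewrite -[y]opprK; apply: OB => //; apply: O_N. Qed.

Lemma O_nat n : O n%:R.
Proof. by elim: n => [|n IH]; [apply: O_0 | rewrite mulrS; apply: O_D]. Qed.

Lemma O_int (z : int) : O z%:~R.
Proof.
by case: z => n; [apply: O_nat | rewrite NegzE rmorphN; apply: O_N; apply: O_nat].
Qed.

Lemma O_int_p (z : int) : O (z%:~R / p%:R) -> (p %| z)%Z.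
Proof.
move=> h; apply: contrapT => /negP npz; apply: O_p.
have [a [b ab]] := Bezoutz z p.
have {}ab : a * z + b * p = 1.
  rewrite ab /gcdz; congr Posz; apply/eqP; rewrite -/(coprime _ _).
  by rewrite coprime_sym prime_coprime.
have -> : p%:R^-1 = a%:~R * (z%:~R / p%:R) + b%:~R :> K.
  have := congr1 (fun z : int => z%:~R : K) ab.
  rewrite rmorphD !rmorphM rmorph1 /= -[(p : int)%:~R]pmulrn => abK.
  by apply: (mulIf p0); rewrite mulVf // mulrDl mulrA mulfVK.
by apply: O_D; [apply: OM => //|]; apply: O_int.
Qed.

Lemma O_int_eq0 (z : int) : (forall n, O (z%:~R / p%:R ^+ n)) -> z = 0.
Proof.
elim: {z}_.+1 {-2}z (ltnSn `|z|%N) => // m IH z zm H.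
have /dvdzP[z' zE] : (p %| z)%Z by apply: O_int_p; apply: H 1%N.
apply/eqP; apply: contrapT => /negP z0.
have z'0 : z' != 0 by apply: contraNneq z0 => z'0; rewrite zE z'0 mul0r.
case/eqP: z'0; apply: IH => [|n].
  move: zm z0; rewrite zE abszM absz_nat -absz_eq0 abszM absz_nat.
  by have := prime_gt1 p_pr; move: `|z'|%N; nia.
have := H n.+1; rewrite zE rmorphM /= -[(p : int)%:~R]pmulrn exprSr invfM.
by rewrite mulrACA divff // mulr1.
Qed.

Lemma O_char0 (z : int) : z%:~R = 0 :> K -> z = 0.
Proof. by move=> z0; apply: O_int_eq0 => n; rewrite z0 mul0r; apply: O_0. Qed.

Lemma O_evi x (f : {poly int}) : O x -> O (evi x f).
Proof.
move=> Ox; elim/poly_ind: f => [|f c IH]; first by rewrite rmorph0; apply: O_0.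
by rewrite rmorphD rmorphM /= eviC eviX; apply: O_D; [apply: OM | apply: O_int].
Qed.

(** The constant coefficient of a relation for [x] is an integral multiple of [x]. Were [x]
    divisible by all powers of [p], so would be this integer, which is then 0, and the relation can
    be divided by ['X]. Algebraicity thus makes the valuation discrete. *)
Lemma O_archimedean x (h : {poly int}) : h != 0 -> evi x h = 0 -> x != 0 ->
  exists n, ~ O (x / p%:R ^+ n).
Proof.
move=> h0 hx x0; apply: contrapT => /forallNP H.
have Hn n : O (x / p%:R ^+ n) := contrapT (H n).
have Ox : O x by have := Hn 0%N; rewrite expr0 divr1.
elim/poly_ind: h h0 hx => [|h c IH]; first by rewrite eqxx.
rewrite rmorphD rmorphM /= eviC eviX => hc0 /eqP; rewrite addr_eq0 => /eqP hE.
suff c0 : c = 0.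
  move: hE hc0; rewrite c0 oppr0 addr0 => /eqP; rewrite mulf_eq0 (negPf x0) orbF => /eqP hx.
  rewrite mulf_eq0 polyX_eq0 orbF => h0; exact: IH.
apply: O_int_eq0 => n; rewrite -[c%:~R]opprK -hE mulNr -mulrA.
by apply/O_N/OM => //; apply: O_evi.
Qed.

Lemma O_valuation :
  (forall x : K, exists2 h : {poly int}, h != 0 & evi x h = 0) ->
  exists2 v : discrete_valuation K, v p%:R = 1 & forall x, dval_ge v 0 x <-> O x.
Proof.
move=> alg; apply: exists_valuation => //; first exact: O_nat.
have dec x : x != 0 -> O x -> exists (z : int) u, [/\ x = p%:R ^ z * u, O u & O u^-1].
  move=> x0 Ox; have [h h0 hx] := alg x.
  have exn : exists n, `[< ~ O (x / p%:R ^+ n) >].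
    by have [n hn] := O_archimedean h0 hx x0; exists n; apply/asboolP.
  case: (ex_minnP exn) => -[/asboolP[]|n /asboolP hn nmin]; first by rewrite expr0 divr1.
  have Ou : O (x / p%:R ^+ n).
    by apply: contrapT => h'; have := nmin n; rewrite ltnn; case/implyP/negP; apply/asboolP.
  exists n, (x / p%:R ^+ n); split=> //.
    by rewrite -exprnP mulrCA divff ?mulr1 // expf_neq0.
  have u0 : x / p%:R ^+ n != 0 by rewrite mulf_neq0 // invr_eq0 expf_neq0.
  case: (O_dec (x / p%:R ^+ n)) => [/eqP|[//|h']]; first by rewrite (negPf u0).
  by case: hn; rewrite exprSr invfM mulrA.
move=> x x0; have xV0 : x^-1 != 0 by rewrite invr_eq0.
case: (pselect (O x)) => [/dec|nOx]; first exact.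
have OxV : O x^-1.
  case: (O_dec x) => [/eqP|[//|h]]; first by rewrite (negPf x0).
  by case: nOx; rewrite -[x](mulfVK p0); apply: OM => //; apply: O_nat.
have [z [u [xE Ou OuV]]] := dec _ xV0 OxV.
exists (- z), u^-1; rewrite invrK; split=> //.
by rewrite -[x]invrK xE invfM -invr_expz.
Qed.

End ValuationRing.

Lemma unramified_field p n : prime p -> consistent (unramified_theory p) n ->
  exists (K : fieldType) (v : discrete_valuation K) (P : {poly rat}) (al : K) (Q : {poly int}),
    [/\ poly_code P = n, v p%:R = 1, [pchar K] =i pred0,
        [/\ Q != 0, evi al Q = 0 & root (map_poly ratr P) al] &
        forall x, simple_ext al x].
Proof.
move=> p_pr [M [M0 /Pall_cat[/common_rulesP HM /Pall_cat[/(poly_rulesP HM) HP]]]].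
move=> /Pall_cat[/(inverse_field HM)[K [f [gf fV fs fP]]]].
case=> O1 [O2 [O3 [O4 [O5 [O6 [O7 [J0 [J1 [J2 [J9 [I0 [I1 [I2 _]]]]]]]]]]]]] Mn.
pose O x := exists2 a, f a = x & M (fO a).
have OP a : O (f a) -> M (fO a).
  move=> [b /fP ba Ob].
  by case: (O4 (nth 0%N [:: b; a]) (conj ba (conj Ob I))) => [|[]].
have fp : f (nnum p) = p%:R by apply: gvnum gf p.
have p0 : p%:R != 0 :> K.
  by apply/eqP; rewrite -fp -(gv0 gf) => /fP h; case: (O7 (nth 0%N [::]) (conj h I)).
have fpV : f (ninv (nnum p)) = p%:R^-1 by rewrite fV fp.
have O_1 : O 1 by exists none; [exact: gv1 | case: (O1 (nth 0%N [::]) I) => [|[]]].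
have O_B x y : O x -> O y -> O (x - y).
  move=> [a <- Oa] [b <- Ob]; exists (nadd a (nopp b)); first by rewrite (gvD gf) (gvN gf).
  by case: (O2 (nth 0%N [:: a; b]) (conj Oa (conj Ob I))) => [|[]].
have O_M x y : O x -> O y -> O (x * y).
  move=> [a <- Oa] [b <- Ob]; exists (nmul a b); first by rewrite (gvM gf).
  by case: (O3 (nth 0%N [:: a; b]) (conj Oa (conj Ob I))) => [|[]].
have O_dec x : x = 0 \/ O x^-1 \/ O (x / p%:R).
  have [a <-] := fs x; have [/eqP|a0] := boolP (f a == 0); first by left.
  right; case: (O5 (nth 0%N [:: a]) I) => [/fP|[h|[h|[]]]].
  - by rewrite (gv0 gf) => /eqP; rewrite (negPf a0).
  - by left; exists (ninv a); rewrite ?fV.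
  - by right; exists (nmul a (ninv (nnum p))); rewrite ?(gvM gf) ?fpV.
have O_p : ~ O p%:R^-1.
  by rewrite -fpV => /OP h; case: (O6 (nth 0%N [::]) (conj h I)).
have K0 (z : int) : z%:~R = 0 :> K -> z = 0.
  exact: (O_char0 (p := p) (O := O)).
have Kc : [pchar K] =i pred0.
  move=> q; apply/negP => /andP[q_pr /eqP q0].
  by have /K0 : (q : int)%:~R = 0 :> K by []; case: q q_pr {q0}.
pose al := f (nvar 0).
have [|[]] // := I1 (nth 0%N [:: n]) (conj Mn I).
rewrite -[inst _ _]/(fPl n) => /(pf_pl HP)/is_polyP[P Pn].
have t0 : f (hterm (map rat_code P) (nvar 0) none).1.2 = 0.
  have := model_hterm HM (map rat_code P) (nvar 0) none.
  rewrite -/(poly_code P) Pn; case: (hterm _ _ _) => [[a t] d] /= h.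
  have [|[]] // := I2 (nth 0%N [:: n; 0; 0; a; t; d]%N) (conj Mn (conj h I)).
  by rewrite -(gv0 gf) => /fP.
have Qal : evi al (hint (map rat_code P) 1).1.2 = 0.
  by case: (@hterm_val _ f (map rat_code P) (nvar 0) none 1 gf); rewrite ?(gv1 gf) // t0.
have Pal : root (map_poly ratr P) al by move/(hint_root P al K0): Qal; rewrite divr1; apply.
have [Q [Q0 Qa]] : exists Q : {poly int}, Q != 0 /\ evi al Q = 0.
  have [P0|P0] := eqVneq P 0; last by exists (hint (map rat_code P) 1).1.2; rewrite hint_neq0.
  exists 'X; rewrite polyX_eq0 eviX; split=> //; rewrite -(gv0 gf); apply/fP.
  have h : M (fIn 0) by move: Mn; rewrite -Pn P0 /poly_code polyseq0.
  by case: (I0 (nth 0%N [::]) (conj h I)) => [|[]].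
have s0 : simple_ext al 0 by apply: (simple_ext_nat al 0).
have sN s : simple_ext al s -> simple_ext al (- s).
  by move=> h; rewrite -[- s]sub0r; apply: simple_extB.
have sal x : simple_ext al x.
  have [a <-] := fs x; elim/ltn_ind: a {x} => a IH; rewrite -(cpair_unpair a).
  have lt2 := @c2_ltn a.
  have l1 : (0 < c1 a)%N -> (c1 (c2 a) < a)%N by move=> /lt2; apply: leq_ltn_trans; apply: c1_le.
  have l2 : (0 < c1 a)%N -> (c2 (c2 a) < a)%N by move=> /lt2; apply: leq_ltn_trans; apply: c2_le.
  case: (c1 a) lt2 l1 l2 => [|[|[|[|[|[|[|[|[|k]]]]]]]]] lt2 l1 l2.
  - have -> : f (cpair 0 (c2 a)) = al.
      by apply/fP; case: (J0 (nth 0%N [:: 0; 0; c2 a]%N) I) => [|[]].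
    by exists 'X, 1; rewrite eviX rmorph1 oner_neq0 divr1.
  - have -> : f (cpair 1 (c2 a)) = 0; last by [].
      by rewrite -(gv0 gf); apply/fP; case: (J1 (nth 0%N [:: 0; 0; c2 a]%N) I) => [|[]].
  - have -> : f (cpair 2 (c2 a)) = 1; last exact: (simple_ext_nat al 1).
      by rewrite -(gv1 gf); apply/fP; case: (J2 (nth 0%N [:: 0; 0; c2 a]%N) I) => [|[]].
  - rewrite -(cpair_unpair (c2 a)) [f _](gvD gf) -[X in _ + X]opprK.
    by apply: simple_extB; [apply/IH/l1 | apply/sN/IH/l2].
  - by rewrite [f _](gvN gf); apply/sN/IH/lt2.
  - rewrite -(cpair_unpair (c2 a)) [f _](gvM gf).
    by apply: simple_extM; apply: IH; [apply: l1 | apply: l2].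
  - by rewrite [f _]fV; apply/simple_extV/IH/lt2.
  - by rewrite [f _](gvnum gf); apply: simple_ext_nat.
  - have -> : f (cpair 8 (c2 a)) = (idec (c2 a))%:~R by apply: (gvint gf).
    case: (idec _) => m; first exact: simple_ext_nat.
    by rewrite NegzE rmorphN; apply: sN; apply: simple_ext_nat.
  - have -> : f (cpair k.+1.+4.+4 (c2 a)) = 0; last by [].
      by rewrite -(gv0 gf); apply/fP; case: (J9 (nth 0%N [:: 0; k; c2 a]%N) I) => [|[]].
have alg (x : K) : exists2 h : {poly int}, h != 0 & evi x h = 0.
  have [F [G [G0 ->]]] := sal x.
  by have [h [h0 _ hx]] := degree_bound F Kc Q0 Qa (leqnSn _) G0; exists h.
have [v vp vO] := O_valuation p_pr O_1 O_B O_M p0 O_dec O_p alg.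
by exists K, v, P, al, Q.
Qed.

(** * Certificates for zeros in unramified extensions *)

Lemma evi_comp (R : comNzRingType) (x : R) f g : evi x (f \Po g) = evi (evi x g) f.
Proof. by rewrite !eviE map_comp_poly horner_comp. Qed.

Lemma evi_taylor (R : comNzRingType) (f : {poly int}) (x h : R) :
  exists r, evi (x + h) f = evi x f + evi x f^`() * h + h ^+ 2 * r.
Proof.
by have [r E] := poly_taylor (map_poly intr f) x h; exists r; rewrite !eviE -deriv_map.
Qed.

Lemma evi_diff (R : comNzRingType) (f : {poly int}) (x y : R) :
  exists r, evi x f = evi y f + (x - y) * r.
Proof. by have [r E] := poly_diff (map_poly intr f) x y; exists r; rewrite !eviE. Qed.

(* B + p ^ j I Z approximates p ^ k times a zero of P in an unramified field
   generated by a zero of m. *)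
Definition zero_certificate (p : nat) (P : {poly rat}) : Prop :=
  exists (l : seq nat) (j k : nat) (c : int) (Q B I R : {poly int}),
    let m := Poly (map Posz l) in
    [/\ (1 < size l)%N /\ last 0%N l = 1%N,
        exists U G H, U * m^`() = 1 + p%:R * G + m * H,
        exists W H, Q \Po B = p%:R ^+ j.*2.+1 * W + m * H,
        exists W H, (Q^`() \Po B) * I = p%:R ^+ j + p%:R ^+ j.*2.+1 * W + m * H &
        c != 0 /\ c%:P * (hint (map rat_code P) (p%:R ^+ k)).1.2 = Q * R].

Section Unramified.

Variables (p : nat) (K : fieldType) (v : discrete_valuation K).
Hypotheses (p_pr : prime p) (vp : v p%:R = 1) (p0 : p%:R != 0 :> K).

Let p_max : dval_ge v 1 p%:R. Proof. by rewrite /dval_ge vp lexx orbT. Qed.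

Lemma dval_ge_pX n x : dval_ge v n%:Z (p%:R ^+ n * x) = dval_ge v 0 x.
Proof.
have := dval_ge_shift v 0 x (expf_neq0 n p0); rewrite add0r dvalX // vp => <-.
by rewrite -mulr_natr mul1r natz.
Qed.

Lemma dval_ge_pXK n x : dval_ge v n%:Z x -> exists2 y : vring v, dval_ge v 0 (val y) & x = p%:R ^+ n * val y.
Proof.
move=> h; have pn : p%:R ^+ n != 0 :> K by apply: expf_neq0.
have xE : x = p%:R ^+ n * (x / p%:R ^+ n) by rewrite mulrCA divff ?mulr1.
have h' : dval_ge v 0 (x / p%:R ^+ n) by move: h; rewrite {1}xE dval_ge_pX.
by have [y yE] := vring_valK h'; exists y; rewrite yE.
Qed.

Let vD (x y : vring v) : val (x + y) = val x + val y. Proof. by []. Qed.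
Let vM (x y : vring v) : val (x * y) = val x * val y. Proof. by []. Qed.
Let vN (x : vring v) : val (- x) = - val x. Proof. by []. Qed.

Section ResidueGenerator.

Variables (th : residue_field v) (m U G H0 : {poly int}).
Hypotheses (th0 : evi th m = 0)
  (th_ker : forall f, evi th f = 0 -> exists h r, f = m * h + p%:R * r)
  (sep : U * m^`() = 1 + p%:R * G + m * H0)
  (gen : forall y : residue_field v, y = 0 \/ exists i, y = th ^+ i).

Lemma red_evi (x : vring v) f : red (evi x f) = evi (red x) f.
Proof. by rewrite evi_morph. Qed.

(** Newton's iteration, with [U] as approximate inverse of the derivative. The field need not be
    complete, so there are only approximations to each precision, which suffice for a
    certificate. *)
Lemma approximate_root n : exists2 x : vring v, red x = th & dval_ge v n%:Z (val (evi x m)).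
Proof.
elim: n => [|n [x xth xm]].
  by have [x <-] := red_surj th; exists x => //; apply: valP.
have xm1 : dval_ge v 1 (val (evi x m)) by rewrite -red_eq0 red_evi xth th0.
pose h := - (evi x U * evi x m); exists (x + h).
  by rewrite /h rmorphD rmorphN rmorphM /= !red_evi xth th0 mulr0 subr0.
have [r ->] := evi_taylor m x h.
have E : evi x m^`() * evi x U = 1 + p%:R * evi x G + evi x m * evi x H0.
  by have := congr1 (evi x) sep; rewrite !rmorphD !rmorphM rmorph1 rmorph_nat mulrC.
have -> : evi x m + evi x m^`() * h + h ^+ 2 * r = evi x m *
    (- p%:R * evi x G + evi x m * (evi x U ^+ 2 * r - evi x H0)).
  transitivity (evi x m - evi x m * (evi x m^`() * evi x U) + evi x m ^+ 2 * (evi x U ^+ 2 * r)).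
    by rewrite /h; ring.
  by rewrite E; ring.
rewrite vM -addn1 PoszD; apply: dval_geM => //; rewrite vD; apply: dval_geD.
  by rewrite vM vN val_nat; apply: dval_geMl (valP _); apply: dval_geN.
by rewrite vM; apply: dval_geMl (valP _).
Qed.

(** A p-adic expansion: [p] is a uniformizer and every residue is 0 or a power of [th], so 0 and the
    powers of ['X] serve as digits. *)
Lemma approximate_elt (x : vring v) (y : vring v) n : red x = th ->
  exists f, dval_ge v n%:Z (val (y - evi x f)).
Proof.
move=> xth; elim: n => [|n [f hf]]; first by exists 0; apply: valP.
have [z _ zE] := dval_ge_pXK hf.
have [g hg] : exists g, dval_ge v 1 (val (z - evi x g)).
  have [z0|[i zi]] := gen (red z).
    by exists 0; rewrite rmorph0 subr0 -red_eq0 z0.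
  by exists 'X^i; rewrite -red_eq0 rmorphB /= red_evi rmorphXn /= eviX zi xth subrr.
exists (f + p%:R ^+ n * g).
have -> : val (y - evi x (f + p%:R ^+ n * g)) = p%:R ^+ n * val (z - evi x g).
  have -> : evi x (f + p%:R ^+ n * g) = evi x f + p%:R ^+ n * evi x g.
    by rewrite rmorphD rmorphM rmorphXn rmorph_nat.
  rewrite opprD addrA [LHS]vD zE vN vM val_X val_nat.
  by rewrite vD vN mulrDr mulrN.
have [w _ ->] := dval_ge_pXK (n := 1) hg.
by rewrite mulrA -exprD addn1 dval_ge_pX; apply: valP.
Qed.

(** Vanishing in the residue field puts [f] into the ideal of [m] and [p]; as [m] is small at [x],
    the cofactor of [p] vanishes to one order less, and induction applies to it. *)
Lemma evi_ideal (x : vring v) n f : red x = th -> dval_ge v n%:Z (val (evi x m)) ->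
  dval_ge v n%:Z (val (evi x f)) -> exists W H, f = p%:R ^+ n * W + m * H.
Proof.
move=> xth; elim: n f => [|n IH] f xm xf.
  by exists f, 0; rewrite expr0 mul1r mulr0 addr0.
have [|h [r fE]] := th_ker (f := f).
  by apply/eqP; rewrite -xth -red_evi red_eq0; apply: dval_ge_le xf.
have [||W [H rE]] := IH r.
- by apply: dval_ge_le xm; rewrite lez_nat.
- have [w _ wE] : exists2 w : vring v, dval_ge v 0 (val w) &
      p%:R * val (evi x r) = p%:R ^+ n.+1 * val w.
    have fx : evi x f = evi x m * evi x h + p%:R * evi x r.
      by rewrite fE rmorphD !rmorphM rmorph_nat.
    apply: dval_ge_pXK; move: xf; rewrite fx vD !vM val_nat => h'.
    have -> : p%:R * val (evi x r) = val (evi x m) * val (evi x h) +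
      p%:R * val (evi x r) - val (evi x m) * val (evi x h) by rewrite addrC addKr.
    by apply: dval_geB => //; apply: dval_geMl (valP _).
  have -> : val (evi x r) = p%:R ^+ n * val w.
    by apply: (mulfI p0); rewrite wE exprS mulrA.
  by rewrite dval_ge_pX; apply: valP.
by exists W, (h + p%:R * H); rewrite fE rE exprS; ring.
Qed.

(** [j] is the valuation of the derivative at the zero. Precision [2 * j + 1] is what Hensel's lemma
    requires when the derivative is not a unit, and [I] approximates [p ^+ j] divided by the
    derivative. *)
Lemma approximate_zero (Q : {poly int}) (a : vring v) :
  evi (val a) Q = 0 -> evi (val a) Q^`() != 0 ->
  exists (j : nat) (B I : {poly int}),
    (exists W H, Q \Po B = p%:R ^+ j.*2.+1 * W + m * H) /\
    (exists W H, (Q^`() \Po B) * I = p%:R ^+ j + p%:R ^+ j.*2.+1 * W + m * H).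
Proof.
move=> Qa Q'a.
have [j jE] : exists j : nat, v (evi (val a) Q^`()) = j%:Z.
  have := valP (evi a Q^`()); rewrite unfold_in /= val_evi /dval_ge (negPf Q'a) /=.
  by case: (v _) => // j _; exists j.
have [i iE] : exists i : vring v, evi (val a) Q^`() * val i = p%:R ^+ j.
  have [|i iE] := @vring_valK _ v (p%:R ^+ j / evi (val a) Q^`()).
    rewrite /dval_ge dvalM ?dvalV ?invr_eq0 ?expf_neq0 // jE dvalX // vp.
    by rewrite -mulr_natr mul1r natz subrr lexx orbT.
  by exists i; rewrite iE mulrCA divff ?mulr1.
have [x xth xm] := approximate_root j.*2.+1.
have [B hB] := approximate_elt a j.*2.+1 xth.
have [I hI] := approximate_elt i j.*2.+1 xth.
exists j, B, I; split.
  apply: (evi_ideal xth xm); rewrite evi_comp.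
  have [r ->] := evi_diff Q (evi x B) a.
  rewrite vD val_evi Qa add0r vM -opprB vN mulNr; apply: dval_geN.
  by apply: dval_geMl (valP _).
have [|W [H E]] := @evi_ideal x j.*2.+1 ((Q^`() \Po B) * I - p%:R ^+ j) xth xm; last first.
  by exists W, H; rewrite -addrA -E addrC subrK.
have -> : evi x ((Q^`() \Po B) * I - p%:R ^+ j) = evi (evi x B) Q^`() * evi x I - p%:R ^+ j.
  by rewrite rmorphB rmorphM rmorphXn rmorph_nat /= evi_comp.
have [r ->] := evi_diff Q^`() (evi x B) a.
have -> : (evi a Q^`() + (evi x B - a) * r) * evi x I - p%:R ^+ j =
    (evi a Q^`() * i - p%:R ^+ j) - (evi a Q^`() * (i - evi x I) + (a - evi x B) * (r * evi x I)).
  by ring.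
rewrite vD vN [X in X - _](_ : _ = 0); last first.
  by rewrite vD vM vN val_evi iE val_X val_nat subrr.
rewrite sub0r vD; apply/dval_geN/dval_geD; rewrite vM.
  exact: dval_geMr (valP _) hI.
exact: dval_geMl hB (valP _).
Qed.

End ResidueGenerator.

(** Every residue satisfies a relation of degree at most [n], so it is fixed by some Frobenius power
    with exponent at most [n]; the factorial of [n] is a common multiple of these exponents. *)
Lemma exists_parameter n :
  (forall y : vring v, exists2 h : {poly int}, h != 0 /\ (size h <= n.+1)%N & evi (val y) h = 0) ->
  exists (th : residue_field v) (l : seq nat), let m := Poly (map Posz l) in
    [/\ (1 < size l)%N /\ last 0%N l = 1%N, evi th m = 0,
        forall f, evi th f = 0 -> exists h r, f = m * h + p%:R * r,
        exists U G H, U * m^`() = 1 + p%:R * G + m * H &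
        forall y : residue_field v, y = 0 \/ exists i, y = th ^+ i].
Proof.
move=> alg; have pk := residue_pchar p_pr p_max.
have q1 : (1 < p ^ n`!)%N by rewrite -(exp1n n`!) ltn_exp2r ?fact_gt0 // prime_gt1.
have [n' [th [n0 thn gen]]] := exists_generator (residue_field v) q1.
have [l [l1 ll lm l0 lmin]] := exists_min_poly pk n0 thn.
exists th, l; split=> //.
- exact: (min_polyP lm l0 lmin).
- exact: (min_poly_separable pk n0 thn lm l0 lmin).
move=> y; apply: gen; have [x <-] := red_surj y.
have [h [h0 hs] hx] := alg x.
have [N [N0 Nn hN]] := residue_algebraic p_pr p_max p0 (valP x) h0 hx hs.
have xN : red x ^+ (p ^ N) = red x.
  by apply/eqP; rewrite -subr_eq0 -rmorphXn -rmorphB red_eq0 vD val_X.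
have /dvdnP[d ->] : (N %| n`!)%N by rewrite dvdn_fact // N0.
by rewrite mulnC exp_p_iter.
Qed.

Lemma zero_certificate_exists (P : {poly rat}) (al : K) (Q : {poly int}) :
  Q != 0 -> evi al Q = 0 -> root (map_poly ratr P) al ->
  (forall x, simple_ext al x) -> zero_certificate p P.
Proof.
move=> Q0 Qal Pal sal.
have Kc := field_pchar0 p_pr p_max p0; have K0 := pchar0_int Kc.
have alg (x : K) : exists2 h : {poly int}, h != 0 /\ (size h <= (size Q).+1)%N & evi x h = 0.
  have [F [G [G0 ->]]] := sal x.
  by have [h [h0 hs hx]] := degree_bound F Kc Q0 Qal (leqnSn _) G0; exists h.
have [th [l [l1 th0 th_ker [U [G [H0 sep]]] gen]]] := exists_parameter (fun y => alg (val y)).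
(* A power of [p] makes the zero integral; it reappears as the denominator in the certificate. *)
have [k [a aE]] : exists k (a : vring v), val a = p%:R ^+ k * al.
  exists `|v al|%N; apply: vring_valK; rewrite /dval_ge.
  have [->|al0] := eqVneq al 0; first by rewrite mulr0 eqxx.
  rewrite dvalM ?expf_neq0 // dvalX // vp -mulr_natr mul1r natz.
  by apply/orP; right; lia.
(* A relation of least size has nonzero derivative at [a], and it divides every relation of [a] up
   to the constant of pseudo-division. *)
have [S [S0 Sa Smin]] : exists S : {poly int}, [/\ S != 0, evi (val a) S = 0 &
    forall T : {poly int}, (size T < size S)%N -> evi (val a) T = 0 -> T = 0].
  pose C s := `[< exists T : {poly int}, [/\ size T = s, T != 0 & evi (val a) T = 0] >].
  have exC : exists s, C s.
    by have [h [h0 _] ha] := alg (val a); exists (size h); apply/asboolP; exists h.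
  case: (ex_minnP exC) => s /asboolP[T [sT T0 Ta]] smin; exists T; split=> // T' T's T'a.
  apply: contrapT => /eqP T'0; have := smin (size T'); rewrite leqNgt -sT T's.
  by move=> h; suff : false by []; apply: h; apply/asboolP; exists T'.
have S'a : evi (val a) S^`() != 0.
  apply/eqP => S'a; have S'0 := Smin _ (lt_size_deriv S0) S'a.
  have S1 : S = (S`_0)%:P.
    apply/polyP => i; rewrite coefC; case: i => [//|i] /=.
    by have /eqP := congr1 (fun f : {poly int} => f`_i) S'0; rewrite coef_deriv coef0 mulrn_eq0 => /eqP.
  have S00 : S`_0 = 0 by apply: K0; rewrite -(eviC (val a)) -S1.
  by case/eqP: S0; rewrite S1 S00.
have [j [B [I [EB EI]]]] := approximate_zero th0 th_ker sep gen Sa S'a.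
set t := (hint (map rat_code P) (p%:R ^+ k)).1.2.
have ta : evi (val a) t = 0.
  have pk0 : p%:R ^+ k != 0 :> int by rewrite expf_neq0 // pnatr_eq0 -lt0n prime_gt0.
  apply/(hint_root P (val a) K0 pk0); rewrite rmorphXn /= rmorph_nat aE mulrC mulKf //.
  exact: expf_neq0.
have E := Pdiv.Idomain.divp_eq t S.
exists l, j, k, (lead_coef S ^+ Pdiv.Idomain.scalp t S), S, B, I, (Pdiv.Idomain.divp t S).
split=> //; first by exists U, G, H0.
split; first by rewrite expf_neq0 // lead_coef_eq0.
rewrite -/t mul_polyC E mulrC [X in _ + X]Smin ?addr0 ?ltn_modp //.
have tz (d : int) : evi (val a) (d *: t) = 0 by rewrite -mul_polyC rmorphM /= ta mulr0.
by have := congr1 (evi (val a)) E; rewrite tz rmorphD rmorphM /= Sa mulr0 add0r.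
Qed.

End Unramified.

(** * Certificates for zeros as refutations *)

Definition fDer l t := cpair 26 (cpair l t).

(* Equations in the context PP 0 l hold at the zeros of l in the residue field;
   in the context PP 1 (PP l (PP s w)), at the zeros X of l and
   Z of Z + Z ^ 2 s + p w in the valuation ring. *)
Definition zero_rules p : seq rule :=
  let l := PV 0 in let k := PV 1 in let s := PV 2 in let w := PV 3 in
  let t := PV 4 in let u := PV 5 in let n := PV 6 in let B := PV 7 in
  let a := PV 8 in let b := PV 9 in let c := PV 10 in let d := PV 11 in
  let Z := PN nZ in let der l t := pfact 26 (PP l t) in
  let g0 := PP (PN 0) l in let g1 := PP (PN 1) (PP l (PP s w)) in
  [:: ([::], [:: pE g0 (pPol l) pZero]);
      ([::], [:: pE g0 (pNum (PN p)) pZero]);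
      ([::], [:: pE g1 (pPol l) pZero]);
      ([::], [:: pE g1 (pA Z (pA (pM (pM Z Z) s) (pM (pNum (PN p)) w))) pZero]);
      ([::], [:: der (PN 0) pZero]);
      ([:: der l t], [:: der (PS (PP k l)) (pA (pPol l) (pM (PN nX) t))]);
      ([:: pfact 1 n; pfact 24 n; pfact 19 l; der l t; pE g0 (pM u t) pOne;
           pfact 4 (PP n (PP B (PP (pInt (PS a)) (PP b (PP c d)))));
           pE g1 (pM (pInt (PS k)) c) pZero], [::])].

Definition zero_theory p : seq rule :=
  common_rules ++ poly_rules ++ list_rules ++ zero_rules p.

(** One term has to give the remainder in all rings, because it becomes part of the equation for Z
    that defines a context. *)
Lemma taylor_term (Q : {poly int}) b h : exists t, forall (R : comNzRingType) (f : nat -> R),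
  good_val f ->
  evi (f b + f h) Q = evi (f b) Q + evi (f b) Q^`() * f h + f h ^+ 2 * f t.
Proof.
elim/poly_ind: Q => [|Q c [t IH]].
  by exists nzero => R f gf; rewrite deriv0 !rmorph0 (gv0 gf); ring.
exists (nadd (tpoly Q^`() b) (nmul (nadd b h) t)) => R f gf.
rewrite derivMXaddC !rmorphD !rmorphM /= !eviC !eviX IH //.
by rewrite (gvD gf) (gvM gf) (gvD gf) tpoly_val //; ring.
Qed.

Lemma int_code_neq0 z : z != 0 -> exists a, int_code z = a.+1.
Proof. by case: z => [[|m]|m] //= _; [exists m.*2.+1 | exists m.*2]. Qed.

Lemma good_val_quadratic (R : comNzRingType) (f : nat -> R) Z s p w z : good_val f -> f Z = z ->
  f (nadd Z (nadd (nmul (nmul Z Z) s) (nmul (nnum p) w))) =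
  z + (z * z * f s + p%:R * f w).
Proof. by move=> gf <-; rewrite !(gvD gf) !(gvM gf) (gvnum gf). Qed.

Lemma idec_neq0 a : idec a.+1 != 0.
Proof. by case: a => [|a] //; rewrite /idec; case: (odd _). Qed.

(** With [h] standing for [p ^+ j * I * Z], Taylor's formula turns [Q] at [B + h] into [p ^+ j.*2]
    times [Z + Z ^ 2 * s + p * w], where [s] is [I ^ 2 * r] and [w] is [W + p ^+ j * W' * Z]. The
    equation of the context therefore annihilates it, and the last rule applies. *)
Lemma zero_complete p n : prime p -> consistent (unramified_theory p) n ->
  ~ consistent (zero_theory p) n.
Proof.
move=> p_pr /(unramified_field p_pr)[K [v [P [al [Q' [Pn vp Kc [Q'0 Q'al Pal] sal]]]]]].
have Kp : p%:R != 0 :> K.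
  by apply/negP => Kp; have := Kc p; rewrite !inE p_pr Kp.
have [l [j [k [c [Q [B [I [R]]]]]]]] := zero_certificate_exists p_pr vp Kp Q'0 Q'al Pal sal.
case=> -[l1 ll] [U [G [H0 sep]]] [W [H1 EB]] [W' [H2 EI]] [c0 tE] {v vp al Q' Q'0 Q'al Pal sal Kp}.
move=> [M [M0 /Pall_cat[/common_rulesP HM /Pall_cat[/(poly_rulesP HM) HP]]]].
move=> /Pall_cat[/list_rulesP HL [A1 [A2 [A3 [A4 [D0 [DS [F _]]]]]]]] Mn.
pose lc := seq_code l; set m := Poly _ in sep EB EI.
have mE : lpoly lc = m by rewrite /lpoly seq_codeK.
have [dt Mdt dtE] : exists2 t, M (fDer lc t) & forall g (A : comNzRingType) (f : nat -> A),
    good_val f -> (forall a b, M (fE g a b) -> f a = f b) -> f t = evi (f nX) m^`().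
  rewrite -mE /lc; elim: (l) => [|x s [t Mt tV]].
    exists nzero; first by case: (D0 (nth 0%N [::]) Logic.I) => [|[]].
    by move=> g A f gf _; rewrite lpoly0 deriv0 rmorph0 (gv0 gf).
  exists (nadd (npol (seq_code s)) (nmul nX t)).
    case: (DS (nth 0%N [:: seq_code s; x; 0; 0; t]%N) (conj Mt Logic.I)) => [|[]] //.
  move=> g A f gf fP; rewrite (gvD gf) (gvM gf) (tV g) // (list_facts_val _ HL gf fP).
  rewrite lpoly_cons derivD derivC derivM derivX add0r mul1r.
  by rewrite rmorphD rmorphM /= eviX.
have Msep : M (fE (cpair 0 lc) (nmul (tpoly U nX) dt) none).
  apply: (model_eqP HM) => A f gf fP; rewrite (gvM gf) (gv1 gf) tpoly_val // (dtE _ _ _ gf fP).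
  have fm : evi (f nX) m = 0.
    rewrite -mE -(list_facts_val lc HL gf fP) -(gv0 gf); apply: fP.
    by case: (A1 (nth 0%N [:: lc]) Logic.I) => [|[]].
  have fp : p%:R = 0 :> A.
    rewrite -(gvnum gf) -(gv0 gf); apply: fP.
    by case: (A2 (nth 0%N [:: lc]) Logic.I) => [|[]].
  by rewrite -rmorphM sep !rmorphD !rmorphM rmorph1 rmorph_nat /= fm fp !mul0r !addr0.
pose b := tpoly B nX; pose h := nmul (tpoly (p%:R ^+ j * I) nX) nZ.
have [r rE] := taylor_term Q b h.
pose s := nmul (nmul (tpoly I nX) (tpoly I nX)) r.
pose w := nadd (tpoly W nX) (nmul (tpoly (p%:R ^+ j * W') nX) nZ).
pose g := cpair 1 (cpair lc (cpair s w)).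
pose q : int := p%:R ^+ k.
have q0 : q != 0 by rewrite expf_neq0 // pnatr_eq0 -lt0n prime_gt0.
have MH := model_hterm HM (map rat_code P) (nadd b h) (tint q).
set T := hterm _ _ _ in MH.
have Mt : M (fE g (nmul (tint c) T.1.2) nzero).
  apply: (model_eqP HM) => A f gf fP.
  have fq : f (tint q) = q%:~R by rewrite (gvint gf) int_codeK.
  have [_ TE _] := hterm_val (map rat_code P) (nadd b h) gf fq.
  rewrite (gv0 gf) (gvM gf) TE (gvint gf) int_codeK -(eviC (f (nadd b h))) -rmorphM /= tE.
  rewrite rmorphM /=.
  suff -> : evi (f (nadd b h)) Q = 0 by rewrite mul0r.
  have fm : evi (f nX) m = 0.
    rewrite -mE -(list_facts_val lc HL gf fP) -(gv0 gf); apply: fP.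
    by case: (A3 (nth 0%N [:: lc; 0; s; w]%N) Logic.I) => [|[]].
  have fZ : f nZ + (f nZ * f nZ * f s + p%:R * f w) = 0.
    have e : f (nadd nZ (nadd (nmul (nmul nZ nZ) s) (nmul (nnum p) w))) = f nzero.
      apply: fP.
      by case: (A4 (nth 0%N [:: lc; 0; s; w]%N) Logic.I) => [|[]].
    by rewrite -(good_val_quadratic s p w gf (erefl (f nZ))) e; apply: gv0 gf.
  have E1 : evi (f b) Q = p%:R ^+ j.*2.+1 * evi (f nX) W.
    have := congr1 (evi (f nX)) EB.
    by rewrite evi_comp /b tpoly_val // rmorphD !rmorphM rmorphXn rmorph_nat /= fm mul0r addr0.
  have E2 : evi (f b) Q^`() * evi (f nX) I = p%:R ^+ j + p%:R ^+ j.*2.+1 * evi (f nX) W'.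
    have := congr1 (evi (f nX)) EI; rewrite rmorphM /= evi_comp /b tpoly_val //.
    by rewrite !rmorphD !rmorphM !rmorphXn !rmorph_nat /= fm mul0r addr0.
  rewrite (gvD gf) rE // E1.
  have fh : f h = p%:R ^+ j * evi (f nX) I * f nZ.
    by rewrite (gvM gf) tpoly_val // rmorphM rmorphXn rmorph_nat.
  have fs : f s = evi (f nX) I ^+ 2 * f r by rewrite !(gvM gf) tpoly_val // expr2.
  have fw : f w = evi (f nX) W + p%:R ^+ j * evi (f nX) W' * f nZ.
    by rewrite (gvD gf) (gvM gf) !tpoly_val // rmorphM rmorphXn rmorph_nat.
  have pj : p%:R ^+ j.*2.+1 = p%:R * p%:R ^+ j * p%:R ^+ j :> A.
    by rewrite -mulrA -exprD addnn exprS.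
  have -> : evi (f b) Q^`() * f h = p%:R ^+ j * f nZ * (evi (f b) Q^`() * evi (f nX) I).
    by rewrite fh; ring.
  rewrite E2 fh pj.
  transitivity (p%:R ^+ j * p%:R ^+ j * (f nZ + (f nZ * f nZ * f s + p%:R * f w))).
    by rewrite fs fw; ring.
  by rewrite fZ mulr0.
have Mpl : M (fPl n) by apply/(pf_pl HP)/is_polyP; exists P.
have Mmon : M (fMon lc) by apply: (lf_mon HL).
have [c' cE] := int_code_neq0 c0; have [q' qE] := int_code_neq0 q0.
rewrite /tint qE in MH; rewrite /tint cE in Mt; rewrite -/(poly_code P) Pn in MH.
case: (F (nth 0%N [:: lc; c'; s; w; dt; tpoly U nX; n; nadd b h; q'; T.1.1; T.1.2; T.2]%N)).
by do ![split].
Qed.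

(** * Certified zeros in the complete field *)

Section ZeroSound.

Definition zval (R : comNzRingType) (x z : R) : nat -> R :=
  nval (fun=> 0) (fun=> 0) (fun l => evi x (lpoly l)) x z.

Lemma zval_morph (R S : comNzRingType) (phi : {rmorphism R -> S}) x z n :
  phi (zval x z n) = zval (phi x) (phi z) n.
Proof.
rewrite /zval; elim/ltn_ind: n => n IH; rewrite [in LHS]nvalE [RHS]nvalE.
have lt2 := @c2_ltn n.
have l1 : (0 < c1 n)%N -> (c1 (c2 n) < n)%N by move=> /lt2; apply: leq_ltn_trans; apply: c1_le.
have l2 : (0 < c1 n)%N -> (c2 (c2 n) < n)%N by move=> /lt2; apply: leq_ltn_trans; apply: c2_le.
case: (c1 n) lt2 l1 l2 => [|[|[|[|[|[|[|[|[|[|[|[|k]]]]]]]]]]]] lt2 l1 l2;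
  rewrite ?rmorph0 ?rmorph1 //.
- by rewrite rmorphD !IH ?l1 ?l2.
- by rewrite rmorphN IH ?lt2.
- by rewrite rmorphM !IH ?l1 ?l2.
- by rewrite rmorph_nat.
- by rewrite rmorph_int.
- by rewrite evi_morph.
Qed.

Variables (p : nat) (E : fieldType) (v : discrete_valuation E).
Hypotheses (p_pr : prime p) (p_max : dval_ge v 1 p%:R) (p0 : p%:R != 0 :> E)
  (v_complete : dval_complete v)
  (E_roots : forall m : {poly int}, m \is monic -> (1 < size m)%N ->
     exists2 x, dval_ge v 0 x & dval_ge v 1 (evi x m)).

(** Hensel's lemma is applied first to [l] and then, over the root found, to the equation for Z. The
    terms [s] and [w] may contain Z, so they are evaluated as polynomials over the valuation ring;
    at 0 the value is a multiple of [p] and the derivative is congruent to 1. *)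
Lemma solve_equations (l s w : nat) (xb : vring v) :
  dval_ge v 1 (val (evi xb (lpoly l))) -> ~~ dval_ge v 1 (val (evi xb (lpoly l)^`())) ->
  exists x z : vring v, evi x (lpoly l) = 0 /\
    z + (z * z * zval x z s + p%:R * zval x z w) = 0.
Proof.
move=> h h'; have [||x] := hensel v_complete (f := map_poly intr (lpoly l)) (a := xb).
- by rewrite -eviE.
- by rewrite deriv_map -eviE.
rewrite -eviE => x0 _.
pose S := zval x%:P 'X s; pose W := zval x%:P 'X w.
pose g : {poly vring v} := 'X + ('X * 'X * S + p%:R * W).
have [||z gz _] := hensel v_complete (f := g) (a := 0).
- rewrite /g -polyC_natr !(hornerD, hornerM, hornerX, hornerC) !mul0r !add0r.
  by rewrite -[val _]/(val (p%:R : vring v) * val W.[0]) val_nat; apply: dval_geMl (valP _).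
- have -> : g^`().[0] = 1 + p%:R * W^`().[0].
    by rewrite /g -polyC_natr !derivE !hornerE /= !(mul0r, mulr0, add0r, addr0).
  apply/negP => h1; have := dval_gt0N1 v; apply/negP; rewrite negbK.
  have -> : (1 : E) = val (1 + p%:R * W^`().[0]) - p%:R * val W^`().[0].
    rewrite -[val (1 + _)]/(val (1 : vring v) + val (p%:R : vring v) * val W^`().[0]).
    by rewrite val_nat addrK.
  by apply: dval_geB => //; apply: dval_geMl (valP _).
exists x, z; split=> //.
have := gz; rewrite /g -polyC_natr !hornerE.
have ev n : (zval x%:P 'X n).[z] = zval x z n.
  rewrite [LHS](zval_morph (horner_eval z)).
  by congr zval; [apply: hornerC | apply: hornerX].
by rewrite /S /W !ev.
Qed.

(** Contexts with first component 0 are interpreted in the residue field, where invertibility of the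
    derivative of [l] is all that lifting a root needs; the other contexts are interpreted in the
    valuation ring. *)
Lemma zero_sound n : ~ codes poly_code (has_zero E) n -> consistent (zero_theory p) n.
Proof.
move=> nZn; pose k := residue_field v.
have pk : p \in [pchar k] := residue_pchar p_pr p_max.
have E0 := pchar0_int (field_pchar0 p_pr p_max p0).
have gv (R : comNzRingType) (x z : R) : good_val (zval x z) by apply: nval_good.
pose D1 (y : nat) (i : vring v * vring v) := evi i.1 (lpoly (c1 y)) = 0 /\
  i.2 + (i.2 * i.2 * zval i.1 i.2 (c1 (c2 y)) + p%:R * zval i.1 i.2 (c2 (c2 y))) = 0.
pose D0 (y : nat) (i : k * k) := evi i.1 (lpoly y) = 0.
pose EQ g a b := if c1 g is 0 then forall i, D0 (c2 g) i -> zval i.1 i.2 a = zval i.1 i.2 b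
  else forall i, D1 (c2 g) i -> zval i.1 i.2 a = zval i.1 i.2 b.
pose X t y := match t with
  | 1 => y = n
  | 19 => is_mon y
  | 21 => (c1 y + c1 (c2 y))%N = c2 (c2 y)
  | 22 => coprime (c1 y) (c2 y)
  | 23 => is_rat y
  | 24 => is_poly y
  | 26 => forall x z : k, zval x z (c2 y) = evi x (lpoly (c1 y))^`()
  | _ => False end.
pose M := base_fact EQ X.
have ME g a b : M (fE g a b) <-> EQ g a b by rewrite /M base_fE.
have ME0 l a b : M (fE (cpair 0 l) a b) <->
    forall i, D0 l i -> zval i.1 i.2 a = zval i.1 i.2 b by rewrite ME /EQ c1K c2K.
have ME1 l s w a b : M (fE (cpair 1 (cpair l (cpair s w))) a b) <->
    forall i, D1 (cpair l (cpair s w)) i -> zval i.1 i.2 a = zval i.1 i.2 b.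
  by rewrite ME /EQ c1K c2K.
have MI m : M (fIn m) <-> m = n by rewrite /M /base_fact !(c1K, c2K).
have MM l : M (fMon l) <-> is_mon l by rewrite /M /base_fact !(c1K, c2K).
have MD l t : M (fDer l t) <-> forall x z : k, zval x z t = evi x (lpoly l)^`().
  by rewrite /M /base_fact !(c1K, c2K) /= c1K c2K.
have MP : poly_facts M.
  by split=> *; rewrite /M /base_fact !(c1K, c2K) /= ?(c1K, c2K).
have MH s B C ctd : M (fH s B C ctd) -> ctd = hterm (sdec s) B C.
  by rewrite /M /base_fact !(c1K, c2K) => ->; case: ctd => [[]].
have M0 : M 0%N by [].
have fam g : exists (I : Type) (D : I -> Prop) (R : comNzRingType) (f : I -> nat -> R),
     [/\ forall i, good_val (f i), forall i l, f i (npol l) = evi (f i nX) (lpoly l) &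
         forall a b, M (fE g a b) <-> forall i, D i -> f i a = f i b].
  have zp (R : comNzRingType) (i : R * R) l :
      zval i.1 i.2 (npol l) = evi (zval i.1 i.2 nX) (lpoly l).
    by rewrite /zval nval_pol nvalX.
  case cg : (c1 g) => [|t].
    exists (k * k)%type, (D0 (c2 g)), k, (fun i => zval i.1 i.2).
    by split=> // a b; rewrite ME /EQ cg.
  exists (vring v * vring v)%type, (D1 (c2 g)), (vring v), (fun i => zval i.1 i.2).
  by split=> // a b; rewrite ME /EQ cg.
have Mcommon : Pall (rule_ok M) common_rules.
  apply/common_rulesP/base_common => g; have [I [D [R [f [gf _ fP]]]]] := fam g.
  by exists I, D, R, f; split=> // a b; rewrite -fP ME.
have Mpoly : Pall (rule_ok M) poly_rules.
  by apply: poly_rules_ok => // *; rewrite /M /base_fact !(c1K, c2K) /= ?(c1K, c2K).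
have Mlist : Pall (rule_ok M) list_rules by apply: list_rules_ok.
clearbody M.
exists M; last exact/MI.
split=> //; do ![apply/Pall_cat; split=> //].
do ![split]; move=> e /=.
- move=> _; left; apply/ME0 => i Di.
  by rewrite [RHS](gv0 (gv _ _ _)) /zval nval_pol.
- move=> _; left; apply: (ME0 _ (nnum p) nzero).2 => i Di.
  by rewrite (gvnum (gv _ _ _)) (gv0 (gv _ _ _)) pcharf0.
- move=> _; left; apply/ME1 => i [Di _].
  by rewrite [RHS](gv0 (gv _ _ _)) /zval nval_pol; move: Di; rewrite c1K.
- move=> _; left; apply/ME1 => i [_ Di].
  move: Di; rewrite c2K c1K c2K => Di.
  have ZE : zval i.1 i.2 nZ = i.2 by rewrite /zval nvalZ.
  have gi := gv _ i.1 i.2.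
  exact: (etrans (good_val_quadratic _ p _ gi ZE) (etrans Di (esym (gv0 gi)))).
- move=> _; left; apply: (MD 0%N nzero).2 => x z.
  by rewrite (gv0 (gv _ _ _)) lpoly0 deriv0 rmorph0.
- case=> /MD h _; left; apply/MD => x z.
  rewrite (gvD (gv _ _ _)) (gvM (gv _ _ _)) h lpoly_cons derivD derivC derivM derivX add0r mul1r.
  by rewrite rmorphD rmorphM /= eviX /zval nval_pol nvalX.
(* The last rule would produce a zero: a root of [l] in the residue field is simple and lifts, the
   equation for Z is solved over it, and the nonzero factor in front of the numerator cancels in
   characteristic 0. *)
case=> /MI -> [/(pf_pl MP)/is_polyP[P Pn]] [/MM[lm l1]] [/MD dt] [/ME0 ut].
case=> [mh [/ME1 ct _]].
have /MH hE : M (fH n (e 7%N) (nint (e 8%N).+1) (e 9%N, e 10%N, e 11%N)) by [].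
have [xb xb0 xbm] := E_roots lm l1; have [x xE] := vring_valK xb0.
have [||y [z [yl yz]]] := @solve_equations (e 0%N) (e 2%N) (e 3%N) x.
- by rewrite val_evi xE.
- rewrite -red_eq0 red_evi; apply/eqP => m0.
  have := ut (red x, 0); rewrite /D0 /= -red_evi => /(_ _)/wrap[].
    by apply/eqP; rewrite red_eq0 val_evi xE.
  rewrite (gvM (gv _ _ _)) (gv1 (gv _ _ _)) dt m0 mulr0 => /esym/eqP.
  by rewrite oner_eq0.
have := ct (y, z); rewrite /D1 /= !(c1K, c2K) => /(_ (conj yl yz)).
rewrite (gvM (gv _ _ _)) (gvint (gv _ _ _)) (gv0 (gv _ _ _)) => cT.
have fC : zval y z (nint (e 8%N).+1) = (idec (e 8%N).+1)%:~R by rewrite (gvint (gv _ _ _)).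
have [_ + _] := hterm_val (map rat_code P) (e 7%N) (gv _ y z) fC.
rewrite -Pn seq_codeK in hE; rewrite -hE /= => TE.
have T0 : evi (val (zval y z (e 7%N))) (hint (map rat_code P) (idec (e 8%N).+1)).1.2 = 0.
  rewrite -val_evi -TE; have /eqP := congr1 val cT.
  rewrite -[val (_ * _)]/(val (_%:~R : vring v) * val (zval y z (e 10%N))) mulf_eq0.
  rewrite -[val _%:~R]/(val ((idec (e 1%N).+1)%:~R : vring v)) (rmorph_int val).
  by case/orP=> /eqP // /E0/eqP; rewrite (negPf (idec_neq0 _)).
apply: nZn; exists P => //; exists (val (zval y z (e 7%N)) / (idec (e 8%N).+1)%:~R).
by apply/(hint_root P _ E0) => //; apply: idec_neq0.
Qed.

End ZeroSound.

(** Again a circle: a zero in [E] makes [unramified_theory] consistent, this makes [zero_theory]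
    inconsistent, and this yields a zero in [E]. *)
Lemma decidable_has_zero p A (E : fieldType) (v : discrete_valuation E) : prime p ->
  twisted_field p A v -> decidable_set (codes poly_code (has_zero E)).
Proof.
move=> p_pr TF; have [vp p0] := twisted_dval_p (prime_gt0 p_pr) TF.
have p_max := dval_ge1_p p_pr vp.
have [pi [c [v_complete E_roots [_ vpi piE c0 c_trans] _]]] := TF.
have A1 n := @unramified_consistent p E v pi c p_pr vp p0 vpi piE c0 c_trans n.
have A2 n := @zero_complete p n p_pr.
have A3 n := @zero_sound p E v p_pr p_max p0 v_complete E_roots n.
apply: (@decidable_of_theories (unramified_theory p) (zero_theory p)) => n.
  split=> [/A1 //|/A2 h]; apply: contrapT => /A3; exact: h.
split=> [/A1/A2 //|h]; apply: contrapT => /A3; exact: h.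
Qed.

Theorem theorem5p1 (p : nat) (p_prime : prime p) :
  exists (E : fieldType) (v : discrete_valuation E),
    [/\ dval_complete v,
        [pchar E] =i pred0,
        p \in [pchar (residue_field v)]
      & [/\ decidable_set
              (codes formula_code (existential_theory (residue_field v))),
            ~ decidable_set (codes formula_code (existential_theory E))
          & decidable_set (codes poly_code (has_zero E))]].
Proof.
have [A [E [v [TF undec]]]] := undecidable_twisted_field p_prime.
have [vp p0] := twisted_dval_p (prime_gt0 p_prime) TF.
have p_max := dval_ge1_p p_prime vp.
have [pi [c [v_complete E_roots _ _]]] := TF.
exists E, v; split=> //; first exact: field_pchar0 p_prime p_max p0.
  exact: residue_pchar p_prime p_max.
split=> //; last exact: decidable_has_zero TF.
apply: (decidable_existential_theory p_prime (residue_pchar p_prime p_max)) => m lm m1.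
have [x /vring_valK[y <-] xm] := E_roots m lm m1; exists (red y).
by apply/eqP; rewrite -red_evi red_eq0 val_evi.
Qed.
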